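(* Let $n\ge1$, let $p_t(r,\theta)$ be the subelliptic heat kernel on $\mathbb{S}^{2n+1}$ issued from the north pole, and let $q_t$ be the Riemannian heat kernel on $\mathbb{S}^{2n+1}$, regarded as a function of the cosine of the Riemannian distance and extended to real arguments $x$ (also $x>1$) by $$q_t(x)=\frac{\Gamma(n)}{2\pi^{n+1}}\sum_{m=0}^{+\infty}(m+n)e^{-m(m+2n)t}C_m^n(x).$$ For $t>0$, $r\in[0,\pi/2)$, $\theta\in[-\pi,\pi]$, $$p_t(r,\theta)=\frac{1}{\sqrt{4\pi t}}\int_{-\infty}^{+\infty}e^{-\frac{(y+i\theta)^2}{4t}}\,q_t(\cos r\cosh y)\,dy.$$
   Context: $\mathbb{S}^{2n+1}=\{z\in\mathbb{C}^{n+1}:\|z\|=1\}$ and the sub-Laplacian is $L=2\sum_{j=1}^{n+1}(T_j\overline{T_j}+\overline{T_j}T_j)$ with $T_j=\frac{\partial}{\partial z_j}-\overline{z_j}\mathcal{S}$, $\mathcal{S}=\sum_{k=1}^{n+1}z_k\frac{\partial}{\partial z_k}$; equivalently $L=\Delta-T^2$, where $\Delta$ is the Laplace-Beltrami operator of the round metric and $Tf(z)=\frac{d}{d\theta}f(e^{i\theta}z)|_{\theta=0}$. The uniform (Riemannian) measure $\mu$ is normalized so that $\mu(\mathbb{S}^{2n+1})=\frac{2\pi^{n+1}}{\Gamma(n+1)}$. Cylindrical coordinates: a point with $z_{n+1}\ne0$ is written $z=\frac{1}{\sqrt{1+\rho^2}}(w_1e^{i\theta},\dots,w_ne^{i\theta},e^{i\theta})$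 with $w\in\mathbb{C}^n$, $\rho^2=\sum|w_j|^2$, and $r\in[0,\pi/2)$ is defined by $\rho=\tan r$, so $z_{n+1}=\cos r\,e^{i\theta}$. The north pole is $N=(0,\dots,0,1)$. The kernel of $e^{tL}$ issued from $N$, i.e. the smooth function $p_t$ with $(e^{tL}f)(N)=\int p_t f\,d\mu$, depends only on $(r,\theta)$ and is denoted $p_t(r,\theta)$. $C_m^n$ is the Gegenbauer polynomial $$C_m^n(x)=\frac{(-1)^m}{2^m}\frac{\Gamma(m+2n)\Gamma(n+1/2)}{\Gamma(2n)\Gamma(m+1)\Gamma(n+m+1/2)}\frac{1}{(1-x^2)^{n-1/2}}\frac{d^m}{dx^m}(1-x^2)^{n+m-1/2};$$ $q_t(\cos\delta)$ is the kernel of $e^{t\Delta}$ at a point at Riemannian distance $\delta$ from the north pole (where $\cos\delta=\cos r\cos\theta$). *)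

(* Defs.v *)
From HB Require Import structures.
From mathcomp Require Import all_boot all_order all_algebra.
From mathcomp Require Import complex.
From mathcomp Require Import all_classical all_reals all_analysis.

Set Implicit Arguments.
Unset Strict Implicit.
Unset Printing Implicit Defensive.

Import Order.TTheory GRing.Theory Num.Theory.
Import numFieldNormedType.Exports.

Local Open Scope classical_set_scope.
Local Open Scope ring_scope.
Local Open Scope complex_scope.

Section RealAndComplexFunctions.
Variable R : realType.

(* Euler's integral; only used for x > 0, where it converges. *)
Definition Gamma (x : R) : R :=
  \int[lebesgue_measure]_(s in `]0%R, +oo[) (s `^ (x - 1) * expR (- s)).

Definition cosh (y : R) : R := (expR y + expR (- y)) / 2.

Definition cexp (z : R[i]) : R[i] :=
  (expR (complex.Re z))%:C * (cos (complex.Im z) +i* sin (complex.Im z)).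

Definition cintegrable d (T : measurableType d)
    (mu : {measure set T -> \bar R}) (D : set T) (f : T -> R[i]) : Prop :=
  mu.-integrable D (fun x => (complex.Re (f x))%:E) /\
  mu.-integrable D (fun x => (complex.Im (f x))%:E).

Definition cintegral d (T : measurableType d)
    (mu : {measure set T -> \bar R}) (D : set T) (f : T -> R[i]) : R[i] :=
  (\int[mu]_(x in D) complex.Re (f x)) +i* (\int[mu]_(x in D) complex.Im (f x)).

End RealAndComplexFunctions.

Section RiemannianKernel.
Variables (R : realType) (n : nat).

(* Rodrigues' formula for the Gegenbauer polynomial C_m^n.  As a formula on
   reals it is meaningful on ]-1, 1[ only: `^ is not the power of a negative
   real. *)
Definition rodrigues (m : nat) (x : R) : R :=
  (-1) ^+ m / 2 ^+ m *
  (Gamma (m%:R + 2 * n%:R) * Gamma (n%:R + 2^-1) /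
   (Gamma (2 * n%:R) * Gamma (m%:R + 1) * Gamma (n%:R + m%:R + 2^-1))) *
  ((1 - x ^+ 2) `^ (n%:R - 2^-1))^-1 *
  derive1n m (fun u : R => (1 - u ^+ 2) `^ (n%:R + m%:R - 2^-1)) x.

(* The polynomial given by Rodrigues' formula on ]-1, 1[, which makes sense at
   every real number. *)
Definition gegenbauer (m : nat) : {poly R} :=
  xget 0 [set P | forall x : R, -1 < x < 1 -> P.[x] = rodrigues m x].

Definition riemannian_term (t x : R) (m : nat) : R :=
  (m%:R + n%:R) * expR (- (m%:R * (m%:R + 2 * n%:R) * t)) *
  (gegenbauer m).[x].

Definition riemannian_kernel (t x : R) : R :=
  Gamma n%:R / (2 * pi ^+ n.+1) * limn (series (riemannian_term t x)).

End RiemannianKernel.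

Section Sphere.
Variables (R : realType) (n : nat).

(* C^{n+1} as a real normed space: (x, y) stands for x + i y.  The library norm
   on this type is not the Euclidean one, but induces the same topology. *)
Definition Cvec : normedModType R := ('rV[R]_n.+1 * 'rV[R]_n.+1)%type.

Definition zcoord (v : Cvec) (j : 'I_n.+1) : R[i] := v.1 ord0 j +i* v.2 ord0 j.

Definition sqnorm (v : Cvec) : R :=
  \sum_(j < n.+1) ((v.1 ord0 j) ^+ 2 + (v.2 ord0 j) ^+ 2).

Definition sphere : set Cvec := [set v | sqnorm v = 1].

(* set_type carries the subspace topology. *)
Definition sphereT : Type := set_type sphere.
HB.instance Definition _ := SubType.on sphereT.
HB.instance Definition _ := Topological.copy sphereT (set_type sphere).

Definition north_vec : Cvec := (delta_mx ord0 ord_max, 0).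

Lemma north_sphere : north_vec \in sphere.
Proof.
apply/mem_set; rewrite /sphere /= /sqnorm (bigD1 ord_max) //= big1.
  by rewrite !mxE !eqxx expr1n expr0n /= !addr0.
by move=> j jN; rewrite !mxE eqxx (negbTE jN) /= expr0n /= addr0.
Qed.

Definition north : sphereT := exist _ north_vec north_sphere.

HB.instance Definition _ := isPointed.Build sphereT north.

(* v |-> v / |v| on C^{n+1} minus the origin *)
Definition radial_proj (v : Cvec) : sphereT :=
  insubd north ((Num.sqrt (sqnorm v))^-1 *: v).

(* the extension of f which is homogeneous of degree 0 *)
Definition ext (f : sphereT -> R[i]) : Cvec -> R[i] :=
  fun v => f (radial_proj v).

Definition ccontinuous (f : sphereT -> R[i]) : Prop :=
  continuous (fun x => complex.Re (f x) : R) /\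
  continuous (fun x => complex.Im (f x) : R).

Definition iter_derive (s : seq Cvec) (g : Cvec -> R) : Cvec -> R :=
  foldr (fun v h => fun x => 'D_v h x) g s.

Definition smooth_off0 (g : Cvec -> R) : Prop :=
  forall (s : seq Cvec) (x : Cvec), x != 0 ->
    (forall v, derivable (iter_derive s g) x v) /\
    {for x, continuous (iter_derive s g)}.

(* C^oo functions on the sphere *)
Definition csmooth (f : sphereT -> R[i]) : Prop :=
  smooth_off0 (fun v => complex.Re (ext f v)) /\
  smooth_off0 (fun v => complex.Im (ext f v)).

Definition cderive (v : Cvec) (F : Cvec -> R[i]) (x : Cvec) : R[i] :=
  ('D_v (fun y => complex.Re (F y) : R) x) +i*
  ('D_v (fun y => complex.Im (F y) : R) x).

Definition xdir (j : 'I_n.+1) : Cvec := (delta_mx ord0 j, 0).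
Definition ydir (j : 'I_n.+1) : Cvec := (0, delta_mx ord0 j).

(* d/dz_j = (d/dx_j - i d/dy_j) / 2 and d/dzbar_j = (d/dx_j + i d/dy_j) / 2 *)
Definition dz (j : 'I_n.+1) (F : Cvec -> R[i]) (x : Cvec) : R[i] :=
  (cderive (xdir j) F x - 'i * cderive (ydir j) F x) / 2.
Definition dzbar (j : 'I_n.+1) (F : Cvec -> R[i]) (x : Cvec) : R[i] :=
  (cderive (xdir j) F x + 'i * cderive (ydir j) F x) / 2.

Definition Sop (F : Cvec -> R[i]) (x : Cvec) : R[i] :=
  \sum_(k < n.+1) zcoord x k * dz k F x.
Definition Sbarop (F : Cvec -> R[i]) (x : Cvec) : R[i] :=
  \sum_(k < n.+1) (zcoord x k)^* * dzbar k F x.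

Definition Top (j : 'I_n.+1) (F : Cvec -> R[i]) (x : Cvec) : R[i] :=
  dz j F x - (zcoord x j)^* * Sop F x.
Definition Tbarop (j : 'I_n.+1) (F : Cvec -> R[i]) (x : Cvec) : R[i] :=
  dzbar j F x - zcoord x j * Sbarop F x.

(* T_j and its conjugate are tangent to the sphere, so on the sphere the result
   does not depend on the chosen extension of f. *)
Definition subLaplacian (f : sphereT -> R[i]) (x : sphereT) : R[i] :=
  2 * \sum_(j < n.+1) (Top j (Tbarop j (ext f)) (val x) +
                       Tbarop j (Top j (ext f)) (val x)).

Definition sphere_borel := g_sigma_algebraType (@open sphereT).

(* The uniform measure: the Borel measure invariant under all linear isometries
   of C^{n+1} = R^{2n+2}, with the total mass of the Riemannian measure. *)
Definition is_uniform (mu : {measure set sphere_borel -> \bar R}) : Prop :=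
  mu setT = (2 * pi ^+ n.+1 / Gamma (n%:R + 1))%:E /\
  forall phi : {linear Cvec -> Cvec},
    (forall v, sqnorm (phi v) = sqnorm v) ->
    forall A : set sphere_borel, measurable A ->
      mu ((fun x : sphereT => radial_proj (phi (val x))) @^-1` A) = mu A.

(* E is (e^{tL})_{t >= 0}: the strongly continuous contraction semigroup on the
   Banach space C(sphere) with the sup norm whose generator is given by L on
   C^oo functions.  As C^oo is a core (L is essentially self-adjoint and
   hypoelliptic), this determines E t f for all t >= 0 and f continuous. *)
Record is_heat_semigroup (E : R -> (sphereT -> R[i]) -> (sphereT -> R[i]))
    : Prop := IsHeatSemigroup {
  hs_continuous : forall (t : R) f, 0 <= t -> ccontinuous f -> ccontinuous (E t f);
  hs_linear : forall (t : R) (a : R[i]) f g, 0 <= t ->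
    ccontinuous f -> ccontinuous g ->
    E t (fun x => a * f x + g x) = (fun x => a * E t f x + E t g x);
  hs_contraction : forall (t : R) f (M : R), 0 <= t -> ccontinuous f ->
    (forall x, `|f x| <= M%:C) -> forall x, `|E t f x| <= M%:C;
  hs_zero : forall f, ccontinuous f -> E 0 f = f;
  hs_add : forall (s t : R) f, 0 <= s -> 0 <= t -> ccontinuous f ->
    E (s + t) f = E s (E t f);
  hs_strong : forall f, ccontinuous f -> forall eps : R, 0 < eps ->
    \forall t \near 0^'+, forall x, `|E t f x - f x| <= eps%:C;
  hs_generator : forall f, csmooth f -> forall eps : R, 0 < eps ->
    \forall t \near 0^'+, forall x,
      `|(t%:C)^-1 * (E t f x - f x) - subLaplacian f x| <= eps%:C
}.

(* p t is the kernel of e^{tL} issued from the north pole *)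
Definition is_heat_kernel (mu : {measure set sphere_borel -> \bar R})
    (E : R -> (sphereT -> R[i]) -> (sphereT -> R[i]))
    (p : R -> sphereT -> R[i]) : Prop :=
  forall t, 0 < t ->
    csmooth (p t) /\
    forall f, ccontinuous f ->
      E t f north = cintegral mu setT (fun x => p t x * f x).

Definition rho (w : 'rV[R[i]]_n) : R :=
  Num.sqrt (\sum_(j < n) (complex.Re (w ord0 j) ^+ 2 +
                          complex.Im (w ord0 j) ^+ 2)).

(* (w_1 e^{i theta}, ..., w_n e^{i theta}, e^{i theta}) / sqrt (1 + rho^2) *)
Definition cylindrical (w : 'rV[R[i]]_n) (theta : R) (j : 'I_n.+1) : R[i] :=
  ((Num.sqrt (1 + rho w ^+ 2))^-1)%:C *
  (if unlift ord_max j is Some k then w ord0 k else 1) * cexp ('i * theta%:C).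

End Sphere.

Arguments north {R n}.

(* Main.v *)
(** Every C_m^n is a spherical harmonic: integrating by parts along rotations
gives the orthogonality and the reproducing property of the zonal functions
x |-> C_m^n(<x, y>) on S^(2n+1).  With u = <x, y> the Hermitian product,
C_m^n(Re u) splits into components homogeneous of bidegree, indexed by the
weight k - m of the rotation z |-> e^(i theta) z; the component of weight k - m
is an eigenfunction of L with eigenvalue -m(m + 2n) + (k - m)^2.  A semigroup
acts on an eigenfunction of its generator by the exponential, so p_t and
[sum_m (m + n) Gamma(n) / (2 pi^(n+1)) e^(-m(m+2n)t) sum_k e^((k-m)^2 t) F_(m,k)]
have the same integrals against all zonal polynomials, hence coincide.  On the
other side C_m^n(cos r cosh y) = sum_k e^((k-m)y) b_(m,k), and shifting the
contour in the Gaussian integral turns e^((k-m)y) into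
sqrt(4 pi t) e^((k-m)^2 t) e^(-i(k-m) theta), which gives the same series. *)

Require Import Defs.
From HB Require Import structures.
From mathcomp Require Import all_boot all_order all_algebra.
From mathcomp Require Import complex zify ring lra.
From mathcomp Require Import all_classical all_reals all_analysis measurable_realfun.

Set Implicit Arguments.
Unset Strict Implicit.
Unset Printing Implicit Defensive.

Import Order.TTheory GRing.Theory Num.Theory.
Import numFieldNormedType.Exports.

Local Open Scope classical_set_scope.
Local Open Scope ring_scope.
Local Open Scope complex_scope.

(** * Gegenbauer polynomials *)

(** The factors e^((k-m)^2 t) grow like e^(m^2 t), so convergence of either series is the central
    concern. The rescue is |k - m| <= m. On the spectral side it gives m(m+2n) - (k-m)^2 >= 2nm; on
    the integral side the Gaussian in y costs at most e^(m^2 t) against e^(m|y|). Either way a decay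
    linear in m remains. It beats the polynomial growth of C_m^n(1), which bounds |C_m^n| on [-1, 1]
    and, after a discrete Fourier transform, every bidegree component. Three objects are known only
    indirectly. Rodrigues' formula is meaningful only on ]-1, 1[, so a three-term recursion replaces
    it and is identified with it through the differential equation and the value at 1. The measure
    is known by its mass and its invariance, so integrals come from reflections and rotations,
    without coordinates. The semigroup is abstract, and its action on an eigenfunction comes from
    cutting time into short steps. That zonal polynomials separate functions follows from one
    integral recursion: the powers of (1 + <x, b>)/2 concentrate at b. *)

Lemma eq_of_subr (V : zmodType) (a b c d : V) : c = d -> a - b = c - d -> a = b.
Proof. by move=> ->; rewrite subrr => /eqP; rewrite subr_eq0 => /eqP. Qed.

Section GegenbauerPolynomials.
Variables (R : realType) (n : nat).
Hypothesis hn : (1 <= n)%N.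

(* (C_m^n, C_(m-1)^n), with 0 for C_(-1)^n. *)
Fixpoint geg_pair (m : nat) : {poly R} * {poly R} :=
  if m is k.+1 then
    let: (g1, g0) := geg_pair k in
    ((k.+1%:R)^-1 *: ((2 * (k%:R + n%:R)) *: ('X * g1) -
                     (k%:R + 2 * n%:R - 1) *: g0), g1)
  else (1, 0).

Definition geg m := (geg_pair m).1.
Definition geg_prev m := (geg_pair m).2.

Lemma geg0 : geg 0 = 1. Proof. by []. Qed.

Lemma geg_prev0 : geg_prev 0 = 0. Proof. by []. Qed.

Lemma geg_prevS m : geg_prev m.+1 = geg m.
Proof. by rewrite /geg /geg_prev /=; case: (geg_pair m). Qed.

Lemma geg_rec m : (m.+1%:R) *: geg m.+1 =
  (2 * (m%:R + n%:R)) *: ('X * geg m) - (m%:R + 2 * n%:R - 1) *: geg_prev m.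
Proof.
rewrite /geg /geg_prev /=; case: (geg_pair m) => g1 g0 /=.
by rewrite scalerA divff ?scale1r// pnatr_eq0.
Qed.

(** The two relations are proved together because each feeds the other: the second at m + 1 is the
    derivative of the recursion combined with the first at m, and the first at m + 1 then uses
    both. *)
Lemma geg_deriv m :
  'X * (geg m)^`() - (geg_prev m)^`() = m%:R *: geg m /\
  (geg m)^`() - 'X * (geg_prev m)^`() =
     (m%:R + 2 * n%:R - 1) *: geg_prev m.
Proof.
elim: m => [|m [B C]].
  by rewrite geg0 geg_prev0 derivC deriv0 scale0r scaler0 !mulr0 !subr0.
have C' : (geg m.+1)^`() - 'X * (geg m)^`() =
          (m.+1%:R + 2 * n%:R - 1) *: geg m.
  have m0 : (m.+1%:R : R) != 0 by rewrite pnatr_eq0.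
  apply: (scalerI m0); rewrite scalerBr -derivZ geg_rec.
  have e : (geg_prev m)^`() = 'X * (geg m)^`() - m%:R *: geg m by rewrite -B subKr.
  rewrite derivB !derivZ derivM derivX mul1r e -!mul_polyC.
  rewrite !(polyCM, polyCD, polyCB, polyC_natr, polyCN) -natr1. ring.
split; rewrite geg_prevS; last exact: C'.
have e1 : (geg m)^`() = 'X * (geg_prev m)^`() +
   (m%:R + 2 * n%:R - 1) *: geg_prev m by rewrite -C addrC subrK.
have e2 : (geg m.+1)^`() = 'X * (geg m)^`() + (m.+1%:R + 2 * n%:R - 1) *: geg m.
  by rewrite -C' addrC subrK.
have e3 : (geg_prev m)^`() = 'X * (geg m)^`() - m%:R *: geg m by rewrite -B subKr.
rewrite geg_rec.
have e4 : (geg m)^`() = 'X * ('X * (geg m)^`() - m%:R *: geg m) +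
   (m%:R + 2 * n%:R - 1) *: geg_prev m by rewrite -e3.
rewrite e2 {2}e4 -!mul_polyC.
rewrite !(polyCM, polyCD, polyCB, polyC_natr, polyCN) -natr1. ring.
Qed.

Lemma geg_derivB m : 'X * (geg m)^`() - (geg_prev m)^`() = m%:R *: geg m.
Proof. by have [] := geg_deriv m. Qed.

Lemma geg_derivC m : (geg m)^`() - 'X * (geg_prev m)^`() =
     (m%:R + 2 * n%:R - 1) *: geg_prev m.
Proof. by have [] := geg_deriv m. Qed.

Lemma geg_derivA m : (1 - 'X^2) * (geg m)^`() =
  (m%:R + 2 * n%:R - 1) *: geg_prev m - m%:R *: ('X * geg m).
Proof. by rewrite -geg_derivC [m%:R *: _]scalerAr -geg_derivB; ring. Qed.

(** Iterated, this expands C_m' over C_(m-1), C_(m-3), ..., which turns every integral involving a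
    derivative into integrals of products of Gegenbauer polynomials. *)
Lemma geg_derivE m : (geg m.+1)^`() - (geg_prev m)^`() =
  (2 * (m%:R + n%:R)) *: geg m.
Proof.
have := geg_derivC m.+1; have := geg_derivB m; rewrite geg_prevS => B C.
have -> : (geg m.+1)^`() - (geg_prev m)^`() =
  ((geg m.+1)^`() - 'X * (geg m)^`()) + ('X * (geg m)^`() - (geg_prev m)^`()) by ring.
rewrite B C -scalerDl -natr1; congr (_ *: _); ring.
Qed.

Lemma geg_ode m : (1 - 'X^2) * (geg m)^`()^`() -
  (2 * n%:R + 1) *: ('X * (geg m)^`()) = - ((m%:R * (m%:R + 2 * n%:R)) *: geg m).
Proof.
have := congr1 (@deriv R) (geg_derivA m).
rewrite derivM derivB derivXn derivC sub0r derivB !derivZ derivM derivX mul1r.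
have e : (geg_prev m)^`() = 'X * (geg m)^`() - m%:R *: geg m by rewrite -geg_derivB subKr.
rewrite e /= expr1 => h.
have {h} -> : (1 - 'X^2) * (geg m)^`()^`() =
 (m%:R + 2 * n%:R - 1) *: ('X * (geg m)^`() - m%:R *: geg m) -
    m%:R *: (geg m + 'X * (geg m)^`()) + 'X *+ 2 * (geg m)^`().
  by rewrite -h; ring.
rewrite -!mul_polyC.
by rewrite !(polyCM, polyCD, polyCB, polyC_natr, polyCN, polyC1); ring.
Qed.

(** The relation [geg_derivA] at the point 1, where 1 - x^2 kills the derivative. *)
Lemma geg_at1 m : (m.+1%:R) * (geg m.+1).[1] = (m%:R + 2 * n%:R) * (geg m).[1] .
Proof.
have := congr1 (fun p : {poly R} => p.[1]) (geg_derivA m.+1).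
rewrite geg_prevS hornerM hornerD hornerN hornerC hornerXn expr1n subrr mul0r.
rewrite hornerD hornerN !hornerZ hornerM hornerX mul1r => /esym/eqP.
rewrite subr_eq0 => /eqP <-; rewrite -(natr1 m); ring.
Qed.

Lemma geg_at1_gt0 m : 0 < (geg m).[1].
Proof.
elim: m => [|m IH]; first by rewrite geg0 hornerE.
rewrite -(pmulr_rgt0 _ (_ : 0 < m.+1%:R)) ?ltr0n// geg_at1 mulr_gt0//.
by rewrite ltr_wpDl// mulr_gt0// ltr0n.
Qed.

(** Any polynomial growth in m is enough for the convergence of the series below. *)
Lemma geg_at1_le m : (geg m).[1] <= (m.+1%:R) ^+ (2 * n).
Proof.
elim: m => [|m IH]; first by rewrite geg0 hornerE expr1n.
have m0 : 0 < m.+1%:R :> R by rewrite ltr0n.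
rewrite -(ler_pM2l m0) geg_at1.
(* Bernoulli's inequality at 1/(m + 1), used with exponent 2n - 1 because m + 2n = (m + 1)(1 + (2n -
   1)/(m + 1)). *)
have B : forall k : nat, 1 + k%:R / m.+1%:R <= (m.+2%:R / m.+1%:R) ^+ k :> R.
  elim=> [|k IHk]; first by rewrite mul0r addr0 expr0.
  rewrite exprS; apply: (le_trans _ (ler_wpM2l _ IHk)); last first.
    by rewrite divr_ge0.
  rewrite -(ler_pM2r m0) -(ler_pM2r m0).
  have -> : (1 + k.+1%:R / m.+1%:R) * m.+1%:R * m.+1%:R = (m.+1%:R + k.+1%:R) * m.+1%:R :> R.
    by field; rewrite addrC natr1 gt_eqF.
  have -> : m.+2%:R / m.+1%:R * (1 + k%:R / m.+1%:R) * m.+1%:R * m.+1%:R =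
    m.+2%:R * (m.+1%:R + k%:R) :> R.
    by field; rewrite addrC natr1 gt_eqF.
  rewrite -!natrD -!natrM ler_nat; nia.
apply: le_trans (_ : (m%:R + 2 * n%:R) * m.+1%:R ^+ (2 * n) <= _).
  by rewrite ler_wpM2l// addr_ge0// mulr_ge0.
have := ler_wpM2l (ltW m0) (B (2 * n).-1).
have -> : m.+1%:R * (1 + (2 * n).-1%:R / m.+1%:R) = m%:R + 2 * n%:R :> R.
  have -> : (2 * n).-1%:R = 2 * n%:R - 1 :> R.
    by rewrite -subn1 natrB ?natrM//; lia.
  by field; rewrite addrC natr1 gt_eqF.
move=> h; apply: le_trans (ler_wpM2r _ h) _; first by rewrite exprn_ge0.
have -> : (2 * n = (2 * n).-1.+1)%N by lia.
rewrite succnK expr_div_n exprS.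
set k := (_).-1.
rewrite -mulrA ler_wpM2l ?ltW// mulrCA mulfVK ?expf_neq0 ?gt_eqF//.
rewrite exprS ltr_pM2r ?exprn_gt0// ltr_nat//.
Qed.

Lemma gegenbauer_ode_coef (p : {poly R}) (l : R) :
  (1 - 'X^2) * p^`()^`() - (2 * n%:R + 1) *: ('X * p^`()) = - (l *: p) ->
  forall j, (j.+2)%:R * (j.+1)%:R * p`_j.+2 = (j%:R * (j%:R + 2 * n%:R) - l) * p`_j.
Proof.
move=> h j; have := congr1 (fun q : {poly R} => q`_j) h.
have cd (q : {poly R}) i : q^`()`_i = i.+1%:R * q`_i.+1 by rewrite coef_deriv mulr_natl.
rewrite mulrBl mul1r !coefB coefXnM coefN !coefZ coefXM !cd.
move=> e; apply: (eq_of_subr e).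
case: j {e} => [|[|j]] /=; rewrite ?subSS ?subn0 ?cd /=.
- by ring.
- by ring.
by rewrite -(natr1 j.+3) -(natr1 j.+2) -(natr1 j.+1) -(natr1 j); ring.
Qed.

Lemma geg_coef m j : (j.+2)%:R * (j.+1)%:R * (geg m)`_j.+2 =
  (j%:R * (j%:R + 2 * n%:R) - m%:R * (m%:R + 2 * n%:R)) * (geg m)`_j.
Proof. exact: gegenbauer_ode_coef (geg_ode m) j. Qed.

Lemma eigenvalue_inj (j m : nat) :
  (j%:R * (j%:R + 2 * n%:R) - m%:R * (m%:R + 2 * n%:R) == 0 :> R) = (j == m).
Proof.
rewrite subr_eq0 -!natrM -!natrD -!natrM eqr_nat; apply/eqP/eqP => [|->//]; nia.
Qed.

(** The coefficient recursion is run downwards from the top degree: p_j is determined by p_(j+2)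
    unless j = m, and that one coefficient vanishes by assumption. In the proof [k] measures the
    distance from [j] to the size of [p]. *)
Lemma gegenbauer_ode_null (p : {poly R}) m :
  (1 - 'X^2) * p^`()^`() - (2 * n%:R + 1) *: ('X * p^`()) =
    - ((m%:R * (m%:R + 2 * n%:R)) *: p) ->
  p`_m = 0 -> p = 0.
Proof.
move=> /gegenbauer_ode_coef h pm.
have key k : forall j, (size p <= j + k)%N -> p`_j = 0.
  elim/ltn_ind: k => k IH j sj.
  have [->//|jm] := eqVneq j m.
  case: k IH sj => [|[|k]] IH sj.
  - by rewrite nth_default// -(addn0 j).
  - have := h j; rewrite (@nth_default _ _ p j.+2)/=; last by apply: leq_trans sj _; lia.
    by rewrite mulr0 => /esym/eqP; rewrite mulf_eq0 eigenvalue_inj (negbTE jm) => /eqP.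
  - have := h j; rewrite (IH k)//; last by apply: leq_trans sj _; lia.
    by rewrite mulr0 => /esym/eqP; rewrite mulf_eq0 eigenvalue_inj (negbTE jm) => /eqP.
by apply/polyP => j; rewrite coef0 (key (size p))// leq_addl.
Qed.

Lemma gegenbauer_ode_unique (p : {poly R}) m :
  (1 - 'X^2) * p^`()^`() - (2 * n%:R + 1) *: ('X * p^`()) =
    - ((m%:R * (m%:R + 2 * n%:R)) *: p) ->
  p.[1] = (geg m).[1] -> p = geg m.
Proof.
move=> hp h1; have hg := geg_ode m.
have g0 : geg m != 0.
  by apply/eqP => g0; have := geg_at1_gt0 m; rewrite g0 horner0 ltxx.
have gm0 : (geg m)`_m != 0.
  by apply/eqP => gm; move: g0; rewrite (gegenbauer_ode_null hg gm) eqxx.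
(* This combination solves the same equation and has no coefficient of degree m, so the two
   solutions are proportional; the values at 1 then fix the factor. *)
have e : (geg m)`_m *: p - p`_m *: geg m = 0.
  apply: (@gegenbauer_ode_null _ m); last by rewrite coefB !coefZ mulrC subrr.
  have h : ((geg m)`_m)%:P * ((1 - 'X^2) * p^`()^`() - (2 * n%:R + 1) *: ('X * p^`())) -
      (p`_m)%:P * ((1 - 'X^2) * (geg m)^`()^`() - (2 * n%:R + 1) *: ('X * (geg m)^`())) =
      ((geg m)`_m)%:P * - ((m%:R * (m%:R + 2 * n%:R)) *: p) -
      (p`_m)%:P * - ((m%:R * (m%:R + 2 * n%:R)) *: geg m) by rewrite hp hg.
  by apply: (eq_of_subr h); rewrite !(derivB, derivZ) -!mul_polyC; ring.
have pm : p`_m = (geg m)`_m.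
  have := congr1 (fun q : {poly R} => q.[1]) e.
  rewrite !hornerE h1 => /eqP; rewrite -mulrBl mulf_eq0 subr_eq0.
  by rewrite (gt_eqF (geg_at1_gt0 m)) orbF => /eqP.
move/eqP: e; rewrite pm -scalerBr scaler_eq0 (negbTE gm0) /= subr_eq0.
by move/eqP.
Qed.

End GegenbauerPolynomials.

(** * Real-valued integrals *)

Section DominatedConvergence.
Context d (T : measurableType d) (R : realType) (mu : {measure set T -> \bar R}).

Lemma Rdominated_convergence (D : set T) (f_ : nat -> T -> R) (f g : T -> R) :
  measurable D -> (forall n, measurable_fun D (f_ n)) ->
  (forall x, D x -> f_ n x @[n --> \oo] --> f x) ->
  mu.-integrable D (EFin \o g) ->
  (forall n x, D x -> `|f_ n x| <= g x) ->
  mu.-integrable D (EFin \o f) /\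
  (\int[mu]_(x in D) f_ n x) @[n --> \oo] --> \int[mu]_(x in D) f x.
Proof.
move=> mD mf_ cvgf ig fg.
have mf : measurable_fun D f by exact: (measurable_fun_cvg mf_ cvgf).
have [|||//||i1 _ i3] := @dominated_convergence _ _ _ mu _ mD (fun n => EFin \o f_ n)
  (EFin \o f) (EFin \o g).
- by move=> n; apply/measurable_EFinP; exact: mf_.
- exact/measurable_EFinP.
- by apply: aeW => x Dx; apply: cvg_EFin; [exact: nearW|exact: cvgf].
- by apply: aeW => x n Dx; rewrite /= lee_fin; exact: fg.
split => //; rewrite /Rintegral; apply: fine_cvg.
by rewrite fineK //; exact: integrable_fin_num.
Qed.

Lemma RintegrableZl (D : set T) (k : R) (f : T -> R) : measurable D ->
  mu.-integrable D (EFin \o f) -> mu.-integrable D (EFin \o (fun x => k * f x)).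
Proof. by move=> mD; exact: (@integrableZl _ _ _ _ _ mD k (EFin \o f)). Qed.

Lemma RintegrableD (D : set T) (f g : T -> R) : measurable D ->
  mu.-integrable D (EFin \o f) -> mu.-integrable D (EFin \o g) ->
  mu.-integrable D (EFin \o (fun x => f x + g x)).
Proof. by move=> mD; exact: (@integrableD _ _ _ _ _ mD (EFin \o f)). Qed.

Lemma RintegrableB (D : set T) (f g : T -> R) : measurable D ->
  mu.-integrable D (EFin \o f) -> mu.-integrable D (EFin \o g) ->
  mu.-integrable D (EFin \o (fun x => f x - g x)).
Proof. by move=> mD; exact: (@integrableB _ _ _ _ _ mD (EFin \o f)). Qed.

Lemma Rle_integrable (D : set T) (f g : T -> R) : measurable D ->
  measurable_fun D f -> (forall x, D x -> `|f x| <= g x) ->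
  mu.-integrable D (EFin \o g) -> mu.-integrable D (EFin \o f).
Proof.
move=> mD mf fg ig; apply: (le_integrable mD _ _ ig); first exact/measurable_EFinP.
move=> x Dx; rewrite /= lee_fin; apply: le_trans (fg x Dx) _; exact: ler_norm.
Qed.

(** Dominated convergence with |f| as the bound: the sets need not be nested, each point only has to
    belong to all but finitely many of them. *)
Lemma Rintegral_exhaust (D : set T) (B : nat -> set T) (f : T -> R) :
  measurable D -> (forall n, measurable (B n)) -> (forall n, B n `<=` D) ->
  (forall x, D x -> \forall n \near \oo, B n x) ->
  mu.-integrable D (EFin \o f) ->
  (\int[mu]_(x in B n) f x) @[n --> \oo] --> \int[mu]_(x in D) f x.
Proof.
move=> mD mB BD Bx intf.
have mf : measurable_fun D f by case/integrableP: intf => /measurable_EFinP.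
have [||||_] := @Rdominated_convergence D (fun n => f \_ (B n)) f (fun x => `|f x|) mD.
- by move=> n; apply/measurable_restrict => //; exact: measurable_funS mf.
- move=> x Dx; apply: cvg_near_cst; near=> n.
  by rewrite patchE mem_set //; near: n; exact: Bx.
- exact: (integrable_abse intf).
- by move=> n x Dx; rewrite patchE; case: ifP => // _; rewrite normr0.
suff -> : (fun n => \int[mu]_(x in B n) f x) =
  (fun n => \int[mu]_(x in D) (f \_ (B n)) x) by [].
by apply/funext => n; rewrite -Rintegral_mkcondr setIidr.
Unshelve. all: end_near. Qed.

End DominatedConvergence.

(** * Integrals of derivatives over unbounded intervals *)

Section ImproperIntegrals.
Variable R : realType.
Notation leb := (@lebesgue_measure R).

(** Integrability replaces a sign condition, since the integrand of the functional equation of Gamma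
    changes sign. *)
Lemma integral_deriv_itvy (g G : R -> R) (a l : R) :
  leb.-integrable `[a, +oo[ (EFin \o g) ->
  {within `[a, +oo[, continuous g} ->
  G x @[x --> +oo] --> l -> (forall x, a < x -> derivable G x 1) ->
  G x @[x --> a^'+] --> G a -> {in `]a, +oo[, G^`()%classic =1 g} ->
  \int[leb]_(x in `[a, +oo[) g x = l - G a.
Proof.
move=> ig cg Gl dG Ga Gg.
have e : (fun n : nat => \int[leb]_(x in `[a, a + n.+1%:R]) g x) =
    (fun n : nat => G (a + n.+1%:R) - G a).
  apply/funext => n; have an : a < a + n.+1%:R by rewrite ltrDl ltr0n.
  have cG x : a < x -> {for x, continuous G}.
    by move=> ax; apply: differentiable_continuous; apply/derivable1_diffP; exact: dG.
  rewrite /Rintegral (@continuous_FTC2 _ g G)//.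
  - apply: continuous_subspaceW cg => x /=; by rewrite !in_itv/= => /andP[-> _].
  - split => //.
    + by move=> x; rewrite in_itv/= => /andP[ax _]; exact: dG.
    + exact/cvg_at_left_filter/cG.
  - by move=> x; rewrite in_itv/= => /andP[ax _]; apply: Gg; rewrite in_itv/= ax.
have := @Rintegral_exhaust _ _ _ leb `[a, +oo[ (fun n => `[a, a + n.+1%:R]%classic) g.
rewrite e => /(_ _ _ _ _ ig) h.
have {}h : (fun n : nat => G (a + n.+1%:R) - G a) n @[n --> \oo] -->
    \int[leb]_(x in `[a, +oo[) g x.
  apply: h => //.
  - by move=> n x /=; rewrite !in_itv/= => /andP[->].
  - move=> x /=; rewrite in_itv/= andbT => ax; near=> n.
    rewrite in_itv/= ax/=; apply: ltW; rewrite -ltrBlDl.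
    apply: lt_le_trans (_ : n%:R <= _); last by rewrite ler_nat.
    near: n; exact: nbhs_infty_gtr.
apply: (cvg_unique _ h) => //=.
apply: cvgB; last exact: cvg_cst.
apply: (cvg_comp _ _ _ Gl).
apply/cvgryPge => A; near=> n.
rewrite -lerBlDl; apply: le_trans (_ : n%:R <= _); last by rewrite ler_nat.
near: n; exact: nbhs_infty_ger.
Unshelve. all: end_near. Qed.

(** Stated for a primitive vanishing at both ends, as happens for the oscillating Gaussians of the
    contour shift. *)
Lemma integral_deriv_line (g G : R -> R) :
  leb.-integrable setT (EFin \o g) -> continuous g ->
  G x @[x --> +oo] --> 0 -> G x @[x --> -oo] --> 0 ->
  (forall x, is_derive x (1 : R) G (g x)) ->
  \int[leb]_x g x = 0.
Proof.
move=> ig cg Gy GNy dG.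
have e : (fun n : nat => \int[leb]_(x in `[(- n.+1%:R), n.+1%:R]) g x) =
    (fun n : nat => G n.+1%:R - G (- n.+1%:R)).
  apply/funext => n.
  have cG x : {for x, continuous G}.
    by apply: differentiable_continuous; apply/derivable1_diffP; have [] := dG x.
  rewrite /Rintegral (@continuous_FTC2 _ g G)//.
  - by rewrite (@lt_trans _ _ 0)// ?oppr_lt0 ltr0n.
  - exact: continuous_subspaceT.
  - split => //.
    + exact/cvg_at_right_filter/cG.
    + exact/cvg_at_left_filter/cG.
  - by move=> x _; rewrite derive1E; have [_ ->] := dG x.
have := @Rintegral_exhaust _ _ _ leb setT (fun n => `[- n.+1%:R, n.+1%:R]%classic) g.
rewrite e => /(_ _ _ _ _ ig) h.
have {}h : (fun n : nat => G n.+1%:R - G (- n.+1%:R)) n @[n --> \oo] -->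
    \int[leb]_x g x.
  apply: h => //.
  move=> x _ /=; near=> n.
  rewrite in_itv/= -ler_norml; apply: ltW.
  apply: lt_le_trans (_ : n%:R <= _); last by rewrite ler_nat.
  near: n; exact: nbhs_infty_gtr.
have ny : n.+1%:R @[n --> \oo] --> (+oo%R : set_system R).
  apply/cvgryPge => A; near=> n.
  apply: le_trans (_ : n%:R <= _); last by rewrite ler_nat.
  near: n; exact: nbhs_infty_ger.
apply: (cvg_unique _ h) => //=.
rewrite -[X in _ --> X](subrr 0); apply: cvgB.
  exact: (cvg_comp _ _ ny Gy).
apply: (cvg_comp _ _ _ GNy).
by apply/cvgNrNy; exact: ny.
Unshelve. all: end_near. Qed.

End ImproperIntegrals.

(** * The Gamma function *)

Section GammaFunction.
Variable R : realType.
Notation leb := (@lebesgue_measure R).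

Lemma exprn_le_fact_expR (x : R) k : 0 <= x -> x ^+ k <= k`!%:R * expR x.
Proof.
move=> x0; case: k => [|k].
  by rewrite expr0 fact0 mul1r -expR0 ler_expR.
have := expR_ge1Dxn k x0.
have k0 : 0 < (k.+1)`!%:R :> R by rewrite ltr0n fact_gt0.
rewrite -(ler_pM2l k0) => /(le_trans _)->//.
by rewrite mulrDr mulr1 mulrCA divff ?gt_eqF// mulr1 lerDr ltW.
Qed.

Lemma is_derive_expRM (c x : R) :
  is_derive x (1 : R) (fun s : R => expR (c * s)) (c * expR (c * x)).
Proof.
have d : is_derive x (1 : R) (fun s : R => c * s) c.
  by apply: is_derive_eq; rewrite scaler1 ?addr0 ?scale1r ?mulr1.
have := is_derive1_comp (is_derive_expR (c * x)) d.
by rewrite mulrC.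
Qed.

Lemma continuous_expRM (c : R) : continuous (fun s : R => expR (c * s)).
Proof.
move=> x; apply: differentiable_continuous; apply/derivable1_diffP.
by have [] := is_derive_expRM c x.
Qed.

Lemma is_derive_expRN (x : R) :
  is_derive x (1 : R) (fun s : R => expR (- s)) (- expR (- x)).
Proof.
have -> : (fun s : R => expR (- s)) = (fun s => expR (-1 * s)).
  by apply/funext => s; rewrite mulN1r.
by have := is_derive_expRM (-1) x; rewrite !mulN1r.
Qed.

Lemma continuous_expRN : continuous (fun s : R => expR (- s)).
Proof.
move=> x; apply: differentiable_continuous; apply/derivable1_diffP.
by have [] := is_derive_expRN x.
Qed.

Lemma cvgy_expRNM (c : R) : 0 < c -> expR (- c * s) @[s --> +oo] --> (0 : R).
Proof.
move=> c0; under eq_fun do rewrite mulNr.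
apply: (@cvg_comp _ _ _ (fun s => c * s) (fun s => expR (- s))) (@cvgr_expR R).
apply/cvgryPge => A; near=> s.
by rewrite -ler_pdivrMl// mulrC; near: s; exact: nbhs_pinfty_ge.
Unshelve. all: end_near. Qed.

Lemma Rintegral_expRNM (c a : R) : 0 < c ->
  (\int[leb]_(s in `[a, +oo[) (expR (- c * s))%:E = (expR (- c * a) / c)%:E)%E.
Proof.
move=> c0.
have d (x : R) : is_derive x (1 : R) (fun s => - c^-1 * expR (- c * s)) (expR (- c * x)).
  have h := is_derive_expRM (- c) x.
  have := is_deriveZ (- c^-1) h; rewrite /GRing.scale/=.
  by rewrite mulrA mulrNN mulVf ?mul1r// gt_eqF.
have cd x : {for x, continuous (fun s => - c^-1 * expR (- c * s))}.
  by apply: differentiable_continuous; apply/derivable1_diffP; have [] := d x.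
rewrite (@ge0_continuous_FTC2y _ _ (fun s => - c^-1 * expR (- c * s)) a 0).
- by rewrite -EFinB sub0r mulNr opprK mulrC.
- by move=> x _; exact: expR_ge0.
- by apply: continuous_subspaceT => x; exact: continuous_expRM.
- by rewrite -[X in _ --> X](mulr0 (- c^-1)); apply: cvgMr; exact: cvgy_expRNM.
- by move=> x _; have [] := d x.
- exact/cvg_at_right_filter/cd.
- by move=> x _; rewrite derive1E; have [_ ->] := d x.
Qed.

Lemma integrable_expRNM (c a : R) : 0 < c ->
  leb.-integrable `[a, +oo[ (fun s => (expR (- c * s))%:E).
Proof.
move=> c0; apply/integrableP; split.
  apply/measurable_EFinP; apply: measurable_funTS.
  by apply: continuous_measurable_fun; exact: continuous_expRM.
under eq_integral do rewrite gee0_abs ?lee_fin ?expR_ge0//.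
by rewrite Rintegral_expRNM// ltry.
Qed.

(** For s >= 1 the real power is bounded by an integer one, hence by the exponential; for s < 1 it
    is at most 1. The rate 1/2 leaves e^(-s/2) after multiplication by e^(-s). *)
Lemma powR_le_expR (a : R) : exists2 C : R, 0 < C &
  forall s, 0 <= s -> 0 <= a -> s `^ a <= C * expR (s / 2).
Proof.
pose k := Num.bound a.
exists (2 ^+ k * k`!%:R).
  by rewrite mulr_gt0 ?exprn_gt0// ltr0n fact_gt0.
move=> s s0 a0; have ak : a <= k%:R by rewrite ltW// archi_boundP.
have e1 : 1 <= expR (s / 2) by rewrite -expR0 ler_expR divr_ge0.
have k1 : 1 <= 2 ^+ k * k`!%:R :> R.
  by rewrite -natrX -natrM ler1n muln_gt0 expn_gt0 fact_gt0.
have [s1|s1] := leP 1 s.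
  apply: le_trans (ler_powR s1 ak) _; rewrite powR_mulrn//.
  rewrite -[X in X ^+ k](divfK (_ : 2 != 0 :> R))// exprMn mulrC -mulrA.
  by rewrite ler_wpM2l ?exprn_ge0// exprn_le_fact_expR// divr_ge0.
apply: le_trans (_ : 1 <= _); last by rewrite mulr_ege1.
apply: le_trans (ge0_ler_powR a0 _ _ (ltW s1)) _; rewrite ?nnegrE//.
by rewrite powR1.
Qed.

Definition gamma_integrand (x s : R) := s `^ (x - 1) * expR (- s).

Lemma measurable_gamma_integrand x D : measurable_fun D (gamma_integrand x).
Proof.
apply: measurable_funTS; apply: measurable_funM; first exact: measurable_powR.
apply: measurableT_comp => //; exact: measurable_oppr.
Qed.

(** Every argument at which Gamma is evaluated below is at least 1; there the integrand is
    continuous up to 0 and only the decay at infinity has to be controlled. *)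
Lemma integrable_gamma (x : R) : 1 <= x ->
  leb.-integrable `[0, +oo[ (EFin \o gamma_integrand x).
Proof.
move=> x1; have [C C0 hC] := powR_le_expR (x - 1).
apply: (@Rle_integrable _ _ _ leb _ _ (fun s => C * expR (- 2^-1 * s))) => //.
- exact: measurable_gamma_integrand.
- move=> s /=; rewrite in_itv/= andbT => s0.
  rewrite ger0_norm; last by rewrite mulr_ge0 ?powR_ge0 ?expR_ge0.
  apply: le_trans (ler_wpM2r (expR_ge0 _) (hC s s0 _)) _; first by rewrite subr_ge0.
  by rewrite -mulrA -expRD; apply: ler_wpM2l; [exact: ltW|rewrite ler_expR; lra].
- by apply: RintegrableZl => //; exact: integrable_expRNM.
Qed.

Lemma GammaE x : 1 <= x ->
  Gamma x = \int[leb]_(s in `[0%R, +oo[) gamma_integrand x s.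
Proof.
move=> x1; rewrite /Gamma Rintegral_itv_obnd_cbnd//.
apply: integrableS (integrable_gamma x1) => //.
by move=> s /=; rewrite !in_itv/= !andbT => /ltW.
Qed.

Lemma powR_at_right0 (a : R) : 0 <= a -> s `^ a @[s --> 0^'+] --> (0 : R) `^ a.
Proof.
rewrite le_eqVlt => /predU1P[<-|a0].
  by rewrite powRr0; under eq_fun do rewrite powRr0; exact: cvg_cst.
by rewrite powR0 ?gt_eqF//; exact: powR_cvg0.
Qed.

Lemma continuous_gamma_integrand x : 1 <= x ->
  {within `[0, +oo[, continuous (gamma_integrand x)}.
Proof.
move=> x1; apply/continuous_within_itvcyP; split.
  move=> s; rewrite in_itv/= andbT => s0.
  have c1 : {for s, continuous ((@powR R)^~ (x - 1))}.
    apply: differentiable_continuous; apply/derivable1_diffP.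
    by apply: derivable_powR; rewrite in_itv/= s0.
  apply: cvgM; first exact: c1.
  exact: continuous_expRN.
apply: cvgM; first by apply: powR_at_right0; rewrite subr_ge0.
apply: cvg_at_right_filter.
exact: continuous_expRN.
Qed.

(** Integration by parts as a single derivative: the difference of the two integrands is the
    derivative of -s^x e^(-s), which vanishes at 0 and at infinity. *)
Lemma GammaS (x : R) : 1 <= x -> Gamma (x + 1) = x * Gamma x.
Proof.
move=> x1; have x0 : 0 <= x by lra.
have x2 : 1 <= x + 1 by lra.
rewrite !GammaE//; apply/eqP; rewrite -subr_eq0 -RintegralZl//; last exact: integrable_gamma.
have iZ : leb.-integrable `[0, +oo[ (EFin \o (fun s => x * gamma_integrand x s)).
  by apply: RintegrableZl => //; exact: integrable_gamma.
rewrite -RintegralB//; last exact: integrable_gamma.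
have dG (s : R) : 0 < s -> is_derive s (1 : R) (fun u => - (u `^ x * expR (- u)))
    (gamma_integrand (x + 1) s - x * gamma_integrand x s).
  move=> s0.
  have h1 := is_derive1_powR x s0.
  have h2 := is_derive_expRN s.
  have -> : (fun u => - (u `^ x * expR (- u))) =
    - (((@powR R)^~ x) * (fun u => expR (- u))) by [].
  apply: is_derive_eq; rewrite /gamma_integrand addrK /GRing.scale/=; ring.
rewrite (@integral_deriv_itvy _ _ (fun u => - (u `^ x * expR (- u))) 0 0).
- by rewrite powR0 ?mul0r ?oppr0 ?subrr//; apply/eqP; lra.
- by apply: RintegrableB => //; exact: integrable_gamma.
- move=> s; apply: cvgB; first exact: (continuous_gamma_integrand x2).
  by apply: cvgMr; exact: (continuous_gamma_integrand x1).
- have [C C0 hC] := powR_le_expR x.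
  rewrite -oppr0; apply: cvgN.
  apply: (@squeeze_cvgr _ _ _ _ (cst 0) (fun s => C * expR (- 2^-1 * s))).
  + near=> s; have s0 : 0 <= s by near: s; exact: nbhs_pinfty_ge.
    rewrite mulr_ge0 ?powR_ge0 ?expR_ge0//=.
    apply: le_trans (ler_wpM2r (expR_ge0 _) (hC s s0 x0)) _.
    by rewrite -mulrA -expRD; apply: ler_wpM2l; [exact: ltW|rewrite ler_expR; lra].
  + exact: cvg_cst.
  + by rewrite -[X in _ --> X](mulr0 C); apply: cvgMr; exact: cvgy_expRNM.
- by move=> s s0; have [] := dG s s0.
- apply: cvgN; apply: cvgM; first exact: powR_at_right0.
  apply: cvg_at_right_filter.
  exact: continuous_expRN.
- by move=> s; rewrite in_itv/= andbT => s0; rewrite derive1E; have [_ ->] := dG s s0.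
Unshelve. all: end_near. Qed.

Lemma Gamma1 : Gamma (1 : R) = 1.
Proof.
rewrite GammaE// /Rintegral.
under eq_integral do rewrite /= /gamma_integrand subrr powRr0 mul1r -mulN1r.
by rewrite Rintegral_expRNM//= mulr0 expR0 divr1.
Qed.

(** On [1, +oo[ the power is at least 1, so the integral is at least that of e^(-s) there. *)
Lemma Gamma_gt0 (x : R) : 1 <= x -> 0 < Gamma x.
Proof.
move=> x1; rewrite GammaE//; have ix := integrable_gamma x1.
have g0 s : 0 <= gamma_integrand x s by rewrite mulr_ge0 ?powR_ge0 ?expR_ge0.
have i1 : leb.-integrable `[1, +oo[ (fun s : R => (expR (- 1 * s))%:E) by exact:
  integrable_expRNM.
apply: lt_le_trans (_ : \int[leb]_(s in `[1%R, +oo[) expR (- 1 * s) <= _).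
  by rewrite /Rintegral Rintegral_expRNM//= divr1 expR_gt0.
apply: le_trans (_ : \int[leb]_(s in `[1%R, +oo[) gamma_integrand x s <= _).
  apply: le_Rintegral => //.
    apply: integrableS ix => // s /=; rewrite !in_itv/= !andbT; lra.
  move=> s /=; rewrite in_itv/= andbT => s1; rewrite /gamma_integrand mulN1r.
  rewrite ler_peMl ?expR_ge0//.
  by rewrite -[X in X <= _](powRr0 (s : R)); apply: ler_powR => //; rewrite subr_ge0.
rewrite /Rintegral fine_le//.
- apply: integrable_fin_num => //.
  by apply: integrableS ix => // s /=; rewrite !in_itv/= !andbT; lra.
- exact: integrable_fin_num.
apply: ge0_subset_integral => //.
- by apply/measurable_EFinP; exact: measurable_gamma_integrand.
- by move=> s _; rewrite lee_fin.
- by move=> s /=; rewrite !in_itv/= !andbT; lra.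
Qed.

End GammaFunction.

(** * Rodrigues' formula *)

Section Rodrigues.
Variable R : realType.

(** The factor Q_k in d^k/dx^k (1 - x^2)^b = (1 - x^2)^(b - k) Q_k; the recursion is the product
    rule. *)
Fixpoint rodrigues_poly (b : R) (k : nat) : {poly R} :=
  if k is j.+1 then
    (1 - 'X^2) * (rodrigues_poly b j)^`() -
    (2 * (b - j%:R)) *: ('X * rodrigues_poly b j)
  else 1.

Lemma rodrigues_poly_deriv b k : (rodrigues_poly b k.+1)^`() =
  - ((k.+1%:R * (2 * b - k%:R)) *: rodrigues_poly b k).
Proof.
elim: k => [|k IH].
  rewrite /= derivB derivM derivZ derivM derivX derivC derivC.
  by rewrite mulr0 !mulr0 addr0 mul1r addr0 add0r subr0 subr0 mul1r.
set Q := rodrigues_poly b in IH *.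
have e : (1 - 'X^2) * (Q k)^`() = Q k.+1 + (2 * (b - k%:R)) *: ('X * Q k).
  by rewrite /Q /= subrK.
have -> : Q k.+2 = (1 - 'X^2) * (Q k.+1)^`() - (2 * (b - k.+1%:R)) *: ('X * Q k.+1) by [].
rewrite {1}IH mulrN -scalerAr derivB derivN !derivZ derivM derivB derivXn derivC.
rewrite derivM derivX /= expr1 IH e.
rewrite -(natr1 k.+1) -(natr1 k) -!mul_polyC.
by rewrite !(polyCM, polyCD, polyCB, polyC_natr, polyCN, polyC1); ring.
Qed.

(** Equating the derivative of the recursion for Q_(m+1) with [rodrigues_poly_deriv] gives a
    second-order equation, which is the Gegenbauer one precisely for this exponent b. *)
Lemma rodrigues_poly_ode n m :
  let Q := rodrigues_poly (n%:R + m%:R - 2^-1) m in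
  (1 - 'X^2) * Q^`()^`() - (2 * n%:R + 1) *: ('X * Q^`()) =
    - ((m%:R * (m%:R + 2 * n%:R)) *: Q).
Proof.
set b := _ - _; have := rodrigues_poly_deriv b m => /=.
set Q := rodrigues_poly b m.
rewrite derivB derivM derivB derivXn derivC derivZ derivM derivX /= expr1 => h.
have e1 : 2 * (b - m%:R) = 2 * n%:R - 1 by rewrite /b; field.
have e2 : 2 * b - m%:R = 2 * n%:R + m%:R - 1 by rewrite /b; field.
move: h; rewrite e1 e2 => h; apply: (eq_of_subr h); rewrite -!mul_polyC -(natr1 m).
by rewrite !(polyCM, polyCD, polyCB, polyC_natr, polyCN, polyC1); ring.
Qed.

Lemma rodrigues_poly_at1 b k : (rodrigues_poly b k.+1).[1] =
  - (2 * (b - k%:R)) * (rodrigues_poly b k).[1].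
Proof.
rewrite /= hornerD hornerN hornerZ !hornerM hornerD hornerN hornerC hornerXn hornerX.
by rewrite expr1n subrr mul0r add0r mul1r mulNr.
Qed.

Lemma derive1n_rodrigues b k (x : R) : -1 < x < 1 ->
  derive1n k (fun u : R => (1 - u ^+ 2) `^ b) x =
  (1 - x ^+ 2) `^ (b - k%:R) * (rodrigues_poly b k).[x].
Proof.
elim: k x => [|k IH] x hx.
  by rewrite derive1n0 subr0 hornerC mulr1.
rewrite derive1nS derive1E.
rewrite (@near_eq_derive _ _ _ _ (fun y : R => (1 - y ^+ 2) `^ (b - k%:R) * (rodrigues_poly b
  k).[y]));
  last first.
  have : x \in `]-1, 1[ by rewrite in_itv/=.
  by move/near_in_itvoo; apply: filterS => y; rewrite in_itv/=; exact: IH.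
have x0 : 0 < 1 - x ^+ 2 by nra.
have d1 : is_derive x (1 : R) (fun y : R => 1 - y ^+ 2) (- (2 * x)).
  have -> : (fun y : R => 1 - y ^+ 2) = horner (1 - 'X^2).
    by apply/funext => y; rewrite hornerD hornerN hornerC hornerXn.
  have := is_derive_poly (1 - 'X^2 : {poly R}) x.
  rewrite derivB derivC derivXn sub0r hornerN hornerMn hornerX mulr_natl //.
have d2 := @is_derive1_comp _ ((@powR R)^~ (b - k%:R)) (fun y => 1 - y ^+ 2) _ _ _
  (is_derive1_powR (b - k%:R) x0) d1.
have d3 := is_deriveM d2 (is_derive_poly (rodrigues_poly b k) x).
have [_ ->] := d3.
rewrite /GRing.scale/= hornerD hornerN hornerZ !hornerM hornerD hornerN hornerC hornerXn
  hornerX.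
have -> : (1 - x ^+ 2) `^ (b - k%:R) = (1 - x ^+ 2) `^ (b - k.+1%:R) * (1 - x ^+ 2).
  rewrite -[X in _ * X](powRr1 (ltW x0)) -powRD; last by rewrite (gt_eqF x0) implybT.
  by congr (_ `^ _); rewrite -(natr1 k); ring.
have -> : b - k%:R - 1 = b - k.+1%:R by rewrite -(natr1 k); ring.
ring.
Qed.

Lemma poly_eq_itv (p q : {poly R}) :
  (forall x, -1 < x < 1 -> p.[x] = q.[x]) -> p = q.
Proof.
move=> h; apply/eqP; rewrite -subr_eq0; apply/eqP.
(* The numbers 1/(i + 2) lie in ]0, 1[, and as many of them as the size of p - q are roots of it. *)
pose f (i : nat) : R := i.+2%:R^-1.
apply: (@roots_geq_poly_eq0 _ _ [seq f i | i <- iota 0 (size (p - q))]).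
- apply/allP => _ /mapP[i _ ->]; rewrite /root hornerD hornerN h ?subrr//.
  rewrite /f; apply/andP; split; first by rewrite (lt_trans (ltrN10 _))// invr_gt0.
  by rewrite invf_lt1// ltr1n.
- rewrite map_inj_uniq ?iota_uniq// => i j /invr_inj/eqP.
  by rewrite eqr_nat => /eqP [].
- by rewrite size_map size_iota.
Qed.

Lemma geg_at1_Gamma n m : (1 <= n)%N ->
  (geg R n m).[1] * Gamma (2 * n%:R) * Gamma (m%:R + 1) = Gamma (m%:R + 2 * n%:R) :> R.
Proof.
move=> hn; have n1 : 1 <= n%:R :> R by rewrite ler1n.
elim: m => [|m IH].
  by rewrite geg0 hornerC mul1r !add0r Gamma1 mulr1.
have m0 : 0 <= m%:R :> R by [].
have -> : m.+1%:R + 2 * n%:R = (m%:R + 2 * n%:R) + 1 :> R by rewrite -(natr1 m); ring.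
have := geg_at1 R n m; rewrite -(natr1 m) (@GammaS _ (m%:R + 1)) ?lerDr// (@GammaS _ (m%:R +
  2 * n%:R)) -?IH; last lra.
move=> e.
have -> : (geg R n m.+1).[1] * Gamma (2 * n%:R) * ((m%:R + 1) * Gamma (m%:R + 1)) =
  (m%:R + 1) * (geg R n m.+1).[1] * Gamma (2 * n%:R) * Gamma (m%:R + 1).
  by move: (Gamma _) (Gamma _) => A B; ring.
by rewrite e; move: (Gamma _) (Gamma _) => A B; ring.
Qed.

Lemma rodrigues_poly_at1_Gamma n m k : (1 <= n)%N -> (k <= m)%N ->
  let b : R := n%:R + m%:R - 2^-1 in
  (rodrigues_poly b k).[1] * Gamma (b - k%:R + 1) = (- 2) ^+ k * Gamma (b + 1).
Proof.
move=> hn; have n1 : 1 <= n%:R :> R by rewrite ler1n.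
elim: k => [|k IH] km b; first by rewrite hornerC expr0 subr0.
have km' : k.+1%:R <= m%:R :> R by rewrite ler_nat.
rewrite rodrigues_poly_at1 exprS -mulrA -(IH (ltnW km)) -/b.
have -> : b - k.+1%:R + 1 = b - k%:R by rewrite -(natr1 k); ring.
(* [GammaS] needs b - k >= 1, which follows from k < m and n >= 1. *)
rewrite GammaS; first by ring.
by move: km'; rewrite /b -natr1; lra.
Qed.

(** The Gamma quotient in Rodrigues' formula is exactly the constant for which c Q_m takes the value
    C_m^n(1) at 1, so [gegenbauer_ode_unique] applies; the polynomial chosen by [xget] is unique
    because agreement on ]-1, 1[ determines it. *)
Lemma gegenbauerE n m : (1 <= n)%N -> gegenbauer R n m = geg R n m.
Proof.
move=> hn; have n1 : 1 <= n%:R :> R by rewrite ler1n.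
pose b : R := n%:R + m%:R - 2^-1.
pose c : R := (-1) ^+ m / 2 ^+ m *
  (Gamma (m%:R + 2 * n%:R) * Gamma (n%:R + 2^-1) /
   (Gamma (2 * n%:R) * Gamma (m%:R + 1) * Gamma (n%:R + m%:R + 2^-1))).
have m0 : 0 <= m%:R :> R by [].
have g1 : Gamma (2 * n%:R) != 0 :> R by rewrite gt_eqF// Gamma_gt0//; lra.
have g2 : Gamma (m%:R + 1) != 0 :> R by rewrite gt_eqF// Gamma_gt0//; lra.
have g3 : Gamma (n%:R + m%:R + 2^-1) != 0 :> R by rewrite gt_eqF// Gamma_gt0//; lra.
have g4 : Gamma (n%:R + 2^-1) != 0 :> R by rewrite gt_eqF// Gamma_gt0//; lra.
have cQ : c *: rodrigues_poly b m = geg R n m.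
  apply: gegenbauer_ode_unique => //.
    have h := rodrigues_poly_ode n m.
    have := congr1 (fun p => c%:P * p) h; rewrite /= -/b => {}h.
    rewrite !derivZ -!mul_polyC; apply: (eq_of_subr h).
    by rewrite -!mul_polyC; ring.
  rewrite hornerZ; apply: (mulIf g4).
  have /= := rodrigues_poly_at1_Gamma hn (leqnn m).
  have -> : n%:R + m%:R - 2^-1 - m%:R + 1 = n%:R + 2^-1 :> R by field.
  have -> : n%:R + m%:R - 2^-1 + 1 = n%:R + m%:R + 2^-1 :> R by field.
  rewrite -/b -mulrA => ->; rewrite /c -(geg_at1_Gamma m hn).
  rewrite [(- 2) ^+ m]exprNn.
  have -> : (-1) ^+ m / 2 ^+ m *
    ((geg R n m).[1] * Gamma (2 * n%:R) * Gamma (m%:R + 1) * Gamma (n%:R + 2^-1) /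
      (Gamma (2 * n%:R) * Gamma (m%:R + 1) * Gamma (n%:R + m%:R + 2^-1))) *
    ((-1) ^+ m * 2 ^+ m * Gamma (n%:R + m%:R + 2^-1)) =
    ((-1) ^+ m * (-1) ^+ m) * ((geg R n m).[1] * Gamma (n%:R + 2^-1)) :> R.
    have p2 : 2 ^+ m != 0 :> R by rewrite expf_neq0.
    move: g1 g2 g3 p2; move: (Gamma (2 * n%:R)) (Gamma (m%:R + 1)) (Gamma (n%:R + m%:R + 2^-1)).
    move: (Gamma (n%:R + 2^-1)) (geg R n m).[1] (2 ^+ m) ((-1) ^+ m) => A B C D E F G h1 h2
      h3 h4.
    by field; rewrite h1 h2 h3 h4.
  by rewrite -expr2 sqrr_sign mul1r.
rewrite /gegenbauer; apply: xget_unique.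
  move=> x hx; rewrite -cQ hornerZ /rodrigues -/c derive1n_rodrigues//.
  have -> : n%:R + m%:R - 2^-1 - m%:R = n%:R - 2^-1 :> R by field.
  rewrite mulrA -(mulrA c) mulVf ?mulr1//.
  by rewrite gt_eqF// powR_gt0//; nra.
move=> q hq; apply: poly_eq_itv => x hx;
  rewrite hq// -cQ hornerZ /rodrigues -/c derive1n_rodrigues//.
have -> : n%:R + m%:R - 2^-1 - m%:R = n%:R - 2^-1 :> R by field.
rewrite mulrA -(mulrA c) mulVf ?mulr1//.
by rewrite gt_eqF// powR_gt0//; nra.
Qed.

End Rodrigues.

(** * Functions on the sphere *)

Section ContinuousRealFunctions.
Variables (R : realType) (T : topologicalType).
Implicit Types f g : T -> R.

Lemma continuous_rcst (a : R) : continuous (fun _ : T => a).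
Proof. by move=> x; exact: cvg_cst. Qed.

Lemma continuous_rD f g :
  continuous f -> continuous g -> continuous (fun x => f x + g x).
Proof. by move=> cf cg x; apply: cvgD; [exact: cf|exact: cg]. Qed.

Lemma continuous_rM f g :
  continuous f -> continuous g -> continuous (fun x => f x * g x).
Proof. by move=> cf cg x; apply: cvgM; [exact: cf|exact: cg]. Qed.

Lemma continuous_sumr (I : Type) (r : seq I) (f : I -> T -> R) :
  (forall i, continuous (f i)) -> continuous (fun x => \sum_(i <- r) f i x).
Proof.
move=> cf; elim: r => [|i r IH].
  by under eq_fun do rewrite big_nil; exact: continuous_rcst.
by under eq_fun do rewrite big_cons; exact: continuous_rD.
Qed.

End ContinuousRealFunctions.

(** * Geometry of the sphere and bounded continuous functions on it *)

Section SphereGeometry.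
Variables (R : realType) (n : nat).
Notation V := (Cvec R n).
Notation S := (sphereT R n).

(** The Euclidean product of R^(2n+2), that is, the real part of the Hermitian product. *)
Definition ip (v w : V) : R :=
  \sum_(j < n.+1) (v.1 ord0 j * w.1 ord0 j + v.2 ord0 j * w.2 ord0 j).

Lemma ipC v w : ip v w = ip w v.
Proof. by apply: eq_bigr => j _; rewrite mulrC (mulrC (v.2 _ _)). Qed.

Lemma ipDl u v w : ip (u + v) w = ip u w + ip v w.
Proof.
rewrite /ip -big_split; apply: eq_bigr => j _ /=; rewrite !mxE; ring.
Qed.

Lemma ipZl a v w : ip (a *: v) w = a * ip v w.
Proof.
rewrite /ip mulr_sumr; apply: eq_bigr => j _ /=; rewrite !mxE; ring.
Qed.

Lemma ipNl v w : ip (- v) w = - ip v w.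
Proof. by rewrite -scaleN1r ipZl mulN1r. Qed.

Lemma ipBl u v w : ip (u - v) w = ip u w - ip v w.
Proof. by rewrite ipDl ipNl. Qed.

Lemma ipDr u v w : ip u (v + w) = ip u v + ip u w.
Proof. by rewrite !(ipC u) ipDl. Qed.

Lemma ipZr a u v : ip u (a *: v) = a * ip u v.
Proof. by rewrite !(ipC u) ipZl. Qed.

Lemma ipNr u v : ip u (- v) = - ip u v.
Proof. by rewrite !(ipC u) ipNl. Qed.

Lemma ipBr u v w : ip u (v - w) = ip u v - ip u w.
Proof. by rewrite ipDr ipNr. Qed.

Lemma ip_sqnorm v : ip v v = sqnorm v.
Proof. by apply: eq_bigr => j _; rewrite !expr2. Qed.

Lemma ip_xdir v j : ip v (xdir R j) = v.1 ord0 j.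
Proof.
rewrite /ip (bigD1 j)//= big1.
  by rewrite !mxE !eqxx mulr1 mulr0 !addr0.
by move=> i ij; rewrite !mxE (negbTE ij) andbF !mulr0 addr0.
Qed.

Lemma ip_ydir v j : ip v (ydir R j) = v.2 ord0 j.
Proof.
rewrite /ip (bigD1 j)//= big1.
  by rewrite !mxE !eqxx mulr1 mulr0 add0r addr0.
by move=> i ij; rewrite !mxE (negbTE ij) andbF !mulr0 addr0.
Qed.

Lemma ip_basis v w :
  \sum_(j < n.+1) (ip v (xdir R j) * ip w (xdir R j) + ip v (ydir R j) * ip w (ydir R j)) =
    ip v w.
Proof. by apply: eq_bigr => j _; rewrite !ip_xdir !ip_ydir. Qed.

Lemma sqnorm_ge0 (v : V) : 0 <= sqnorm v.
Proof. by apply: sumr_ge0 => j _; rewrite addr_ge0 ?sqr_ge0. Qed.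

Lemma sqnorm_eq0 (v : V) : (sqnorm v == 0) = (v == 0).
Proof.
apply/eqP/eqP => [h|->]; last by rewrite -ip_sqnorm -(scale0r 0) ipZl mul0r.
have h0 j : v.1 ord0 j = 0 /\ v.2 ord0 j = 0.
  move: h => /eqP; rewrite psumr_eq0; last first.
    by move=> i _; rewrite addr_ge0 ?sqr_ge0.
  move=> /allP /(_ j); rewrite mem_index_enum => /(_ isT).
  by rewrite /= paddr_eq0 ?sqr_ge0// !sqrf_eq0 => /andP[/eqP -> /eqP ->].
case: v h0 {h} => v1 v2 h0 /=; congr pair; apply/rowP => j; rewrite mxE.
  by have [] := h0 j.
by have [] := h0 j.
Qed.

Lemma sqnorm_gt0 (v : V) : (0 < sqnorm v) = (v != 0).
Proof. by rewrite lt_neqAle sqnorm_ge0 andbT eq_sym sqnorm_eq0. Qed.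

Lemma sqnorm_val (x : S) : sqnorm (val x) = 1.
Proof. exact: set_mem (valP x). Qed.

Lemma ip_val (x : S) : ip (val x) (val x) = 1.
Proof. by rewrite ip_sqnorm sqnorm_val. Qed.

Lemma val_neq0 (x : S) : val x != 0.
Proof. by rewrite -sqnorm_gt0 sqnorm_val. Qed.

Lemma val_radial_proj (v : V) : v != 0 ->
  val (radial_proj v) = (Num.sqrt (sqnorm v))^-1 *: v.
Proof.
move=> v0; rewrite /radial_proj insubdK//; apply/mem_set.
rewrite /sphere/= -ip_sqnorm ipZl ipZr mulrA -invfM -expr2 sqr_sqrtr ?sqnorm_ge0//.
by rewrite ip_sqnorm mulVf// sqnorm_eq0.
Qed.

Lemma val_radial_proj1 (v : V) : sqnorm v = 1 -> val (radial_proj v) = v.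
Proof.
move=> v1; rewrite val_radial_proj; first by rewrite v1 sqrtr1 invr1 scale1r.
by rewrite -sqnorm_gt0 v1.
Qed.

Lemma radial_proj_val (x : S) : radial_proj (val x) = x.
Proof. by apply: val_inj; rewrite val_radial_proj1 ?sqnorm_val. Qed.

Lemma val_north : val (@north R n) = north_vec R n. Proof. by []. Qed.

Lemma ip_le1 (x y : S) : `|ip (val x) (val y)| <= 1.
Proof.
have h (s : R) : s ^+ 2 = 1 -> 0 <= 2 + 2 * s * ip (val x) (val y).
  move=> s1; have := sqnorm_ge0 (val x + s *: val y).
  rewrite -ip_sqnorm ipDl !ipDr !ipZl !ipZr !ip_val (ipC (val y)) => h.
  apply: le_trans h _; rewrite mulr1 -expr2 s1.
  by rewrite (_ : 1 + _ + _ = 2 + 2 * s * ip (val x) (val y))//; ring.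
have s1 : (-1) ^+ 2 = 1 :> R by rewrite sqrrN expr1n.
by rewrite ler_norml; have := h 1 (expr1n _ _); have := h (-1) s1; lra.
Qed.

Lemma continuous_fst_coord (j : 'I_n.+1) : continuous (fun v : V => v.1 ord0 j).
Proof.
move=> v; apply: (@continuous_comp _ _ _ fst (fun M : 'rV[R]_n.+1 => M ord0 j)).
  exact: cvg_fst.
exact: coord_continuous.
Qed.

Lemma continuous_snd_coord (j : 'I_n.+1) : continuous (fun v : V => v.2 ord0 j).
Proof.
move=> v; apply: (@continuous_comp _ _ _ snd (fun M : 'rV[R]_n.+1 => M ord0 j)).
  exact: cvg_snd.
exact: coord_continuous.
Qed.

Lemma continuous_ip (w : V) : continuous (fun v : V => ip v w).
Proof.
apply: continuous_sumr => j; apply: continuous_rD; apply: continuous_rM;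
  try exact: continuous_rcst; [exact: continuous_fst_coord|exact: continuous_snd_coord].
Qed.

Lemma continuous_sqnorm : continuous (@sqnorm R n).
Proof.
apply: continuous_sumr => j; apply: continuous_rD; apply: continuous_rM;
  try exact: continuous_fst_coord; exact: continuous_snd_coord.
Qed.

Lemma continuous_val_sphere : continuous (val : S -> V).
Proof. exact: (@initial_continuous _ _ (val : S -> V)). Qed.

(** The sphere is a closed subset of a cube; a cube rather than a ball fits the sup norm carried by
    row vectors. *)
Lemma compact_sphere : compact (@sphere R n).
Proof.
pose B : set 'rV[R]_n.+1 := [set v | forall j, `|v ord0 j| <= 1].
have cB : compact B.
  apply: bounded_closed_compact.
    exists 1; split => // M M1 v Bv /=.
    rewrite [`|v|]mx_normrE; apply: bigmax_le => [|i _]; first by lra.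
    by rewrite (ord1 i.1); apply: le_trans (Bv _) _; exact: ltW.
  have -> : B = \bigcap_(j in setT) [set v | `|v ord0 j| <= 1].
    by apply/seteqP; split => v h j; [move=> _; exact: h|exact: h].
  apply: closed_bigI => j _.
  apply: (@closed_comp _ _ (fun v : 'rV[R]_n.+1 => `|v ord0 j|) [set x | x <= 1]).
    move=> v _; apply: continuous_comp; first exact: coord_continuous.
    exact: norm_continuous.
  exact: closed_le.
apply: (@subclosed_compact _ _ (B `*` B)).
- apply: (@closed_comp _ _ (@sqnorm R n) [set x | x = 1]).
    by move=> v _; exact: continuous_sqnorm.
  exact: closed_eq.
- exact: compact_setX.
- move=> v /= v1.
  have h j : (v.1 ord0 j) ^+ 2 + (v.2 ord0 j) ^+ 2 <= 1.
    rewrite -v1 /sqnorm (bigD1 j)//= lerDl sumr_ge0// => i _.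
    by rewrite addr_ge0 ?sqr_ge0.
  split => j; rewrite ler_norml; have := h j; nra.
Qed.

(** The bound is part of the definition, so that integrability and closure under products need no
    compactness; compactness enters only in [bcont_comp]. *)
Definition bcont (f : S -> R) := continuous f /\ exists M : R, forall x, `|f x| <= M.

Lemma bcont_cst a : bcont (fun=> a).
Proof. by split; [exact: continuous_rcst|exists `|a|]. Qed.

Lemma bcontD f g : bcont f -> bcont g -> bcont (fun x => f x + g x).
Proof.
move=> [cf [M hM]] [cg [N hN]]; split.
  exact: continuous_rD.
by exists (M + N) => x; apply: le_trans (ler_normD _ _) (lerD (hM x) (hN x)).
Qed.

Lemma bcontM f g : bcont f -> bcont g -> bcont (fun x => f x * g x).
Proof.
move=> [cf [M hM]] [cg [N hN]]; split.
  exact: continuous_rM.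
by exists (M * N) => x; rewrite normrM; apply: ler_pM.
Qed.

Lemma bcontZ a f : bcont f -> bcont (fun x => a * f x).
Proof. by move=> nf; apply: bcontM nf; exact: bcont_cst. Qed.

Lemma bcontN f : bcont f -> bcont (fun x => - f x).
Proof. by move=> /(bcontZ (-1)); under eq_fun do rewrite mulN1r. Qed.

Lemma bcontB f g : bcont f -> bcont g -> bcont (fun x => f x - g x).
Proof. by move=> nf ng; apply: bcontD => //; exact: bcontN. Qed.

Lemma bcontX f k : bcont f -> bcont (fun x => f x ^+ k).
Proof.
move=> nf; elim: k => [|k IH]; first by under eq_fun do rewrite expr0; exact: bcont_cst.
by under eq_fun do rewrite exprS; exact: bcontM.
Qed.

Lemma bcont_sum (I : Type) (r : seq I) (P : pred I) (f : I -> S -> R) :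
  (forall i, bcont (f i)) -> bcont (fun x => \sum_(i <- r | P i) f i x).
Proof.
move=> nf; elim: r => [|i r IH].
  by under eq_fun do rewrite big_nil; exact: bcont_cst.
under eq_fun do rewrite big_cons; case: (P i) => //.
exact: bcontD.
Qed.

Lemma bcont_norm f : bcont f -> bcont (fun x => `|f x|).
Proof.
move=> [cf [M hM]]; split; last by exists M => x; rewrite normr_id.
by move=> x; apply: continuous_comp; [exact: cf|exact: norm_continuous].
Qed.

Lemma bcont_comp (F : V -> R) : (forall v, v != 0 -> {for v, continuous F}) ->
  bcont (fun x => F (val x)).
Proof.
move=> cF; split.
  move=> x; apply: (@continuous_comp _ _ _ (val : S -> V) F).
    exact: continuous_val_sphere.
  by apply: cF; exact: val_neq0.
have : compact (F @` @sphere R n).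
  apply: continuous_compact compact_sphere.
  apply: continuous_in_subspaceT => v /set_mem /= v1; apply: cF.
  by rewrite -sqnorm_gt0 v1.
move=> /compact_bounded [M [Mr hM]].
exists (M + 1) => x; apply: (hM (M + 1)); first by rewrite ltrDl.
by exists (val x) => //; exact: sqnorm_val.
Qed.

Lemma bcont_ip w : bcont (fun x => ip (val x) w).
Proof. by apply: (@bcont_comp (ip ^~ w)) => v _; exact: continuous_ip. Qed.

Lemma bcont_horner (p : {poly R}) f : bcont f -> bcont (fun x => p.[f x]).
Proof.
move=> nf; elim/poly_ind: p => [|p c IH].
  by under eq_fun do rewrite horner0; exact: bcont_cst.
under eq_fun do rewrite hornerMXaddC.
by apply: bcontD; [exact: bcontM|exact: bcont_cst].
Qed.

Lemma continuous_isometry (phi : V -> V) :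
  continuous phi -> (forall v, sqnorm (phi v) = sqnorm v) ->
  continuous (fun x : S => radial_proj (phi (val x)) : S).
Proof.
move=> cphi iphi; apply: (@continuous_comp_initial _ _ _ (val : S -> V)).
rewrite (_ : _ \o _ = phi \o val); last first.
  by apply/funext => x /=; rewrite val_radial_proj1// iphi sqnorm_val.
move=> x; apply: continuous_comp; first exact: continuous_val_sphere.
exact: cphi.
Qed.

Lemma bcont_isometry (phi : V -> V) (f : S -> R) :
  continuous phi -> (forall v, sqnorm (phi v) = sqnorm v) -> bcont f ->
  bcont (fun x => f (radial_proj (phi (val x)))).
Proof.
move=> cphi iphi [cf [M hM]]; split; last by exists M => x; exact: hM.
move=> x; apply: (@continuous_comp _ _ _ (fun x : S => radial_proj (phi (val x)) : S) f).
  exact: continuous_isometry.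
exact: cf.
Qed.

Lemma measurable_continuous_sphere (f : S -> R) : continuous f ->
  measurable_fun setT (f : sphere_borel R n -> R).
Proof.
move=> cf; apply: (@measurability _ _ (sphere_borel R n) _ setT f _ (RGenOpens.measurableE
  R)) => _ [_ [a [b ->] <-]].
rewrite setTI; apply: sub_sigma_algebra.
by move/continuousP: cf; apply; exact: interval_open.
Qed.

End SphereGeometry.

(** * Integration against the uniform measure *)

Section UniformIntegral.
Variables (R : realType) (n : nat).
Notation V := (Cvec R n).
Notation S := (sphereT R n).
Variable mu : {measure set (sphere_borel R n) -> \bar R}.
Hypothesis hmu : is_uniform mu.

Lemma mu_fin : (mu setT < +oo)%E.
Proof. by have [-> _] := hmu; rewrite ltry. Qed.

Lemma bcont_integrable (f : S -> R) : bcont f -> mu.-integrable setT (EFin \o f).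
Proof.
move=> [cf [M hM]]; apply: measurable_bounded_integrable => //.
- exact: mu_fin.
- exact: measurable_continuous_sphere.
- exists M; split; first exact: num_real.
  by move=> N MN x _ /=; apply: le_trans (hM x) (ltW MN).
Qed.

Definition mass : R := fine (mu setT).

Lemma massE : mass = 2 * pi ^+ n.+1 / Gamma (n%:R + 1).
Proof. by rewrite /mass; have [-> _] := hmu. Qed.

Lemma mass_gt0 : 0 < mass.
Proof.
by rewrite massE divr_gt0 ?mulr_gt0 ?exprn_gt0 ?pi_gt0// Gamma_gt0// lerDr.
Qed.

Definition sint (f : S -> R) : R := \int[mu]_x f x.

Lemma sint_cst a : sint (fun=> a) = a * mass.
Proof. by rewrite /sint Rintegral_cst. Qed.

Lemma sintD f g : bcont f -> bcont g -> sint (fun x => f x + g x) = sint f + sint g.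
Proof. by move=> nf ng; rewrite /sint RintegralD//; exact: bcont_integrable. Qed.

Lemma sintZ a f : bcont f -> sint (fun x => a * f x) = a * sint f.
Proof. by move=> nf; rewrite /sint RintegralZl//; exact: bcont_integrable. Qed.

Lemma sintN f : bcont f -> sint (fun x => - f x) = - sint f.
Proof. by move=> nf; under eq_fun do rewrite -mulN1r; rewrite sintZ// mulN1r. Qed.

Lemma sintB f g : bcont f -> bcont g -> sint (fun x => f x - g x) = sint f - sint g.
Proof. by move=> nf ng; rewrite sintD ?sintN//; exact: bcontN. Qed.

Lemma sint_sum (I : Type) (r : seq I) (P : pred I) (f : I -> S -> R) :
  (forall i, bcont (f i)) ->
  sint (fun x => \sum_(i <- r | P i) f i x) = \sum_(i <- r | P i) sint (f i).
Proof.
move=> nf; elim: r => [|i r IH].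
  by rewrite big_nil; under eq_fun do rewrite big_nil; rewrite sint_cst mul0r.
rewrite big_cons; under eq_fun do rewrite big_cons.
by case: (P i) => //; rewrite sintD ?IH//; exact: bcont_sum.
Qed.

Lemma sint_le f g : bcont f -> bcont g -> (forall x, f x <= g x) -> sint f <= sint g.
Proof. by move=> nf ng fg; apply: le_Rintegral => //; exact: bcont_integrable. Qed.

Lemma sint_norm f : bcont f -> `|sint f| <= sint (fun x => `|f x|).
Proof. by move=> nf; apply: le_normr_Rintegral => //; exact: bcont_integrable. Qed.

Lemma sint_bound f M : bcont f -> (forall x, `|f x| <= M) -> `|sint f| <= M * mass.
Proof.
move=> nf fM; apply: le_trans (sint_norm nf) _; rewrite -sint_cst.
by apply: sint_le => //; [exact: bcont_norm|exact: bcont_cst].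
Qed.

Lemma sint_isometry (phi : {linear V -> V}) (f : S -> R) :
  continuous (phi : V -> V) -> (forall v, sqnorm (phi v) = sqnorm v) -> bcont f ->
  sint (fun x => f (radial_proj (phi (val x)))) = sint f.
Proof.
move=> cphi iphi nf; have cT := continuous_isometry cphi iphi.
have nfT := bcont_isometry cphi iphi nf.
pose T (x : S) : S := radial_proj (phi (val x)).
have mT : measurable_fun setT (T : sphere_borel R n -> sphere_borel R n).
  apply: (@measurability _ _ (sphere_borel R n) (sphere_borel R n) _ _ (@open S)) => //.
  move=> _ [B oB <-]; rewrite setTI; apply: sub_sigma_algebra.
  by move/continuousP: cT; apply.
rewrite /sint /Rintegral; congr fine.
have := @integral_pushforward _ _ (sphere_borel R n) (sphere_borel R n) R T mT mu setT
  (EFin \o f).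
rewrite preimage_setT => <-//.
- apply: eq_measure_integral => A mA _; rewrite /pushforward.
  by have [_] := hmu; apply.
- by apply/measurable_EFinP; apply: measurable_continuous_sphere; have [] := nf.
- exact: bcont_integrable nfT.
Qed.

End UniformIntegral.

(** * Zonal functions and the reproducing property *)

Section PlaneMaps.
Variables (R : realType) (n : nat).
Notation V := (Cvec R n).
Notation S := (sphereT R n).

(** The identity plus a map into the span of e and f: the common form of the reflections and
    rotations below, whose linearity and continuity are thus proved once. *)
Definition plane_map (e f : V) (a b c d : R) (v : V) : V :=
  v + (a * ip v e + b * ip v f) *: e + (c * ip v e + d * ip v f) *: f.

Lemma plane_map_linear e f a b c d : linear (plane_map e f a b c d).
Proof.
move=> k u v; rewrite /plane_map !ipDl !ipZl !scalerDr !scalerA.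
have h (p q p' q' s s' : R) (w : V) : (p * (k * q + q') + s * (k * p' + s')) *: w =
   (k * (p * q + s * p')) *: w + (p * q' + s * s') *: w.
  by rewrite -scalerDl; congr (_ *: _); ring.
by rewrite !h [RHS]addrACA; congr (_ + _); rewrite [RHS]addrACA.
Qed.

HB.instance Definition _ e f a b c d :=
  GRing.isLinear.Build R V V *:%R (plane_map e f a b c d) (plane_map_linear e f a b c d).

Lemma plane_map_continuous e f a b c d : continuous (plane_map e f a b c d).
Proof.
move=> v; have ce := @continuous_ip R n e v; have cf := @continuous_ip R n f v.
apply: cvgD; first (apply: cvgD; first exact: cvg_id).
- by apply: cvgZr_tmp; apply: cvgD; apply: cvgMr.
- by apply: cvgZr_tmp; apply: cvgD; apply: cvgMr.
Qed.

(** The reflection exchanging a and b. Its usual coefficient 2/|a - b|^2 equals 1/(1 - <a, b>) on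
    the sphere; for a = b the vector a - b is 0 and the map is the identity, whatever the inverse of
    0 is. *)
Definition reflection (a b : S) : V -> V :=
  plane_map (val a - val b) 0 (- (1 - ip (val a) (val b))^-1) 0 0 0.

Lemma reflectionE (a b : S) v : reflection a b v =
  v - ((1 - ip (val a) (val b))^-1 * ip v (val a - val b)) *: (val a - val b).
Proof. by rewrite /reflection /plane_map !mul0r !addr0 scaler0 addr0 mulNr scaleNr. Qed.

Lemma ip1_eq (a b : S) : (1 - ip (val a) (val b) == 0) = (a == b).
Proof.
have -> : (a == b) = (val a - val b == 0) by rewrite subr_eq0 (inj_eq val_inj).
rewrite -(sqnorm_eq0 (val a - val b)) -ip_sqnorm ipBl !ipBr !ip_val.
rewrite (ipC (val b)); set c := ip _ _.
rewrite (_ : 1 - c - (c - 1) = 2 * (1 - c)); last by ring.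
by rewrite mulf_eq0 pnatr_eq0.
Qed.

Lemma reflection_sym (a b : S) v w : ip (reflection a b v) w = ip v (reflection a b w).
Proof. rewrite !reflectionE; move: (val a - val b) (1 - _)^-1 => d k.
by rewrite ipBl ipBr ipZl ipZr (ipC d w); congr (_ - _); ring. Qed.

Lemma reflection_l (a b : S) : reflection a b (val a) = val b.
Proof.
rewrite reflectionE ipBr ip_val; have [ab|ab] := eqVneq a b.
  by rewrite ab subrr scaler0 subr0.
by rewrite mulVf ?ip1_eq// scale1r subKr.
Qed.

Lemma reflection_r (a b : S) : reflection a b (val b) = val a.
Proof.
rewrite reflectionE ipBr ip_val (ipC (val b)); have [ab|ab] := eqVneq a b.
  by rewrite ab subrr scaler0 subr0.
rewrite -[_ - 1]opprB mulrN mulVf ?ip1_eq// scaleN1r opprK addrC subrK//.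
Qed.

Lemma reflection_iso (a b : S) v : sqnorm (reflection a b v) = sqnorm v.
Proof.
rewrite -!ip_sqnorm reflectionE.
have [ab|ab] := eqVneq a b.
  by rewrite ab subrr scaler0 subr0.
have dd : ip (val a - val b) (val a - val b) = 2 * (1 - ip (val a) (val b)).
  by rewrite ipBl !ipBr !ip_val (ipC (val b)); ring.
have k0 : 1 - ip (val a) (val b) != 0 by rewrite ip1_eq.
move: (val a - val b) (1 - _) k0 dd => d k k0 dd.
rewrite ipBl !ipBr !ipZl !ipZr (ipC d v) dd.
by field.
Qed.

HB.instance Definition _ a b := GRing.isLinear.Build R V V *:%R (reflection a b)
  (plane_map_linear _ _ _ _ _ _).

(* The rotation of the plane (e, f) by the angle 2 arctan t; this parametrization
   is rational in t. *)
Definition rotation (e f : V) (t : R) : V -> V :=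
  plane_map e f (- (2 * t ^+ 2 / (1 + t ^+ 2))) (- (2 * t / (1 + t ^+ 2)))
    (2 * t / (1 + t ^+ 2)) (- (2 * t ^+ 2 / (1 + t ^+ 2))).

HB.instance Definition _ e f t := GRing.isLinear.Build R V V *:%R (rotation e f t)
  (plane_map_linear _ _ _ _ _ _).

Lemma rotation_iso e f t v : ip e e = 1 -> ip f f = 1 -> ip e f = 0 ->
  sqnorm (rotation e f t v) = sqnorm v.
Proof.
move=> ee ff ef; rewrite -!ip_sqnorm /rotation /plane_map.
rewrite !ipDl !ipDr !ipZl !ipZr ee ff (ipC f e) ef (ipC e v) (ipC f v).
have t0 : 1 + t ^+ 2 != 0 by rewrite gt_eqF// ltr_wpDr// sqr_ge0.
by field.
Qed.

Lemma ip_rotation e f t v w : ip (rotation e f t v) w = ip v w +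
  t * (2 * (ip v e * ip f w - ip v f * ip e w)) -
  (t ^+ 2 * 2 / (1 + t ^+ 2)) *
   (ip v e * ip e w + ip v f * ip f w + t * (ip v e * ip f w - ip v f * ip e w)).
Proof.
rewrite /rotation /plane_map !ipDl !ipZl.
have t0 : 1 + t ^+ 2 != 0 by rewrite gt_eqF// ltr_wpDr// sqr_ge0.
by field.
Qed.

End PlaneMaps.

(** * Integration by parts along rotations *)

Section RotationDerivative.
Variables (R : realType) (n : nat).
Notation V := (Cvec R n).
Notation S := (sphereT R n).
Variables e f : V.
Hypotheses (ee : ip e e = 1) (ff : ip f f = 1) (ef : ip e f = 0).

Definition rot (t : R) (x : S) : S := radial_proj (rotation e f t (val x)).

Lemma val_rot t x : val (rot t x) = rotation e f t (val x).
Proof. by rewrite val_radial_proj1// rotation_iso// sqnorm_val. Qed.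

(** The quadratic remainder is uniform in x so that it can be integrated; the same constant bounds F
    and D, which lets the product rule close up. *)
Definition rot_deriv (F D : S -> R) := exists2 C : R, 0 <= C &
  forall x, [/\ `|F x| <= C, `|D x| <= C &
    forall t, 0 <= t <= 1 -> `|F (rot t x) - F x - t * D x| <= C * t ^+ 2].

Lemma rot_deriv_cst a : rot_deriv (fun=> a) (fun=> 0).
Proof.
exists `|a| => // x; split; rewrite ?normr0// => t _.
by rewrite subrr mulr0 subr0 normr0 mulr_ge0 ?sqr_ge0.
Qed.

Lemma rot_deriv_ip w : rot_deriv (fun x => ip (val x) w)
  (fun x => 2 * (ip (val x) e * ip f w - ip (val x) f * ip e w)).
Proof.
have [_ [C1 h1]] := bcont_ip w.
have [_ [C2 h2]] := bcont_ip e.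
have [_ [C3 h3]] := bcont_ip f.
have C2p : 0 <= C2 by exact: le_trans (normr_ge0 _) (h2 (@north R n)).
have C3p : 0 <= C3 by exact: le_trans (normr_ge0 _) (h3 (@north R n)).
have C1p : 0 <= C1 by exact: le_trans (normr_ge0 _) (h1 (@north R n)).
pose A := C2 * `|ip e w| + C3 * `|ip f w| + C2 * `|ip f w| + C3 * `|ip e w|.
have A0 : 0 <= A by rewrite /A !addr_ge0// mulr_ge0.
exists (C1 + 2 * A); first by rewrite addr_ge0// mulr_ge0.
move=> x.
have b1 : `|ip (val x) e * ip e w| <= C2 * `|ip e w| by rewrite normrM ler_wpM2r.
have b2 : `|ip (val x) f * ip f w| <= C3 * `|ip f w| by rewrite normrM ler_wpM2r.
have b3 : `|ip (val x) e * ip f w| <= C2 * `|ip f w| by rewrite normrM ler_wpM2r.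
have b4 : `|ip (val x) f * ip e w| <= C3 * `|ip e w| by rewrite normrM ler_wpM2r.
have p1 : 0 <= C2 * `|ip e w| by rewrite mulr_ge0.
have p2 : 0 <= C3 * `|ip f w| by rewrite mulr_ge0.
have p3 : 0 <= C2 * `|ip f w| by rewrite mulr_ge0.
have p4 : 0 <= C3 * `|ip e w| by rewrite mulr_ge0.
split.
- by apply: le_trans (h1 x) _; rewrite lerDl mulr_ge0.
- rewrite normrM ger0_norm//; apply: le_trans (_ : 2 * A <= _); last by rewrite lerDr.
  rewrite ler_wpM2l//; apply: le_trans (ler_normB _ _) _.
  by rewrite /A; move: b3 b4 p1 p2; lra.
- move=> t /andP[t0 t1]; rewrite val_rot ip_rotation.
  set q := _ * _ + _ + _; rewrite (_ : _ - _ = - (t ^+ 2 * 2 / (1 + t ^+ 2) * q)); last by ring.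
  rewrite normrN normrM.
  have s0 := sqr_ge0 t.
  have qA : `|q| <= A.
    rewrite /q; apply: le_trans (ler_normD _ _) _.
    have : `|t * (ip (val x) e * ip f w - ip (val x) f * ip e w)| <=
      C2 * `|ip f w| + C3 * `|ip e w|.
      rewrite normrM ger0_norm//.
      apply: le_trans (ler_piMl _ t1) _ => //.
      by apply: le_trans (ler_normB _ _) _; apply: lerD.
    have := ler_normD (ip (val x) e * ip e w) (ip (val x) f * ip f w).
    by rewrite /A; move: b1 b2; lra.
  rewrite ger0_norm; last by rewrite divr_ge0 ?addr_ge0 ?mulr_ge0.
  apply: le_trans (_ : (t ^+ 2 * 2) * A <= _); last first.
    rewrite -subr_ge0 (_ : _ - _ = C1 * t ^+ 2); first by rewrite mulr_ge0.
    by ring.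
  apply: ler_pM => //; first by rewrite divr_ge0 ?addr_ge0 ?mulr_ge0.
  by rewrite ler_pdivrMr ?ltr_wpDr// ler_peMr ?mulr_ge0// lerDl.
Qed.

Lemma rot_derivD F1 D1 F2 D2 : rot_deriv F1 D1 -> rot_deriv F2 D2 ->
  rot_deriv (fun x => F1 x + F2 x) (fun x => D1 x + D2 x).
Proof.
move=> [C1 c1 h1] [C2 c2 h2]; exists (C1 + C2); first exact: addr_ge0.
move=> x; have [a1 b1 d1] := h1 x; have [a2 b2 d2] := h2 x; split.
- by apply: le_trans (ler_normD _ _) _; apply: lerD.
- by apply: le_trans (ler_normD _ _) _; apply: lerD.
- move=> t ht; rewrite (_ : _ - _ = (F1 (rot t x) - F1 x - t * D1 x) +
    (F2 (rot t x) - F2 x - t * D2 x)); last by ring.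
  by rewrite mulrDl; apply: le_trans (ler_normD _ _) _; apply: lerD; auto.
Qed.

Lemma rot_derivM F1 D1 F2 D2 : rot_deriv F1 D1 -> rot_deriv F2 D2 ->
  rot_deriv (fun x => F1 x * F2 x) (fun x => D1 x * F2 x + F1 x * D2 x).
Proof.
move=> [C1 c1 h1] [C2 c2 h2]; exists (4 * (C1 * C2)).
  by rewrite mulr_ge0// mulr_ge0.
have cc : 0 <= C1 * C2 by exact: mulr_ge0.
move=> x; have [a1 b1 d1] := h1 x; have [a2 b2 d2] := h2 x; split.
- rewrite normrM; apply: le_trans (_ : C1 * C2 <= _); first exact: ler_pM.
  by rewrite ler_peMl// ler1n.
- apply: le_trans (ler_normD _ _) _; rewrite !normrM.
  have : `|D1 x| * `|F2 x| <= C1 * C2 by apply: ler_pM.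
  have : `|F1 x| * `|D2 x| <= C1 * C2 by apply: ler_pM.
  by lra.
- move=> t ht; have /andP[t0 t1] := ht.
  (* Four terms, each bounded by C1 C2 t^2: this is where the constant 4 comes from. *)
  rewrite (_ : _ - _ = t ^+ 2 * (D1 x * D2 x) +
    (F1 (rot t x) - F1 x - t * D1 x) * F2 (rot t x) +
    (F2 (rot t x) - F2 x - t * D2 x) * F1 x +
    (F2 (rot t x) - F2 x - t * D2 x) * (t * D1 x)); last by ring.
  have [a2' _ _] := h2 (rot t x).
  have s0 := sqr_ge0 t.
  have e1 : `|t ^+ 2 * (D1 x * D2 x)| <= (C1 * C2) * t ^+ 2.
    by rewrite normrM ger0_norm// mulrC ler_wpM2r// normrM ler_pM.
  have e2 : `|(F1 (rot t x) - F1 x - t * D1 x) * F2 (rot t x)| <= (C1 * C2) * t ^+ 2.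
    by rewrite normrM mulrAC ler_pM// d1.
  have e3 : `|(F2 (rot t x) - F2 x - t * D2 x) * F1 x| <= (C1 * C2) * t ^+ 2.
    by rewrite normrM mulrC -mulrA ler_pM// d2.
  have e4 : `|(F2 (rot t x) - F2 x - t * D2 x) * (t * D1 x)| <= (C1 * C2) * t ^+ 2.
    rewrite normrM mulrC -mulrA ler_pM ?d2//.
    by rewrite normrM ger0_norm//; apply: le_trans b1; rewrite ler_piMl.
  apply: le_trans (ler_normD _ _) _; apply: le_trans (lerD (ler_normD _ _) (lexx _)) _.
  apply: le_trans (lerD (lerD (ler_normD _ _) (lexx _)) (lexx _)) _.
  by move: e1 e2 e3 e4; lra.
Qed.

Lemma rot_deriv_horner (p : {poly R}) F D : rot_deriv F D ->
  rot_deriv (fun x => p.[F x]) (fun x => p^`().[F x] * D x).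
Proof.
move=> FD; elim/poly_ind: p => [|p c IH].
  have := rot_deriv_cst 0; congr rot_deriv; apply/funext => x.
    by rewrite horner0.
  by rewrite deriv0 horner0 mul0r.
have := rot_derivD (rot_derivM IH FD) (rot_deriv_cst c).
congr rot_deriv; apply/funext => x; first by rewrite hornerMXaddC.
by rewrite derivD derivM derivX derivC !hornerD !hornerM hornerX hornerC horner0; ring.
Qed.

Variable mu : {measure set (sphere_borel R n) -> \bar R}.
Hypothesis hmu : is_uniform mu.

(** By invariance the rotated F has the same integral as F, so t times the integral of D is O(t^2);
    then t tends to 0. *)
Lemma sint_rot_deriv F D : bcont F -> bcont D -> rot_deriv F D -> sint mu D = 0.
Proof.
move=> nF nD [C C0 h].
have key (t : R) : 0 < t <= 1 -> `|sint mu D| <= C * mass mu * t.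
  move=> /andP[t0 t1].
  have cr : continuous (rotation e f t) by exact: plane_map_continuous.
  have ir v : sqnorm (rotation e f t v) = sqnorm v by exact: rotation_iso.
  have nFr : bcont (fun x => F (rot t x)) by exact: bcont_isometry.
  have e1 : sint mu (fun x => F (rot t x)) = sint mu F.
    exact: (@sint_isometry R n mu hmu (rotation e f t : {linear V -> V})).
  have e2 : t * sint mu D = - sint mu (fun x => F (rot t x) - F x - t * D x).
    rewrite sintB//; last first.
    - exact: bcontZ.
    - exact: bcontB.
    by rewrite sintB// e1 subrr sub0r opprK sintZ.
  rewrite -(ler_pM2l t0) -[X in X * `|_|](gtr0_norm t0) -normrM e2 normrN.
  apply: le_trans (_ : C * t ^+ 2 * mass mu <= _).
    apply: sint_bound => //; first by apply: bcontB; [exact: bcontB|exact: bcontZ].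
    by move=> x; have [_ _] := h x; apply; rewrite (ltW t0) t1.
  by rewrite (_ : t * _ = C * t ^+ 2 * mass mu)//; ring.
apply/eqP; rewrite -normr_eq0 eq_le normr_ge0 andbT.
apply/ler_addgt0Pl => eps eps0; rewrite addr0.
have m0 := mass_gt0 hmu.
have K0 : 0 < C * mass mu + 1 by rewrite ltr_wpDl// mulr_ge0// ltW.
(* The cap 1 keeps t in the range where the remainder is controlled; the + 1 keeps the denominator
   positive even for C = 0. *)
pose t := Num.min 1 (eps / (C * mass mu + 1)).
have t0 : 0 < t by rewrite lt_min ltr01 divr_gt0.
have /key h1 : 0 < t <= 1 by rewrite t0 ge_min lexx.
apply: le_trans h1 _; apply: le_trans (_ : (C * mass mu + 1) * t <= _).
  by rewrite ler_wpM2r ?lerDl// ltW.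
by rewrite mulrC -ler_pdivlMr// ge_min lexx orbT.
Qed.

End RotationDerivative.

(** * Orthogonality and reproducing property of zonal Gegenbauer functions *)

Section ReproducingKernel.
Variables (R : realType) (n : nat).
Hypothesis hn : (1 <= n)%N.
Notation V := (Cvec R n).
Notation S := (sphereT R n).
Variable mu : {measure set (sphere_borel R n) -> \bar R}.
Hypothesis hmu : is_uniform mu.
Notation N := (north_vec R n).

Definition zonal2 (b : S) (g h : {poly R}) : R :=
  sint mu (fun x => g.[ip (val x) N] * h.[ip (val x) (val b)]).

Lemma bcont_zonal (a : V) (g : {poly R}) : bcont (fun x : S => g.[ip (val x) a]).
Proof. by apply: bcont_horner; exact: bcont_ip. Qed.

Lemma bcont_zonal2 (a b : V) (g h : {poly R}) :
  bcont (fun x : S => g.[ip (val x) a] * h.[ip (val x) b]).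
Proof. by apply: bcontM; exact: bcont_zonal. Qed.

Lemma zonal2Dl b g1 g2 h : zonal2 b (g1 + g2) h = zonal2 b g1 h + zonal2 b g2 h.
Proof.
rewrite /zonal2 -sintD//; try exact: bcont_zonal2.
by congr sint; apply/funext => x; rewrite hornerD mulrDl.
Qed.

Lemma zonal2Zl b a g h : zonal2 b (a *: g) h = a * zonal2 b g h.
Proof.
rewrite /zonal2 -sintZ//; try exact: bcont_zonal2.
by congr sint; apply/funext => x; rewrite hornerZ mulrA.
Qed.

Lemma sint_reflection (a b : S) (f : S -> R) : bcont f ->
  sint mu (fun x => f (radial_proj (reflection a b (val x)))) = sint mu f.
Proof.
move=> nf; apply: (@sint_isometry R n mu hmu (reflection a b : {linear V -> V})) => //.
  exact: plane_map_continuous.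
exact: reflection_iso.
Qed.

Lemma val_reflection (a b x : S) :
  val (radial_proj (reflection a b (val x)) : S) = reflection a b (val x).
Proof. by rewrite val_radial_proj1// reflection_iso sqnorm_val. Qed.

(** The reflection exchanging the two poles preserves the measure. *)
Lemma zonal2C b g h : zonal2 b g h = zonal2 b h g.
Proof.
rewrite /zonal2 -(sint_reflection north b); last exact: bcont_zonal2.
congr sint; apply/funext => x.
rewrite val_reflection !reflection_sym -val_north reflection_l reflection_r mulrC.
by [].
Qed.

Lemma zonal2Dr b g h1 h2 : zonal2 b g (h1 + h2) = zonal2 b g h1 + zonal2 b g h2.
Proof. by rewrite !(zonal2C _ g) zonal2Dl. Qed.

Lemma zonal2Zr b a g h : zonal2 b g (a *: h) = a * zonal2 b g h.
Proof. by rewrite !(zonal2C _ g) zonal2Zl. Qed.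

Lemma zonal2Nl b g h : zonal2 b (- g) h = - zonal2 b g h.
Proof. by rewrite -scaleN1r zonal2Zl mulN1r. Qed.

Lemma zonal2Nr b g h : zonal2 b g (- h) = - zonal2 b g h.
Proof. by rewrite -scaleN1r zonal2Zr mulN1r. Qed.

Lemma sum_affine (I : finType) (P : pred I) (a b : I -> R) (k1 k2 k3 : R) :
  \sum_(j | P j) (k1 - a j * k2 + b j * k3) =
  #|P|%:R * k1 - (\sum_(j | P j) a j) * k2 + (\sum_(j | P j) b j) * k3.
Proof. by rewrite big_split sumrB sumr_const /= !mulr_suml mulr_natl. Qed.

Lemma ip_basis_north (v w : V) :
  \sum_(j < n.+1 | j != ord_max) ip v (xdir R j) * ip w (xdir R j) +
  \sum_(j < n.+1) ip v (ydir R j) * ip w (ydir R j) = ip v w - ip v N * ip w N.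
Proof.
rewrite -(ip_basis v w) big_split /= [X in _ = X + _ - _](bigD1 ord_max)//=.
rewrite /north_vec /xdir; ring.
Qed.

(* The integrand is half the derivative, along the rotations of the plane
   (N, f), of <x, f> g(<x, N>) h(<x, b>). *)
Lemma zonal2_rotation (b : S) (f : V) g h : ip f f = 1 -> ip N f = 0 ->
  sint mu (fun x => ip (val x) N * g.[ip (val x) N] * h.[ip (val x) (val b)]
   - ip (val x) f ^+ 2 * (g^`().[ip (val x) N] * h.[ip (val x) (val b)])
   + ip (val x) f * g.[ip (val x) N] * h^`().[ip (val x) (val b)] *
     (ip (val x) N * ip f (val b) - ip (val x) f * ip N (val b))) = 0.
Proof.
move=> ff Nf; have NN : ip N N = 1 by rewrite -val_north ip_val.
pose D (x : S) : R := ip (val x) N * g.[ip (val x) N] * h.[ip (val x) (val b)]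
   - ip (val x) f ^+ 2 * (g^`().[ip (val x) N] * h.[ip (val x) (val b)])
   + ip (val x) f * g.[ip (val x) N] * h^`().[ip (val x) (val b)] *
     (ip (val x) N * ip f (val b) - ip (val x) f * ip N (val b)).
have nD : bcont D.
  have ni := @bcont_ip R n; have nz := bcont_zonal.
  apply: bcontD; first apply: bcontB.
  - by apply: bcontM; [apply: bcontM|].
  - by apply: bcontM; [apply: bcontX|apply: bcontM].
  - apply: bcontM; first by apply: bcontM; [apply: bcontM|].
    by apply: bcontB; apply: bcontM => //; exact: bcont_cst.
suff : 2 * sint mu D = 0.
  by move/eqP; rewrite mulf_eq0 pnatr_eq0/= => /eqP.
rewrite -sintZ//.
apply: (@sint_rot_deriv R n N f NN ff Nf mu hmu
  (fun x => ip (val x) f * (g.[ip (val x) N] * h.[ip (val x) (val b)]))).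
- by apply: bcontM; [exact: bcont_ip|exact: bcont_zonal2].
- exact: bcontZ.
- have := rot_derivM (rot_deriv_ip NN ff Nf f)
    (rot_derivM (rot_deriv_horner g (rot_deriv_ip NN ff Nf N))
       (rot_deriv_horner h (rot_deriv_ip NN ff Nf (val b)))).
  congr rot_deriv; apply/funext => x; rewrite ff NN (ipC f N) Nf /D.
  ring.
Qed.

(* Sum of zonal2_rotation over an orthonormal basis of the complement of N. *)
Lemma zonal2_divergence (b : S) g h : let c := ip N (val b) in
  zonal2 b ((2 * n%:R + 1) *: ('X * g) - (1 - 'X^2) * g^`()) h +
  zonal2 b ('X * g) ('X * h^`()) = c * zonal2 b g h^`().
Proof.
move=> c; apply/eqP; rewrite -subr_eq0; apply/eqP.
pose T (f : V) (x : S) := ip (val x) N * g.[ip (val x) N] * h.[ip (val x) (val b)]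
   - ip (val x) f ^+ 2 * (g^`().[ip (val x) N] * h.[ip (val x) (val b)])
   + ip (val x) f * g.[ip (val x) N] * h^`().[ip (val x) (val b)] *
     (ip (val x) N * ip f (val b) - ip (val x) f * ip N (val b)).
have nT f : bcont (T f).
  have ni := @bcont_ip R n; have nz := bcont_zonal.
  apply: bcontD; first apply: bcontB.
  - by apply: bcontM; [apply: bcontM|].
  - by apply: bcontM; [apply: bcontX|apply: bcontM].
  - apply: bcontM; first by apply: bcontM; [apply: bcontM|].
    by apply: bcontB; apply: bcontM => //; exact: bcont_cst.
have e0 : sint mu (fun x => \sum_(j < n.+1 | j != ord_max) T (xdir R j) x +
   \sum_(j < n.+1) T (ydir R j) x) = 0.
  rewrite sintD//; try exact: bcont_sum.
  rewrite !sint_sum// !big1 ?addr0// => j jN; apply: zonal2_rotation.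
  - by rewrite ip_ydir !mxE !eqxx.
  - by rewrite ip_ydir !mxE.
  - by rewrite ip_xdir !mxE !eqxx.
  - by rewrite ip_xdir !mxE eqxx/= (negbTE jN).
rewrite -[RHS]e0 /zonal2 -sintZ//; last exact: bcont_zonal2.
rewrite -sintD//; try exact: bcont_zonal2.
rewrite -sintB//; last 2 first.
- by apply: bcontD; exact: bcont_zonal2.
- by apply: bcontZ; exact: bcont_zonal2.
congr sint; apply/funext => x; rewrite /T -/c.
set u := ip (val x) N; set v := ip (val x) (val b).
pose A (f : V) : R := ip (val x) f * ip (val x) f.
pose B (f : V) : R := ip (val x) f * ip (val b) f.
(* In each direction f the integrand is affine in <x, f>^2 and <x, f><b, f>, whose sums over the
   basis of the complement of N are 1 - u^2 and v - u c. *)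
have TE f : ip (val x) N * g.[u] * h.[v] - ip (val x) f ^+ 2 * (g^`().[u] * h.[v])
   + ip (val x) f * g.[u] * h^`().[v] * (u * ip f (val b) - ip (val x) f * c) =
   u * g.[u] * h.[v] - A f * (g^`().[u] * h.[v] + c * (g.[u] * h^`().[v])) +
     B f * (u * (g.[u] * h^`().[v])).
  by rewrite /A /B -/u (ipC f); ring.
rewrite (eq_bigr _ (fun j _ => TE (xdir R j))) (eq_bigr _ (fun j _ => TE (ydir R j))).
rewrite !sum_affine.
(* The complement of N has n real directions [xdir] and n + 1 directions [ydir], which gives the
   coefficient 2n + 1. *)
have cN : #|[pred j : 'I_n.+1 | j != ord_max]| = n.
  by have := cardC (pred1 (@ord_max n)); rewrite card1 card_ord add1n => -[].
have sA : \sum_(j < n.+1 | j != ord_max) A (xdir R j) + \sum_(j < n.+1) A (ydir R j) =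
  1 - u ^+ 2.
  by rewrite ip_basis_north ip_val -expr2.
have sB : \sum_(j < n.+1 | j != ord_max) B (xdir R j) + \sum_(j < n.+1) B (ydir R j) =
  v - u * c.
  by rewrite ip_basis_north (ipC (val b)).
move: sA sB cN; set A1 := \sum_(j | _) A _; set A2 := \sum_j A _.
set B1 := \sum_(j | _) B _; set B2 := \sum_j B _ => sA sB cN.
rewrite cN card_ord -(natr1 n).
have -> : A2 = 1 - u ^+ 2 - A1 by rewrite -sA addrC addKr.
have -> : B2 = v - u * c - B1 by rewrite -sB addrC addKr.
rewrite !(hornerD, hornerN, hornerZ, hornerM, hornerX, hornerXn, hornerC).
ring.
Qed.

(** Self-adjointness of the zonal Laplacian: applied to g', [zonal2_divergence] expresses the left
    side by a Dirichlet form symmetric in g and h. *)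
Lemma zonal2_laplacian b g h :
  zonal2 b ((1 - 'X^2) * g^`()^`() - (2 * n%:R + 1) *: ('X * g^`())) h =
  zonal2 b g ((1 - 'X^2) * h^`()^`() - (2 * n%:R + 1) *: ('X * h^`())).
Proof.
have key g' h' : zonal2 b ((1 - 'X^2) * g'^`()^`() - (2 * n%:R + 1) *: ('X * g'^`())) h' =
    zonal2 b ('X * g'^`()) ('X * h'^`()) - ip N (val b) * zonal2 b g'^`() h'^`().
  by rewrite -zonal2_divergence opprD addrCA subrr addr0 -zonal2Nl opprB.
by rewrite key [RHS]zonal2C key !(zonal2C b h^`()) !(zonal2C b ('X * h^`())).
Qed.

(** Eigenfunctions of a symmetric operator with distinct eigenvalues. *)
Lemma zonal2_orthogonal b m l : m != l -> zonal2 b (geg R n m) (geg R n l) = 0.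
Proof.
move=> ml; have := zonal2_laplacian b (geg R n m) (geg R n l).
rewrite !geg_ode !zonal2Nl !zonal2Nr zonal2Zl zonal2Zr => /eqP.
rewrite -subr_eq0 -opprB opprK addrC -mulrBl oppr_eq0 mulf_eq0.
by rewrite (eigenvalue_inj _ hn) (negbTE ml) => /eqP.
Qed.

(** The derivative of C_m is a combination of the C_j with j < m <= l; the induction descends by two
    degrees at a time. *)
Lemma zonal2_deriv_orthogonal b l m : (m <= l)%N ->
  zonal2 b (geg R n l) (geg R n m)^`() = 0.
Proof.
have z0 : zonal2 b (geg R n l) 0 = 0 by rewrite -(scale0r 0) zonal2Zr mul0r.
elim/ltn_ind: m => -[|[|m]] IH ml.
- by rewrite geg0 derivC.
- have := geg_derivE R n 0; rewrite geg_prev0 deriv0 subr0 => ->.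
  by rewrite zonal2Zr zonal2_orthogonal ?mulr0// gtn_eqF.
have := geg_derivE R n m.+1; rewrite geg_prevS => /(canRL (subrK _)) ->.
rewrite zonal2Dr IH ?addr0//; last by apply: leq_trans ml; exact: leqW.
by rewrite zonal2Zr zonal2_orthogonal ?mulr0// gtn_eqF.
Qed.

(** Its inverse is (m + n) Gamma(n) / (2 pi^(n+1)), the coefficient in the heat kernel series; see
    [geg_weightV]. *)
Definition geg_weight m : R := mass mu * n%:R / (m%:R + n%:R).

(** [zonal2_divergence] with g = C_m and h = C_(m+1) contains the unknown integral of degree m + 1,
    and every other term in it is either zero by orthogonality or known by induction through
    [geg_derivE]. The remaining multiples of c C_m(c) and C_(m-1)(c) recombine into C_(m+1)(c) by
    the three-term recursion. *)
Lemma geg_reproducing_north b m :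
  zonal2 b (geg R n m) (geg R n m) = geg_weight m * (geg R n m).[ip N (val b)].
Proof.
set c := ip N (val b).
have n0 : 0 < n%:R :> R by rewrite ltr0n.
have pr k l : zonal2 b (geg_prev R n k) (geg R n l) =
  (k == l.+1)%:R * zonal2 b (geg R n l) (geg R n l).
  case: k => [|k]; first by rewrite geg_prev0 -(scale0r 0) zonal2Zl !mul0r.
  rewrite geg_prevS eqSS; have [->|kl] := eqVneq k l; first by rewrite mul1r.
  by rewrite mul0r zonal2_orthogonal.
elim/ltn_ind: m => -[|m] IH.
  rewrite geg0 /zonal2 /geg_weight add0r hornerC mulr1 mulfK ?gt_eqF//.
  rewrite (_ : (fun x : S => _) = fun=> 1); first by rewrite sint_cst mul1r.
  by apply/funext => x; rewrite !hornerC mulr1.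
have m0 : 0 <= m%:R :> R by [].
have XG : 'X * geg R n m = (2 * (m%:R + n%:R))^-1 *:
    (m.+1%:R *: geg R n m.+1 + (m%:R + 2 * n%:R - 1) *: geg_prev R n m).
  by rewrite geg_rec subrK scalerA mulVf ?scale1r// gt_eqF// mulr_gt0// ltr_wpDl.
have h := zonal2_divergence b (geg R n m) (geg R n m.+1).
have wk k : geg_weight k * (k%:R + n%:R) = mass mu * n%:R.
  by rewrite divfK// gt_eqF// ltr_wpDl.
(* The product of C_(m-1) and C_m', reduced to degree m - 1. *)
have z0 : zonal2 b (geg_prev R n m) (geg R n m)^`() =
  2 * (mass mu * n%:R) * (geg_prev R n m).[c].
  case: m IH {m0 XG h} => [|k] IH.
    by rewrite geg_prev0 horner0 mulr0 -(scale0r 0) zonal2Zl mul0r.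
  have := geg_derivE R n k => /(canRL (subrK _)) ->.
  rewrite geg_prevS zonal2Dr zonal2Zr IH 1?ltnW// -(wk k).
  have -> : zonal2 b (geg R n k) (geg_prev R n k)^`() = 0.
    case: k {IH} => [|k]; first by rewrite geg_prev0 deriv0 -(scale0r 0) zonal2Zr mul0r.
    by rewrite geg_prevS zonal2_deriv_orthogonal.
  by rewrite addr0; ring.
(* The product of C_m and C_(m+1)', reduced to degree m. *)
have z1 : zonal2 b (geg R n m) (geg R n m.+1)^`() = 2 * (mass mu * n%:R) * (geg R n m).[c].
  have := geg_derivE R n m => /(canRL (subrK _)) ->.
  rewrite zonal2Dr zonal2Zr IH// -(wk m).
  have -> : zonal2 b (geg R n m) (geg_prev R n m)^`() = 0.
    case: m {IH m0 XG h z0} => [|k];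
      first by rewrite geg_prev0 deriv0 -(scale0r 0) zonal2Zr mul0r.
    by rewrite geg_prevS zonal2_deriv_orthogonal.
  by rewrite addr0; ring.
have XD : 'X * (geg R n m.+1)^`() = m.+1%:R *: geg R n m.+1 + (geg R n m)^`().
  by have := geg_derivB R n m.+1; rewrite geg_prevS => <-; rewrite subrK.
have mS : m == m.+2 = false by apply/negbTE; rewrite neq_ltn ltnS leqnSn.
move: h; rewrite z1 XD geg_derivA zonal2Dr !zonal2Zr.
rewrite (_ : _ - (_ - _) = (2 * n%:R + 1 + m%:R) *: ('X * geg R n m) +
   - (m%:R + 2 * n%:R - 1) *: geg_prev R n m); last first.
  by rewrite opprB addrA scaleNr -scalerDl.
rewrite XG !(zonal2Dl, zonal2Zl) !pr mS mul0r z0 (zonal2_deriv_orthogonal _ (leqnSn m)) -/c.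
have := congr1 (fun p => p.[c]) (geg_rec R n m).
rewrite /geg_weight hornerD hornerN !hornerZ hornerM hornerX -(natr1 m).
have mn : m%:R + n%:R != 0 :> R by rewrite gt_eqF// ltr_wpDl.
have mn1 : m%:R + 1 + n%:R != 0 :> R by rewrite gt_eqF// ltr_wpDl// addr_ge0.
have m1 : m%:R + 1 != 0 :> R by rewrite gt_eqF// ltr_wpDl.
move: (zonal2 _ _ _) (geg R n m.+1).[c] (geg R n m).[c] (geg_prev R n m).[c] (mass mu).
move: (m%:R : R) (n%:R : R) mn mn1 m1 => M K mn mn1 m1 z g1 g0 gp A rec h.
apply: (mulfI m1); rewrite mulrCA rec.
apply: (mulfI (_ : (M + 1 + K) / (M + K) != 0)); first by rewrite mulf_neq0 ?invr_neq0.
apply: (eq_of_subr h); field.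
by rewrite mn1 mn.
Qed.

(** A reflection moves the pole a to N; its self-adjointness carries it over to b. *)
Lemma geg_reproducing (a b : S) m l :
  sint mu (fun x => (geg R n m).[ip (val x) (val a)] * (geg R n l).[ip (val x) (val b)]) =
  (m == l)%:R * (geg_weight m * (geg R n m).[ip (val a) (val b)]).
Proof.
rewrite -(sint_reflection north a); last exact: bcont_zonal2.
pose b' : S := radial_proj (reflection north a (val b)).
transitivity (zonal2 b' (geg R n m) (geg R n l)).
  congr sint; apply/funext => x.
  by rewrite val_reflection !reflection_sym reflection_r /b' val_reflection.
have [<-|ml] := eqVneq m l; last by rewrite zonal2_orthogonal// mul0r.
by rewrite geg_reproducing_north /b' val_reflection -reflection_sym -val_north reflection_l
  mul1r.
Qed.

Lemma geg_weight_gt0 m : 0 < geg_weight m.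
Proof.
by rewrite divr_gt0 ?mulr_gt0 ?mass_gt0 ?ltr0n// ltr_wpDl// ltr0n.
Qed.

(* The reproducing property makes this a Cauchy-Schwarz inequality. *)
Lemma geg_bound (a b : S) m :
  `|(geg R n m).[ip (val a) (val b)]| <= (geg R n m).[1].
Proof.
have w0 := geg_weight_gt0 m; have r := geg_reproducing.
pose g (c x : S) : R := (geg R n m).[ip (val x) (val c)].
have ng c : bcont (g c) by exact: bcont_zonal.
have sq c : sint mu (fun x => g c x * g c x) = geg_weight m * (geg R n m).[1].
  by rewrite r eqxx mul1r ip_val.
have h (s : R) : s ^+ 2 = 1 -> 0 <= 2 * (geg_weight m * (geg R n m).[1]) +
    s * (2 * (geg_weight m * (geg R n m).[ip (val a) (val b)])).
  move=> s1; have rab := r a b m m; rewrite eqxx mul1r in rab.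
  have -> : 2 * (geg_weight m * (geg R n m).[1]) +
    s * (2 * (geg_weight m * (geg R n m).[ip (val a) (val b)])) =
    sint mu (fun x => (g a x + s * g b x) * (g a x + s * g b x)).
    have -> : (fun x => (g a x + s * g b x) * (g a x + s * g b x)) =
      (fun x => g a x * g a x + g b x * g b x + s * 2 * (g a x * g b x)).
      apply/funext => x; rewrite (_ : _ + s * 2 * _ =
        g a x * g a x + s ^+ 2 * (g b x * g b x) + s * 2 * (g a x * g b x)).
        by ring.
      by rewrite s1 mul1r.
    rewrite sintD ?sintZ ?sintD//; try (by apply: bcontM); last 2 first.
    - by apply: bcontD; apply: bcontM.
    - by apply: bcontZ; apply: bcontM.
    by rewrite !sq rab; ring.
  by rewrite /sint; apply: Rintegral_ge0 => x _; rewrite -expr2 sqr_ge0.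
have s1 : (-1) ^+ 2 = 1 :> R by rewrite sqrrN expr1n.
have := h 1 (expr1n _ _); have := h (-1) s1.
move: (geg R n m).[1] (geg R n m).[ip (val a) (val b)] => A B h1 h2.
have {}h1 : 0 <= geg_weight m * (A - B) by move: h1; lra.
have {}h2 : 0 <= geg_weight m * (A + B) by move: h2; lra.
rewrite ler_norml; move: h1 h2; rewrite !pmulr_rge0// => h1 h2; lra.
Qed.

(** [zonal2_divergence] with g = U^k and h = 1, where U = (1 + X)/2 and 1 - X^2 = 4 U (1 - U). The
    ratio of consecutive integrals tends to 1, which is what the separation argument needs. *)
Lemma sint_capS (b : S) k :
  (k%:R + 2 * n%:R + 1) * sint mu (fun x => ((1 + ip (val x) (val b)) / 2) ^+ k.+1) =
  (k%:R + n%:R + 2^-1) * sint mu (fun x => ((1 + ip (val x) (val b)) / 2) ^+ k).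
Proof.
pose U : {poly R} := 2^-1 *: (1 + 'X).
have e j : sint mu (fun x => ((1 + ip (val x) (val b)) / 2) ^+ j) = zonal2 b (U ^+ j) 1.
  rewrite zonal2C /zonal2; congr sint; apply/funext => x.
  by rewrite hornerC mul1r horner_exp hornerZ hornerD hornerX hornerC mulrC.
have XU : 'X = 2 * U - 1 by rewrite /U -mul_polyC mulrA -polyC_natr -polyCM divff// mul1r
  addrC addKr.
have dU : U^`() = (2^-1)%:P by rewrite /U derivZ derivD derivC derivX add0r -mul_polyC mulr1.
have h2 : 2 * (2^-1)%:P = 1 :> {poly R} by rewrite -polyC_natr -polyCM divff.
have key : (1 - 'X^2) * (U ^+ k)^`() = (2 * k%:R) *: (U ^+ k - U ^+ k.+1).
  case: (k) => [|l]; first by rewrite expr0 derivC !mulr0 scale0r.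
  rewrite deriv_exp dU /= XU -mul_polyC -mulr_natl.
  transitivity ((2 * (2^-1)%:P) * (2 * (U * (1 - U)) * U ^+ l * l.+1%:R)).
    by rewrite exprS expr1; ring.
  by rewrite h2 mul1r !(polyCM, polyC_natr) !exprS; ring.
have XUk : 'X * U ^+ k = 2 *: U ^+ k.+1 - U ^+ k.
  by rewrite XU -mul_polyC polyC_natr exprS; ring.
rewrite !e; have /= := zonal2_divergence b (U ^+ k) 1.
rewrite derivC mulr0 (_ : zonal2 b _ 0 = 0); last by rewrite -(scale0r 0) zonal2Zr mul0r.
rewrite (_ : zonal2 b _ 0 = 0); last by rewrite -(scale0r 0) zonal2Zr mul0r.
rewrite key XUk scalerBr scalerA scalerBr opprB !(zonal2Dl, zonal2Nl, zonal2Zl) => h.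
by apply: (mulfI (_ : 2 != 0)) => //; apply: (eq_of_subr h); field.
Qed.

End ReproducingKernel.

(** * Bidegree decomposition *)

Section ComplexArithmetic.
Variable R : realType.
Implicit Types z w : R[i].

Lemma Re_add z w : complex.Re (z + w) = complex.Re z + complex.Re w.
Proof. by case: z w => [a b] [c d]. Qed.

Lemma Im_add z w : complex.Im (z + w) = complex.Im z + complex.Im w.
Proof. by case: z w => [a b] [c d]. Qed.

Lemma Re_opp z : complex.Re (- z) = - complex.Re z.
Proof. by case: z. Qed.

Lemma Im_opp z : complex.Im (- z) = - complex.Im z.
Proof. by case: z. Qed.

Lemma Re_mul z w : complex.Re (z * w) =
  complex.Re z * complex.Re w - complex.Im z * complex.Im w.
Proof. by case: z w => [a b] [c d]. Qed.

Lemma Im_mul z w : complex.Im (z * w) =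
  complex.Re z * complex.Im w + complex.Im z * complex.Re w.
Proof. by case: z w => [a b] [c d]. Qed.

Lemma eq_ReIm z w : complex.Re z = complex.Re w -> complex.Im z = complex.Im w -> z = w.
Proof. by case: z w => [a b] [c d] /= -> ->. Qed.

Lemma Re_sum (I : Type) (r : seq I) (P : pred I) (F : I -> R[i]) :
  complex.Re (\sum_(i <- r | P i) F i) = \sum_(i <- r | P i) complex.Re (F i).
Proof. by elim/big_rec2: _ => // i x y _ <-; rewrite Re_add. Qed.

Lemma Im_sum (I : Type) (r : seq I) (P : pred I) (F : I -> R[i]) :
  complex.Im (\sum_(i <- r | P i) F i) = \sum_(i <- r | P i) complex.Im (F i).
Proof. by elim/big_rec2: _ => // i x y _ <-; rewrite Im_add. Qed.

Lemma conjcM z w : conjc (z * w) = conjc z * conjc w.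
Proof. exact: (rmorphM (@conjc R)). Qed.

Lemma Re_conjc z : complex.Re (conjc z) = complex.Re z. Proof. by case: z. Qed.

Lemma Im_conjc z : complex.Im (conjc z) = - complex.Im z. Proof. by case: z. Qed.

Definition cis (x : R) : R[i] := cos x +i* sin x.

Lemma cisD x y : cis (x + y) = cis x * cis y.
Proof. by apply: eq_ReIm; rewrite ?Re_mul ?Im_mul /= ?cosD ?sinD; ring. Qed.

Lemma cis0 : cis 0 = 1.
Proof. by apply: eq_ReIm; rewrite /= ?cos0 ?sin0. Qed.

Lemma cisX x k : cis x ^+ k = cis (k%:R * x).
Proof.
elim: k => [|k IH]; first by rewrite expr0 mul0r cis0.
by rewrite exprS IH -cisD -(natr1 k) mulrDl mul1r addrC.
Qed.

Lemma conj_cis x : conjc (cis x) = cis (- x).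
Proof. by apply: eq_ReIm; rewrite /= ?cosN ?sinN. Qed.

Lemma cis_neq0 x : cis x != 0.
Proof.
apply/eqP => h; have := cisD x (- x); rewrite h mul0r subrr cis0 => /eqP.
by rewrite oner_eq0.
Qed.

Lemma cisN x : cis (- x) = (cis x)^-1.
Proof. by apply: (mulIf (cis_neq0 x)); rewrite -cisD addNr cis0 mulVf// cis_neq0. Qed.

Lemma normc_cis x : `|cis x| = 1.
Proof. by rewrite normc_def /= cos2Dsin2 sqrtr1. Qed.

(** By cos x = 1 - 2 sin(x/2)^2 the sine of x/2 vanishes, while it is positive for 0 < x/2 < pi;
    conjugation reduces to x >= 0. *)
Lemma cis_eq1 x : `|x| < 2 * pi -> cis x = 1 -> x = 0.
Proof.
wlog x0 : x / 0 <= x.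
  move=> hw xp x1; have [|x0] := leP 0 x; first by move/hw; apply.
  apply/eqP; rewrite -oppr_eq0; apply/eqP; apply: hw; rewrite ?normrN ?cisN ?x1 ?invr1//.
  by rewrite oppr_ge0 ltW.
rewrite ger0_norm// => xp [c1 _].
have : cos (x / 2 + x / 2) = 1 by rewrite -splitr.
rewrite cosD -!expr2 cos2sin2 => h.
have /eqP : sin (x / 2) ^+ 2 = 0 by lra.
rewrite sqrf_eq0 => /eqP s0; apply/eqP; rewrite eq_le x0 andbT leNgt.
apply/negP => xgt0; have : 0 < sin (x / 2).
  by apply: sin_gt0_pi; rewrite divr_gt0// ltr_pdivrMr// mulrC.
by rewrite s0 ltxx.
Qed.

(** A geometric sum of ratio e^(id) with d = 2 pi (k - l)/M; since |d| < 2 pi, the ratio is 1 only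
    for k = l. *)
Lemma sum_cis (M k l : nat) : (k < M)%N -> (l < M)%N ->
  \sum_(j < M) cis (j%:R * (2 * pi / M%:R)) ^+ k *
     conjc (cis (j%:R * (2 * pi / M%:R))) ^+ l = (k == l)%:R * M%:R :> R[i].
Proof.
move=> kM lM; have M0 : 0 < M%:R :> R by rewrite ltr0n (leq_trans _ kM).
pose d : R := (k%:R - l%:R) * (2 * pi / M%:R).
have e (j : 'I_M) : cis (j%:R * (2 * pi / M%:R)) ^+ k *
     conjc (cis (j%:R * (2 * pi / M%:R))) ^+ l = cis d ^+ j.
  by rewrite conj_cis !cisX -cisD; congr cis; rewrite /d; ring.
under eq_bigr do rewrite e.
have [kl|kl] := eqVneq k l.
  rewrite /d kl subrr mul0r cis0; under eq_bigr do rewrite expr1n.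
  by rewrite sumr_const card_ord mul1r.
have d1 : cis d != 1.
  apply/eqP => /cis_eq1 h; move: kl; rewrite -(eqr_nat R) -subr_eq0.
  suff -> : (k%:R - l%:R : R) = 0 by rewrite eqxx.
  have /eqP : d = 0.
    apply: h; rewrite /d normrM (ger0_norm (x := _ / _)); last first.
      by rewrite divr_ge0 ?mulr_ge0 ?pi_ge0.
    rewrite mulrA ltr_pdivrMr// mulrC ltr_pM2l ?mulr_gt0 ?pi_gt0//.
    have kM' : k%:R < M%:R :> R by rewrite ltr_nat.
    have lM' : l%:R < M%:R :> R by rewrite ltr_nat.
    have k0 : 0 <= k%:R :> R by []. have l0 : 0 <= l%:R :> R by [].
    by rewrite ltr_norml; lra.
  rewrite /d mulf_eq0 => /orP[/eqP//|].
  by rewrite gt_eqF// divr_gt0// mulr_gt0// pi_gt0.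
rewrite mul0r; apply: (mulfI (_ : cis d - 1 != 0)); first by rewrite subr_eq0.
rewrite [RHS]mulr0 -subrX1 cisX.
have -> : M%:R * d = (k%:R - l%:R) * (2 * pi) by rewrite /d; field; rewrite gt_eqF.
rewrite (_ : cis _ = (cis (2 * pi)) ^+ k * conjc (cis (2 * pi)) ^+ l).
  have -> : cis (2 * pi) = 1.
    apply: eq_ReIm => /=.
      by rewrite mulrC mulr_natr cos2pi.
    by rewrite mulrC mulr_natr sin2pi.
  by rewrite conjc1 !expr1n mulr1 subrr.
by rewrite conj_cis !cisX -cisD; congr cis; ring.
Qed.

End ComplexArithmetic.

(** * Splitting a Gegenbauer polynomial into bihomogeneous parts *)

Section Bidegrees.
Variables (R : realType) (n : nat).
Notation G m := (map_poly (real_complex R) (geg R n m)).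

Lemma size_geg m : (size (geg R n m) <= m.+1)%N.
Proof.
suff : (size (geg R n m) <= m.+1)%N /\ (size (geg_prev R n m) <= m)%N by case.
elim: m => [|m [IH1 IH2]]; first by rewrite geg0 geg_prev0 size_poly1 size_poly0.
rewrite geg_prevS; split => //.
have m0 : m.+1%:R != 0 :> R by rewrite pnatr_eq0.
rewrite -(size_scale _ m0) geg_rec; apply: leq_trans (size_polyD _ _) _.
rewrite size_polyN geq_max; apply/andP; split.
  apply: leq_trans (size_scale_leq _ _) _; rewrite mulrC.
  have [->|g0] := eqVneq (geg R n m) 0; first by rewrite mul0r size_poly0.
  by rewrite size_mulX.
by apply: leq_trans (size_scale_leq _ _) _; do 2!apply: leqW.
Qed.

(** The coefficient of a^p b^q in C_m^n((a + b)/2). *)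
Definition bicoef m p q : R :=
  (geg R n m)`_(p + q) * 'C(p + q, p)%:R / 2 ^+ (p + q).

Lemma bicoef0 m p q : (m < p + q)%N -> bicoef m p q = 0.
Proof. by move=> h; rewrite /bicoef nth_default ?mul0r// (leq_trans (size_geg m)). Qed.

Lemma sum_triangle (A : nmodType) (F : nat -> nat -> A) N :
  \sum_(j < N) \sum_(p < j.+1) F p (j - p)%N = \sum_(p < N) \sum_(q < N - p) F p q.
Proof.
elim: N => [|N IH]; first by rewrite !big_ord0.
rewrite big_ord_recr IH [RHS]big_ord_recr /= subSnn big_ord1.
rewrite [in X in _ + X = _]big_ord_recr /= subnn addrA; congr (_ + _).
rewrite -big_split; apply: eq_bigr => p _ /=.
by rewrite subSn ?big_ord_recr//= ltnW.
Qed.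

Lemma geg_bivariate m (a b : R[i]) : (G m).[(a + b) / 2] =
  \sum_(p < m.+1) \sum_(q < m.+1) (bicoef m p q)%:C * a ^+ p * b ^+ q.
Proof.
have -> : (G m).[(a + b) / 2] = \sum_(j < m.+1) (G m)`_j * ((a + b) / 2) ^+ j.
  apply: horner_coef_wide; rewrite size_map_poly; exact: size_geg.
pose F p q : R[i] := (bicoef m p q)%:C * a ^+ p * b ^+ q.
transitivity (\sum_(j < m.+1) \sum_(p < j.+1) F p (j - p)%N).
  apply: eq_bigr => j _; rewrite coef_map expr_div_n addrC exprDn mulr_suml mulr_sumr;
    apply: eq_bigr => p _.
  have pj : (p <= j)%N by rewrite -ltnS.
  rewrite /F /bicoef subnKC// !rmorphM /= fmorphV rmorphXn /= !rmorph_nat.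
  by rewrite -mulr_natr; ring.
rewrite sum_triangle; apply: eq_bigr => p _.
(* The triangle p + q <= m may be enlarged to a square, as the coefficients outside it vanish. *)
rewrite (big_ord_widen m.+1 (fun q => F p q)) ?leq_subr// big_mkcond /=.
apply: eq_bigr => q _; rewrite ltn_subRL; case: ltnP => // h.
by rewrite bicoef0 ?rmorph0 ?mul0r.
Qed.

(* The part of C_m^n((a + b) / 2) made of the monomials a^p b^q with
   p - q = k - m; all of them have 0 <= k <= 2m. *)
Definition bigeg m k (a b : R[i]) : R[i] :=
  \sum_(p < m.+1) \sum_(q < m.+1)
     (p + m == q + k)%N%:R * ((bicoef m p q)%:C * a ^+ p * b ^+ q).

(** For p - q = k - m the monomial picks up u^(p-q) = u^(k-m); the factor u^m keeps all exponents
    natural. *)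
Lemma bigeg_sum m (u v a b : R[i]) : u * v = 1 ->
  u ^+ m * (G m).[(u * a + v * b) / 2] = \sum_(k < (2 * m).+1) u ^+ k * bigeg m k a b.
Proof.
move=> uv; rewrite geg_bivariate mulr_sumr.
under [RHS]eq_bigr do rewrite mulr_sumr.
rewrite exchange_big /=; apply: eq_bigr => p _.
rewrite mulr_sumr; under [RHS]eq_bigr do rewrite mulr_sumr.
rewrite exchange_big /=; apply: eq_bigr => q _.
have k0 : (p + m - q < (2 * m).+1)%N by have := ltn_ord p; lia.
have qm : (q <= p + m)%N by have := ltn_ord q; lia.
rewrite (bigD1 (Ordinal k0)) //= big1 ?addr0; last first.
  move=> k kn; rewrite (_ : (_ == _) = false) ?mul0r ?mulr0//.
  apply/negbTE; apply: contra kn => /eqP h; apply/eqP/val_inj => /=; lia.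
rewrite subnKC// eqxx mul1r !exprMn.
have -> : u ^+ m * ((bicoef m p q)%:C * (u ^+ p * a ^+ p) * (v ^+ q * b ^+ q)) =
  (u ^+ (p + m) * v ^+ q) * ((bicoef m p q)%:C * a ^+ p * b ^+ q).
  by rewrite exprD; ring.
by rewrite -{1}(subnK qm) exprD -(mulrA (_ ^+ _)) -(exprMn _ u v) uv expr1n mulr1.
Qed.

Definition rootu m (j : nat) : R[i] := cis (j%:R * (2 * pi / (2 * m).+1%:R)).

Lemma rootu_conj m j : rootu m j * conjc (rootu m j) = 1.
Proof. by rewrite /rootu conj_cis -cisD subrr cis0. Qed.

(* The coefficients of a trigonometric polynomial of degree m are recovered by a
   discrete Fourier transform over the roots of unity of order 2m + 1. *)
Lemma bigeg_fourier m k a b : (k < (2 * m).+1)%N ->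
  bigeg m k a b = ((2 * m).+1%:R)^-1 * \sum_(j < (2 * m).+1)
    conjc (rootu m j) ^+ k * (rootu m j) ^+ m *
    (G m).[(rootu m j * a + conjc (rootu m j) * b) / 2].
Proof.
move=> kM; set M := (2 * m).+1 in kM *.
have M0 : M%:R != 0 :> R[i] by rewrite pnatr_eq0.
apply: (mulfI M0); rewrite mulrA divff// mul1r.
under eq_bigr do rewrite -mulrA (bigeg_sum _ _ _ (rootu_conj m _)) mulr_sumr.
rewrite exchange_big /=.
under eq_bigr => l _.
  under eq_bigr do rewrite mulrA (mulrC (_ ^+ k)).
  rewrite -mulr_suml sum_cis//.
  over.
rewrite (bigD1 (Ordinal kM))//= eqxx mul1r big1 ?addr0// => l lk.
rewrite (_ : (_ == _) = false) ?mul0r//; apply/negbTE.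
by apply: contra lk => /eqP h; apply/eqP/val_inj.
Qed.

End Bidegrees.

(** * The Hermitian product and the components of given weight *)

Section HermitianProduct.
Variables (R : realType) (n : nat).
Notation V := (Cvec R n).
Notation S := (sphereT R n).

Definition herm (v w : V) : R[i] := \sum_(j < n.+1) zcoord v j * conjc (zcoord w j).

Lemma Re_hp v w : complex.Re (herm v w) = ip v w.
Proof.
by rewrite /herm Re_sum; apply: eq_bigr => j _; rewrite Re_mul /=; ring.
Qed.

Lemma hpC v w : herm w v = conjc (herm v w).
Proof.
rewrite /herm (raddf_sum (@conjc R)); apply: eq_bigr => j _.
by rewrite -[RHS]/(conjc _) conjcM conjcK mulrC.
Qed.

Lemma hp_self (x : S) : herm (val x) (val x) = 1.
Proof.
apply: eq_ReIm; first by rewrite Re_hp ip_val.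
by rewrite /herm Im_sum big1// => j _; rewrite Im_mul /=; ring.
Qed.

(** The point e^(it) N. Moving the pole along this circle separates the weights. *)
Definition phase_north (t : R) : S := radial_proj
  (cos t *: xdir R ord_max + sin t *: ydir R ord_max).

Lemma val_phase_north t : val (phase_north t) =
  cos t *: xdir R ord_max + sin t *: ydir R ord_max.
Proof.
rewrite /phase_north val_radial_proj1// -ip_sqnorm ipDl !ipDr !ipZl !ipZr.
have -> : ip (xdir R (@ord_max n)) (xdir R ord_max) = 1 by rewrite ip_xdir !mxE !eqxx.
have -> : ip (ydir R (@ord_max n)) (ydir R ord_max) = 1 by rewrite ip_ydir !mxE !eqxx.
have -> : ip (xdir R (@ord_max n)) (ydir R ord_max) = 0 by rewrite ip_ydir !mxE.
have -> : ip (ydir R (@ord_max n)) (xdir R ord_max) = 0 by rewrite ip_xdir !mxE.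
by rewrite -[RHS](cos2Dsin2 t); ring.
Qed.

Lemma hp_north (v : V) : herm (north_vec R n) v = conjc (zcoord v ord_max).
Proof.
rewrite /herm (bigD1 ord_max)//= big1 ?addr0 => [|j jN].
  by rewrite /zcoord/= !mxE !eqxx mul1r.
by rewrite /zcoord/= !mxE (negbTE jN) /= mul0r.
Qed.

Lemma ip_phase_north t (v : V) :
  ip (val (phase_north t)) v = complex.Re (cis t * herm (north_vec R n) v).
Proof.
rewrite val_phase_north ipDl !ipZl !(ipC _ v) ip_xdir ip_ydir hp_north Re_mul /=.
ring.
Qed.

Lemma phase_avg t (v : V) : (cis t * herm (north_vec R n) v +
  conjc (cis t) * herm v (north_vec R n)) / 2 = (ip (val (phase_north t)) v)%:C.
Proof.
by rewrite (hpC (north_vec R n) v) -conjcM addcJ ip_phase_north mulrAC divff ?mul1r// pnatr_eq0.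
Qed.

Lemma hp_avg (v w : V) : (herm v w + herm w v) / 2 = (ip v w)%:C.
Proof. by rewrite (hpC v w) addcJ Re_hp mulrAC divff ?mul1r// pnatr_eq0. Qed.

(** Of weight k - m under rotation of the first argument, hence m - k under rotation of the
    second. *)
Definition bidegree m k (v w : V) : R[i] := bigeg n m k (herm v w) (herm w v).

Lemma geg_bidegree m (v w : V) : ((geg R n m).[ip v w])%:C =
  \sum_(k < (2 * m).+1) bidegree m k v w.
Proof.
have := bigeg_sum n m (herm v w) (herm w v) (mulr1 (1 : R[i])).
rewrite !mul1r hp_avg expr1n mul1r horner_map => ->.
by apply: eq_bigr => k _; rewrite expr1n mul1r.
Qed.

Definition cbcont (f : S -> R[i]) :=
  bcont (fun x => complex.Re (f x)) /\ bcont (fun x => complex.Im (f x)).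

Lemma cbcont_ccontinuous f : cbcont f -> ccontinuous f.
Proof. by move=> [[? _] [? _]]. Qed.

Lemma cbcont_cst a : cbcont (fun=> a).
Proof. by split; exact: bcont_cst. Qed.

Lemma cbcontD f g : cbcont f -> cbcont g -> cbcont (fun x => f x + g x).
Proof.
move=> [f1 f2] [g1 g2]; split.
  by under eq_fun do rewrite Re_add; exact: bcontD.
by under eq_fun do rewrite Im_add; exact: bcontD.
Qed.

Lemma cbcontM f g : cbcont f -> cbcont g -> cbcont (fun x => f x * g x).
Proof.
move=> [f1 f2] [g1 g2]; split.
  by under eq_fun do rewrite Re_mul; apply: bcontB; exact: bcontM.
by under eq_fun do rewrite Im_mul; apply: bcontD; exact: bcontM.
Qed.

Lemma cbcontX f k : cbcont f -> cbcont (fun x => f x ^+ k).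
Proof.
move=> nf; elim: k => [|k IH]; first by under eq_fun do rewrite expr0; exact: cbcont_cst.
by under eq_fun do rewrite exprS; exact: cbcontM.
Qed.

Lemma cbcont_sum (I : Type) (r : seq I) (P : pred I) (f : I -> S -> R[i]) :
  (forall i, cbcont (f i)) -> cbcont (fun x => \sum_(i <- r | P i) f i x).
Proof.
move=> nf; split.
  by under eq_fun do rewrite Re_sum; apply: bcont_sum => i; have [] := nf i.
by under eq_fun do rewrite Im_sum; apply: bcont_sum => i; have [] := nf i.
Qed.

Lemma cbcont_real (f : S -> R) : bcont f -> cbcont (fun x => (f x)%:C).
Proof. by move=> nf; split => //=; exact: bcont_cst. Qed.

Lemma cbcont_hp w : cbcont (fun x => herm (val x) w).
Proof.
apply: cbcont_sum => j; apply: cbcontM; last exact: cbcont_cst.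
split; rewrite /zcoord /=.
  by apply: (@bcont_comp _ _ (fun v : V => v.1 ord0 j)) => v _; exact: continuous_fst_coord.
by apply: (@bcont_comp _ _ (fun v : V => v.2 ord0 j)) => v _; exact: continuous_snd_coord.
Qed.

Lemma cbcont_conj f : cbcont f -> cbcont (fun x => conjc (f x)).
Proof.
move=> [f1 f2]; split.
  by under eq_fun do rewrite Re_conjc.
by under eq_fun do rewrite Im_conjc; exact: bcontN.
Qed.

Lemma cbcont_hpr w : cbcont (fun x => herm w (val x)).
Proof. by under eq_fun do rewrite hpC; apply: cbcont_conj; exact: cbcont_hp. Qed.

Lemma cbcont_bigeg m k (a b : S -> R[i]) : cbcont a -> cbcont b ->
  cbcont (fun x => bigeg n m k (a x) (b x)).
Proof.
move=> na nb; apply: cbcont_sum => p; apply: cbcont_sum => q.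
apply: cbcontM; first exact: cbcont_cst.
apply: cbcontM; last exact: cbcontX.
by apply: cbcontM; [exact: cbcont_cst|exact: cbcontX].
Qed.

Lemma cbcont_bidegree m k w : cbcont (fun x => bidegree m k (val x) w).
Proof. by apply: cbcont_bigeg; [exact: cbcont_hp|exact: cbcont_hpr]. Qed.

Lemma cbcont_bidegreer m k w : cbcont (fun x => bidegree m k w (val x)).
Proof. by apply: cbcont_bigeg; [exact: cbcont_hpr|exact: cbcont_hp]. Qed.

Variable mu : {measure set (sphere_borel R n) -> \bar R}.
Hypothesis hmu : is_uniform mu.

Definition cint (f : S -> R[i]) : R[i] := cintegral mu setT f.

Lemma cintE f : cint f = sint mu (fun x => complex.Re (f x)) +i* sint mu (fun x => complex.Im
  (f x)).
Proof. by []. Qed.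

Lemma cintD f g : cbcont f -> cbcont g -> cint (fun x => f x + g x) = cint f + cint g.
Proof.
move=> [f1 f2] [g1 g2]; rewrite !cintE.
under eq_fun do rewrite Re_add; under [X in _ +i* sint _ X]eq_fun do rewrite Im_add.
by rewrite !sintD.
Qed.

Lemma cintZ a f : cbcont f -> cint (fun x => a * f x) = a * cint f.
Proof.
move=> [f1 f2]; rewrite !cintE.
under eq_fun do rewrite Re_mul; under [X in _ +i* sint _ X]eq_fun do rewrite Im_mul.
rewrite sintB ?sintD ?sintZ//; try exact: bcontZ.
by apply: eq_ReIm; rewrite ?Re_mul ?Im_mul.
Qed.

Lemma cintB f g : cbcont f -> cbcont g -> cint (fun x => f x - g x) = cint f - cint g.
Proof.
move=> nf ng; under eq_fun do rewrite -mulN1r.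
rewrite cintD ?cintZ ?mulN1r//; apply: cbcontM => //; exact: cbcont_cst.
Qed.

Lemma cint_sum (I : Type) (r : seq I) (P : pred I) (f : I -> S -> R[i]) :
  (forall i, cbcont (f i)) ->
  cint (fun x => \sum_(i <- r | P i) f i x) = \sum_(i <- r | P i) cint (f i).
Proof.
move=> nf; apply: eq_ReIm; rewrite ?Re_sum ?Im_sum /=.
  by under eq_fun do rewrite Re_sum; rewrite -/(sint mu _) sint_sum// => i; have [] := nf i.
by under eq_fun do rewrite Im_sum; rewrite -/(sint mu _) sint_sum// => i; have [] := nf i.
Qed.

Lemma cint_real (f : S -> R) : cint (fun x => (f x)%:C) = (sint mu f)%:C.
Proof. by rewrite cintE /= sint_cst mul0r. Qed.

Hypothesis hn : (1 <= n)%N.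

(** Each component is an average of zonal functions with poles e^(it) N; bounds and the reproducing
    property pass to it by linearity. *)
Lemma bidegree_fourier m k (x : V) : (k < (2 * m).+1)%N ->
  bidegree m k (north_vec R n) x = ((2 * m).+1%:R)^-1 * \sum_(j < (2 * m).+1)
    conjc (rootu R m j) ^+ k * (rootu R m j) ^+ m *
    ((geg R n m).[ip (val (phase_north (j%:R * (2 * pi / (2 * m).+1%:R)))) x])%:C.
Proof.
move=> km; rewrite /bidegree bigeg_fourier//; congr (_ * _); apply: eq_bigr => j _.
by rewrite phase_avg horner_map.
Qed.

Lemma bidegree_bound m k (x : S) : (k < (2 * m).+1)%N ->
  `|bidegree m k (north_vec R n) (val x)| <= ((geg R n m).[1])%:C.
Proof.
move=> km; rewrite bidegree_fourier// normrM ger0_norm ?invr_ge0//.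
have M0 : 0 < (2 * m).+1%:R :> R[i] by rewrite ltr0n.
rewrite mulrC ler_pdivrMr//.
apply: le_trans (ler_norm_sum _ _ _) _.
apply: le_trans (_ : \sum_(j < (2 * m).+1) ((geg R n m).[1])%:C <= _); last first.
  by rewrite sumr_const card_ord mulr_natr.
apply: ler_sum => j _; rewrite !normrM !normrX normcJ normc_cis !expr1n !mul1r.
by rewrite normc_def /= expr0n addr0 sqrtr_sqr lecR (geg_bound hn hmu).
Qed.

Lemma bidegree_reproducing m k l (y : S) : (k < (2 * m).+1)%N ->
  cint (fun x => bidegree m k (north_vec R n) (val x) *
     ((geg R n l).[ip (val x) (val y)])%:C) =
  (m == l)%:R * ((geg_weight mu m)%:C * bidegree m k (north_vec R n) (val y)).
Proof.
move=> km; rewrite bidegree_fourier//.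
pose a j : S := phase_north (j%:R * (2 * pi / (2 * m).+1%:R)).
pose c j : R[i] := ((2 * m).+1%:R)^-1 * (conjc (rootu R m j) ^+ k * (rootu R m j) ^+ m).
rewrite (_ : (fun x : S => _) = (fun x => \sum_(j < (2 * m).+1) c j *
   ((geg R n m).[ip (val x) (val (a j))] * (geg R n l).[ip (val x) (val y)])%:C)); last first.
  apply/funext => x; rewrite bidegree_fourier// mulr_sumr mulr_suml.
  by apply: eq_bigr => j _; rewrite -/(a j) (ipC (val (a j))) /c rmorphM /=; ring.
have nj j : bcont (fun x : S => (geg R n m).[ip (val x) (val (a j))] * (geg R n l).[ip (val
  x) (val y)]).
  exact: bcont_zonal2.
rewrite cint_sum; last first.
  by move=> j; apply: cbcontM; [exact: cbcont_cst|apply: cbcont_real].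
rewrite !mulr_sumr; apply: eq_bigr => j _.
rewrite cintZ; last exact: cbcont_real.
rewrite cint_real geg_reproducing// !rmorphM /= rmorph_nat /c -/(a j); ring.
Qed.

End HermitianProduct.

(** * Derivatives of functions on the punctured space *)

Section SmoothExpressions.
Variables (R : realType) (n : nat).
Notation V := (Cvec R n).

Lemma is_derive_limit (f : V -> R) (x u : V) (l : R) :
  (h^-1 * (f (h *: u + x) - f x)) @[h --> (0 : R)^'] --> l -> is_derive x u f l.
Proof.
move=> h; split; first by apply/cvg_ex; exists l; exact: h.
by apply: cvg_lim => //; exact: h.
Qed.

Lemma is_derive_line (f : V -> R) (x u : V) (l : R) :
  is_derive (0 : R) (1 : R) (fun h => f (h *: u + x)) l -> is_derive x u f l.
Proof.
move=> [d v]; apply: is_derive_limit.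
have : (h^-1 *: (((fun h => f (h *: u + x)) \o shift 0) (h *: (1 : R)) - f (0 *: u + x)))
  @[h --> (0 : R)^'] --> l.
  by rewrite -v; exact: d.
rewrite scale0r add0r; apply: cvg_trans.
apply: near_eq_cvg; near=> h.
by rewrite /= addr0 /GRing.scale/= mulr1.
Unshelve. all: end_near. Qed.

Lemma is_derive_ip (x u w : V) : is_derive x u (fun v => ip v w) (ip u w).
Proof.
apply: is_derive_limit; apply: cvg_near_cst; near=> h.
have h0 : h != 0 by near: h; exact: nbhs_dnbhs_neq.
by rewrite ipDl ipZl addrK mulKf.
Unshelve. all: end_near. Qed.

(** Along a line the squared norm is a quadratic polynomial, which reduces the claim to one
    variable. *)
Lemma is_derive_invnorm (x u : V) : x != 0 ->
  is_derive x u (fun v => (Num.sqrt (sqnorm v))^-1)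
    (- ((Num.sqrt (sqnorm x))^-1 ^+ 3 * ip x u)).
Proof.
move=> x0; have s0 : 0 < sqnorm x by rewrite sqnorm_gt0.
apply: is_derive_line.
have d1 : is_derive (0 : R) (1 : R) (fun h => sqnorm (h *: u + x)) (2 * ip x u).
  pose p : {poly R} := (sqnorm u) *: 'X^2 + (2 * ip x u) *: 'X + (sqnorm x)%:P.
  have -> : (fun h => sqnorm (h *: u + x)) = horner p.
    apply/funext => h; rewrite /p !hornerD !hornerZ hornerXn hornerX hornerC.
    rewrite -!ip_sqnorm ipDl !ipDr !ipZl !ipZr (ipC u x); ring.
  have := is_derive_poly p 0.
  rewrite /p !derivD !derivZ derivXn derivX derivC /= expr1.
  by rewrite !hornerD !hornerZ hornerMn hornerX hornerC mul0rn mulr0 horner0 addr0 add0r mulr1.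
have e0 : sqnorm (0 *: u + x) = sqnorm x by rewrite scale0r add0r.
have s0' : 0 < sqnorm (0 *: u + x) by rewrite e0.
have d2 := @is_derive1_comp _ Num.sqrt (fun h : R => sqnorm (h *: u + x)) _ _ _
  (is_derive1_sqrt s0') d1.
have := @is_deriveV _ (Num.sqrt \o (fun h : R => sqnorm (h *: u + x))) 0 _ 1 _ d2.
rewrite /= e0 => /(_ _) h.
have q0 : Num.sqrt (sqnorm x) != 0 by rewrite gt_eqF// sqrtr_gt0.
apply: is_derive_eq (h q0) _.
by rewrite /GRing.scale /=; field.
Qed.

(* Functions on V minus the origin that are visibly closed under derivation. *)
Inductive sexpr :=
| SCst of R
| SLin of V
| SInv
| SAdd of sexpr & sexpr
| SMul of sexpr & sexpr.

Fixpoint seval (e : sexpr) (v : V) : R :=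
  match e with
  | SCst a => a
  | SLin w => ip v w
  | SInv => (Num.sqrt (sqnorm v))^-1
  | SAdd a b => seval a v + seval b v
  | SMul a b => seval a v * seval b v
  end.

Fixpoint sderiv (u : V) (e : sexpr) : sexpr :=
  match e with
  | SCst a => SCst 0
  | SLin w => SCst (ip u w)
  | SInv => SMul (SCst (-1)) (SMul (SMul SInv (SMul SInv SInv)) (SLin u))
  | SAdd a b => SAdd (sderiv u a) (sderiv u b)
  | SMul a b => SAdd (SMul a (sderiv u b)) (SMul b (sderiv u a))
  end.

Lemma is_derive_seval (e : sexpr) (x u : V) : x != 0 ->
  is_derive x u (seval e) (seval (sderiv u e) x).
Proof.
move=> x0; elim: e => [a|w||a IHa b IHb|a IHa b IHb] /=.
- exact: is_derive_cst.
- exact: is_derive_ip.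
- apply: is_derive_eq (is_derive_invnorm u x0) _; ring.
- exact: is_deriveD.
- exact: is_deriveM.
Qed.

Lemma continuous_seval (e : sexpr) (x : V) : x != 0 -> {for x, continuous (seval e)}.
Proof.
move=> x0; elim: e => [a|w||a IHa b IHb|a IHa b IHb] /=.
- exact: cvg_cst.
- exact: continuous_ip.
- apply: cvgV; first by rewrite gt_eqF// sqrtr_gt0 sqnorm_gt0.
  apply: continuous_comp; first exact: continuous_sqnorm.
  exact: sqrt_continuous.
- exact: cvgD.
- exact: cvgM.
Qed.

Lemma near_neq0 (x : V) : x != 0 -> \forall y \near x, y != 0.
Proof.
move=> x0; apply: (@open_nbhs_nbhs _ x [set y | y != 0]); split => //.
have -> : [set y : V | y != 0] = ~` [set 0].
  by apply/seteqP; split => y /= /eqP.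
by apply: closed_openC; apply: accessible_closed_set1; apply: hausdorff_accessible;
  exact: norm_hausdorff.
Qed.

(** Iterated derivatives stay within the expressions, and equality off the origin is equality near
    each nonzero point, so it survives differentiation. *)
Lemma smooth_off0_seval (g : V -> R) (e : sexpr) :
  (forall v, v != 0 -> g v = seval e v) -> smooth_off0 g.
Proof.
move=> ge s.
have {ge} he : forall v, v != 0 -> iter_derive s g v = seval (foldr sderiv e s) v.
  elim: s => [|u s IH] v v0; first exact: ge.
  rewrite /= (@near_eq_derive _ _ _ _ (seval (foldr sderiv e s))).
    by have [_ ->] := is_derive_seval (foldr sderiv e s) u v0.
  by have := near_neq0 v0; apply: filterS => y; exact: IH.
move=> x x0.
have hn : \forall y \near x, seval (foldr sderiv e s) y = iter_derive s g y.
  by have := near_neq0 x0; apply: filterS => y y0; rewrite he.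
split.
  move=> v; apply: near_eq_derivable hn _.
  by have [] := is_derive_seval (foldr sderiv e s) v x0.
have c : seval (foldr sderiv e s) y @[y --> x] --> iter_derive s g x.
  by rewrite he//; exact: continuous_seval.
exact: cvg_trans (near_eq_cvg hn) c.
Qed.

End SmoothExpressions.

(** * Derivations of complex-valued functions *)

Section ComplexDerivations.
Variables (R : realType) (n : nat).
Notation V := (Cvec R n).
Notation S := (sphereT R n).

(** Values at the origin are left free: there [radial_proj], and so every extension from the sphere,
    takes a default value. *)
Definition elem (F : V -> R[i]) := exists e1 e2 : sexpr R n, forall v, v != 0 ->
  complex.Re (F v) = seval e1 v /\ complex.Im (F v) = seval e2 v.

Lemma elem_ext F G : (forall v, v != 0 -> F v = G v) -> elem G -> elem F.
Proof. by move=> FG [e1 [e2 h]]; exists e1, e2 => v v0; rewrite FG//; exact: h. Qed.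

Lemma elem_cst a : elem (fun=> a).
Proof. by exists (SCst n (complex.Re a)), (SCst n (complex.Im a)). Qed.

Lemma elemD F G : elem F -> elem G -> elem (fun v => F v + G v).
Proof.
move=> [a1 [a2 ha]] [b1 [b2 hb]]; exists (SAdd a1 b1), (SAdd a2 b2) => v v0.
by rewrite Re_add Im_add /=; have [-> ->] := ha v v0; have [-> ->] := hb v v0.
Qed.

Lemma elemM F G : elem F -> elem G -> elem (fun v => F v * G v).
Proof.
move=> [a1 [a2 ha]] [b1 [b2 hb]].
exists (SAdd (SMul a1 b1) (SMul (SCst n (-1)) (SMul a2 b2))),
  (SAdd (SMul a1 b2) (SMul a2 b1)) => v v0.
rewrite Re_mul Im_mul /=; have [-> ->] := ha v v0; have [-> ->] := hb v v0.
by split=> //; ring.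
Qed.

Lemma elemX F k : elem F -> elem (fun v => F v ^+ k).
Proof.
move=> sF; elim: k => [|k IH]; first by under eq_fun do rewrite expr0; exact: elem_cst.
by under eq_fun do rewrite exprS; exact: elemM.
Qed.

Lemma elem_sum (I : Type) (r : seq I) (P : pred I) (f : I -> V -> R[i]) :
  (forall i, elem (f i)) -> elem (fun x => \sum_(i <- r | P i) f i x).
Proof.
move=> nf; elim: r => [|i r IH].
  by under eq_fun do rewrite big_nil; exact: elem_cst.
under eq_fun do rewrite big_cons; case: (P i) => //.
exact: elemD.
Qed.

(** Multiplication by i on C^(n+1). *)
Definition rot90 (w : V) : V := (- w.2, w.1).

Lemma Im_hp (v w : V) : complex.Im (herm v w) = ip v (rot90 w).
Proof.
by rewrite /herm Im_sum; apply: eq_bigr => j _; rewrite Im_mul /= !mxE; ring.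
Qed.

Lemma elem_hp y : elem (fun v => herm v y).
Proof.
exists (SLin y), (SLin (rot90 y)) => v _ /=.
by rewrite Re_hp Im_hp.
Qed.

Lemma elem_hpr y : elem (fun v => herm y v).
Proof.
exists (SLin y), (SMul (SCst n (-1)) (SLin (rot90 y))) => v _ /=.
by rewrite hpC Re_conjc Im_conjc Re_hp Im_hp mulN1r.
Qed.

Definition invnorm (v : V) : R[i] := ((Num.sqrt (sqnorm v))^-1)%:C.

Lemma elem_invnorm : elem invnorm.
Proof. by exists (SInv R n), (SCst n 0) => v _. Qed.

Lemma elem_zcoord j : elem (fun v => zcoord v j).
Proof.
exists (SLin (xdir R j)), (SLin (ydir R j)) => v _ /=.
by rewrite ip_xdir ip_ydir.
Qed.

Lemma elem_zcoordJ j : elem (fun v => conjc (zcoord v j)).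
Proof.
exists (SLin (xdir R j)), (SMul (SCst n (-1)) (SLin (ydir R j))) => v _ /=.
by rewrite ip_xdir ip_ydir mulN1r.
Qed.

(** Closed under complex linear combinations, so d/dz_j, S, T_j and their conjugates inherit the
    product and power rules from real directional derivatives. *)
Definition derivation_at (x : V) (D : (V -> R[i]) -> R[i]) := [/\
  forall F G, elem F -> elem G -> D (fun v => F v + G v) = D F + D G,
  forall F G, elem F -> elem G -> D (fun v => F v * G v) = D F * G x + F x * D G,
  forall a, D (fun=> a) = 0
  & forall F G, (forall v, v != 0 -> F v = G v) -> D F = D G].

Lemma derivation_scale x D a : derivation_at x D -> derivation_at x (fun F => a * D F).
Proof.
move=> [h1 h2 h3 h4]; split.
- by move=> F G sF sG; rewrite h1// mulrDr.
- by move=> F G sF sG; rewrite h2//; ring.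
- by move=> b; rewrite h3 mulr0.
- by move=> F G FG; rewrite (h4 _ _ FG).
Qed.

Lemma derivation_add x D E : derivation_at x D -> derivation_at x E ->
  derivation_at x (fun F => D F + E F).
Proof.
move=> [h1 h2 h3 h4] [k1 k2 k3 k4]; split.
- by move=> F G sF sG; rewrite h1// k1// addrACA.
- by move=> F G sF sG; rewrite h2// k2//; ring.
- by move=> b; rewrite h3 k3 addr0.
- by move=> F G FG; rewrite (h4 _ _ FG) (k4 _ _ FG).
Qed.

Lemma derivation_sum x (I : Type) (r : seq I) (D : I -> (V -> R[i]) -> R[i]) :
  (forall i, derivation_at x (D i)) -> derivation_at x (fun F => \sum_(i <- r) D i F).
Proof.
move=> h; elim: r => [|i r IH].
  by split => *; rewrite !big_nil ?addr0 ?mul0r ?mulr0 ?addr0.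
have := derivation_add (h i) IH; congr derivation_at; apply/funext => F.
by rewrite big_cons.
Qed.

Lemma derivation_sub x D E : derivation_at x D -> derivation_at x E ->
  derivation_at x (fun F => D F - E F).
Proof.
move=> hD hE; have := derivation_add hD (derivation_scale (-1) hE).
by congr derivation_at; apply/funext => F; rewrite mulN1r.
Qed.

Lemma derivationX x D F k : derivation_at x D -> elem F ->
  D (fun v => F v ^+ k) = k%:R * F x ^+ k.-1 * D F.
Proof.
move=> hD sF; have [h1 h2 h3 h4] := hD; elim: k => [|k IH].
  by rewrite (h4 _ (fun=> 1)) ?h3 ?mul0r// => v _; rewrite expr0.
rewrite (h4 _ (fun v => F v * F v ^+ k)); last by move=> v _; rewrite exprS.
rewrite h2//; last exact: elemX.
rewrite IH -(natr1 k) /=; case: k {IH} => [|k]; first by rewrite expr0; ring.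
by rewrite /= exprS; ring.
Qed.

Lemma derivationZ x D F a : derivation_at x D -> elem F ->
  D (fun v => a * F v) = a * D F.
Proof.
by move=> [h1 h2 h3 h4] sF; rewrite h2 ?h3 ?mul0r ?add0r//; exact: elem_cst.
Qed.

Lemma derivation_bigsum x D (I : Type) (r : seq I) (f : I -> V -> R[i]) :
  derivation_at x D -> (forall i, elem (f i)) ->
  D (fun v => \sum_(i <- r) f i v) = \sum_(i <- r) D (f i).
Proof.
move=> hD sf; have [h1 h2 h3 h4] := hD; elim: r => [|i r IH].
  by rewrite big_nil (h4 _ (fun=> 0)) ?h3// => v _; rewrite big_nil.
rewrite big_cons -IH -h1//; last exact: elem_sum.
by apply: h4 => v _; rewrite big_cons.
Qed.

Lemma elem_is_derive F x v : elem F -> x != 0 -> exists l1 l2 : R,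
  is_derive x v (fun y => complex.Re (F y)) l1 /\
  is_derive x v (fun y => complex.Im (F y)) l2.
Proof.
move=> [e1 [e2 h]] x0; have hx := near_neq0 x0.
exists (seval (sderiv v e1) x), (seval (sderiv v e2) x); split.
  apply: near_eq_is_derive (is_derive_seval e1 v x0).
  by apply: filterS hx => y y0; have [] := h y y0.
apply: near_eq_is_derive (is_derive_seval e2 v x0).
by apply: filterS hx => y y0; have [] := h y y0.
Qed.

Lemma derivation_cderive x v : x != 0 -> derivation_at x (fun F => cderive v F x).
Proof.
move=> x0; split.
- move=> F G sF sG; have [a [b [da db]]] := elem_is_derive v sF x0.
  have [c [d [dc dd]]] := elem_is_derive v sG x0.
  rewrite /cderive.
  have [_ ->] := da; have [_ ->] := db; have [_ ->] := dc; have [_ ->] := dd.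
  apply: eq_ReIm => /=.
    have -> : (fun y => complex.Re (F y + G y)) =
      (fun y => complex.Re (F y)) + (fun y => complex.Re (G y)).
      by apply/funext => y; rewrite Re_add.
    by have [_ ->] := is_deriveD da dc.
  have -> : (fun y => complex.Im (F y + G y)) =
    (fun y => complex.Im (F y)) + (fun y => complex.Im (G y)).
    by apply/funext => y; rewrite Im_add.
  by have [_ ->] := is_deriveD db dd.
- move=> F G sF sG; have [a [b [da db]]] := elem_is_derive v sF x0.
  have [c [d [dc dd]]] := elem_is_derive v sG x0.
  rewrite /cderive.
  have [_ ->] := da; have [_ ->] := db; have [_ ->] := dc; have [_ ->] := dd.
  apply: eq_ReIm; rewrite ?Re_add ?Im_add ?Re_mul ?Im_mul /=.
    have -> : (fun y => complex.Re (F y * G y)) =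
       (fun y => complex.Re (F y)) * (fun y => complex.Re (G y)) -
       (fun y => complex.Im (F y)) * (fun y => complex.Im (G y)).
      by apply/funext => y; rewrite Re_mul.
    have [_ ->] := is_deriveB (is_deriveM da dc) (is_deriveM db dd).
    by rewrite /GRing.scale /=; ring.
  have -> : (fun y => complex.Im (F y * G y)) =
     (fun y => complex.Re (F y)) * (fun y => complex.Im (G y)) +
     (fun y => complex.Im (F y)) * (fun y => complex.Re (G y)).
    by apply/funext => y; rewrite Im_mul.
  have [_ ->] := is_deriveD (is_deriveM da dd) (is_deriveM db dc).
  by rewrite /GRing.scale /=; ring.
- move=> a; apply: eq_ReIm; rewrite /cderive /=.
    by have [_ ->] := is_derive_cst (complex.Re a) x v.
  by have [_ ->] := is_derive_cst (complex.Im a) x v.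
- move=> F G FG; rewrite /cderive; congr (_ +i* _); apply: near_eq_derive.
    by apply: filterS (near_neq0 x0) => y y0; rewrite FG.
  by apply: filterS (near_neq0 x0) => y y0; rewrite FG.
Qed.

Lemma derivation_dz x j : x != 0 -> derivation_at x (fun F => dz j F x).
Proof.
move=> x0; have hx := derivation_cderive (xdir R j) x0.
have hy := derivation_cderive (ydir R j) x0.
have := derivation_scale (2^-1) (derivation_sub hx (derivation_scale 'i%C hy)).
by congr derivation_at; apply/funext => F; rewrite /dz mulrC.
Qed.

Lemma derivation_dzbar x j : x != 0 -> derivation_at x (fun F => dzbar j F x).
Proof.
move=> x0; have hx := derivation_cderive (xdir R j) x0.
have hy := derivation_cderive (ydir R j) x0.
have := derivation_scale (2^-1) (derivation_add hx (derivation_scale 'i%C hy)).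
by congr derivation_at; apply/funext => F; rewrite /dzbar mulrC.
Qed.

Lemma derivation_Sop x : x != 0 -> derivation_at x (fun F => Sop F x).
Proof.
move=> x0; apply: derivation_sum => k; apply: derivation_scale.
exact: derivation_dz.
Qed.

Lemma derivation_Sbarop x : x != 0 -> derivation_at x (fun F => Sbarop F x).
Proof.
move=> x0; apply: derivation_sum => k; apply: derivation_scale.
exact: derivation_dzbar.
Qed.

Lemma derivation_Top x j : x != 0 -> derivation_at x (fun F => Top j F x).
Proof.
move=> x0; apply: derivation_sub; first exact: derivation_dz.
by apply: derivation_scale; exact: derivation_Sop.
Qed.

Lemma derivation_Tbarop x j : x != 0 -> derivation_at x (fun F => Tbarop j F x).
Proof.
move=> x0; apply: derivation_sub; first exact: derivation_dzbar.
by apply: derivation_scale; exact: derivation_Sbarop.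
Qed.

Lemma cderive_hp (x v y : V) : cderive v (fun u => herm u y) x = herm v y.
Proof.
apply: eq_ReIm; rewrite /cderive /=.
  under [X in 'D_v X x]eq_fun do rewrite Re_hp.
  by have [_ ->] := is_derive_ip x v y; rewrite Re_hp.
under [X in 'D_v X x]eq_fun do rewrite Im_hp.
by have [_ ->] := is_derive_ip x v (rot90 y); rewrite Im_hp.
Qed.

Lemma hp_xdir j (y : V) : herm (xdir R j) y = conjc (zcoord y j).
Proof.
rewrite /herm (bigD1 j)//= big1 ?addr0 => [|k kj].
  by rewrite /zcoord/= !mxE !eqxx mul1r.
by rewrite /zcoord/= !mxE (negbTE kj) /= mul0r.
Qed.

Lemma hp_ydir j (y : V) : herm (ydir R j) y = 'i%C * conjc (zcoord y j).
Proof.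
rewrite /herm (bigD1 j)//= big1 ?addr0 => [|k kj].
  by rewrite /zcoord/= !mxE !eqxx.
by rewrite /zcoord/= !mxE (negbTE kj) /= mul0r.
Qed.

Lemma dz_hp j (x y : V) : dz j (fun u => herm u y) x = conjc (zcoord y j).
Proof.
rewrite /dz !cderive_hp hp_xdir hp_ydir.
have i2 : 'i%C * 'i%C = -1 :> R[i] by rewrite -expr2 sqr_i.
by rewrite mulrA i2 mulN1r opprK; field.
Qed.

Lemma dzbar_hp j (x y : V) : dzbar j (fun u => herm u y) x = 0.
Proof.
rewrite /dzbar !cderive_hp hp_xdir hp_ydir.
have i2 : 'i%C * 'i%C = -1 :> R[i] by rewrite -expr2 sqr_i.
by rewrite mulrA i2 mulN1r subrr mul0r.
Qed.

End ComplexDerivations.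

(** * The sub-Laplacian *)

Section SubLaplacian.
Variables (R : realType) (n : nat).
Notation V := (Cvec R n).
Notation S := (sphereT R n).

Lemma cderive_hpr (x v y : V) : cderive v (fun u => herm y u) x = herm y v.
Proof.
have -> : (fun u => herm y u) = (fun u => conjc (herm u y)) by apply/funext => u; rewrite hpC.
rewrite hpC -(cderive_hp x); apply: eq_ReIm; rewrite /cderive /=.
  by under [X in 'D_v X x]eq_fun do rewrite Re_conjc.
under [X in 'D_v X x]eq_fun do rewrite Im_conjc Im_hp.
under [X in _ = - 'D_v X x]eq_fun do rewrite Im_hp.
have d := is_derive_ip x v (rot90 y).
have [_ ->] := is_deriveN d.
by have [_ ->] := d.
Qed.

Lemma dz_hpr j (x y : V) : dz j (fun u => herm y u) x = 0.
Proof.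
rewrite /dz !cderive_hpr !(hpC _ y) hp_xdir hp_ydir conjcM !conjcK.
have i2 : 'i%C * conjc 'i%C = 1 :> R[i] by apply: eq_ReIm; rewrite ?Re_mul ?Im_mul /=; ring.
by rewrite mulrA i2 mul1r subrr mul0r.
Qed.

Lemma dzbar_hpr j (x y : V) : dzbar j (fun u => herm y u) x = zcoord y j.
Proof.
rewrite /dzbar !cderive_hpr !(hpC _ y) hp_xdir hp_ydir conjcM !conjcK.
have i2 : 'i%C * conjc 'i%C = 1 :> R[i] by apply: eq_ReIm; rewrite ?Re_mul ?Im_mul /=; ring.
by rewrite mulrA i2 mul1r; field.
Qed.

Lemma cderive_invnorm (x v : V) : x != 0 ->
  cderive v (@invnorm R n) x = - (invnorm x ^+ 3 * (ip x v)%:C).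
Proof.
move=> x0; have [_ h] := is_derive_invnorm v x0.
have [_ h0] := is_derive_cst (0 : R) x v.
rewrite /cderive /invnorm /= h h0.
by rewrite -rmorphXn -rmorphM -rmorphN.
Qed.

Lemma zcoordE (v : V) j : zcoord v j = (ip v (xdir R j))%:C + 'i%C * (ip v (ydir R j))%:C.
Proof. by rewrite ip_xdir ip_ydir; apply: eq_ReIm;
  rewrite ?Re_add ?Im_add ?Re_mul ?Im_mul /=; ring. Qed.

Lemma zcoordJE (v : V) j : conjc (zcoord v j) =
  (ip v (xdir R j))%:C - 'i%C * (ip v (ydir R j))%:C.
Proof.
by rewrite ip_xdir ip_ydir; apply: eq_ReIm;
  rewrite ?Re_add ?Im_add ?Re_opp ?Im_opp ?Re_mul ?Im_mul /=; ring.
Qed.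

Lemma dzE j (F : V -> R[i]) x :
  dz j F x = (cderive (xdir R j) F x - 'i%C * cderive (ydir R j) F x) / 2.
Proof. by []. Qed.

Lemma dzbarE j (F : V -> R[i]) x :
  dzbar j F x = (cderive (xdir R j) F x + 'i%C * cderive (ydir R j) F x) / 2.
Proof. by []. Qed.

Lemma dz_invnorm j (x : V) : x != 0 ->
  dz j (@invnorm R n) x = - (2^-1 * invnorm x ^+ 3 * conjc (zcoord x j)).
Proof. by move=> x0; rewrite dzE !cderive_invnorm// zcoordJE; ring. Qed.

Lemma dzbar_invnorm j (x : V) : x != 0 ->
  dzbar j (@invnorm R n) x = - (2^-1 * invnorm x ^+ 3 * zcoord x j).
Proof. by move=> x0; rewrite dzbarE !cderive_invnorm// zcoordE; ring. Qed.

Lemma invnorm_hp (x : V) : x != 0 -> invnorm x ^+ 2 * herm x x = 1.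
Proof.
move=> x0; have -> : herm x x = (sqnorm x)%:C.
  apply: eq_ReIm; first by rewrite Re_hp ip_sqnorm.
  by rewrite /herm Im_sum big1// => j _; rewrite Im_mul /=; ring.
rewrite /invnorm -rmorphXn -rmorphM /= -(rmorph1 (real_complex R)); congr (_%:C).
by rewrite exprVn sqr_sqrtr ?sqnorm_ge0// mulVf// sqnorm_eq0.
Qed.

Lemma SopE (F : V -> R[i]) (x : V) : Sop F x = \sum_(k < n.+1) zcoord x k * dz k F x.
Proof. by []. Qed.

Lemma SbaropE (F : V -> R[i]) (x : V) : Sbarop F x =
  \sum_(k < n.+1) conjc (zcoord x k) * dzbar k F x.
Proof. by []. Qed.

Lemma TopE j (F : V -> R[i]) (x : V) : Top j F x = dz j F x - conjc (zcoord x j) * Sop F x.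
Proof. by []. Qed.

Lemma hpE (v w : V) : herm v w = \sum_(j < n.+1) zcoord v j * conjc (zcoord w j).
Proof. by []. Qed.

Lemma Top_hp j (x y : V) : Top j (fun u => herm u y) x =
  conjc (zcoord y j) - conjc (zcoord x j) * herm x y.
Proof.
by rewrite TopE dz_hp SopE; under eq_bigr do rewrite dz_hp.
Qed.

Lemma Top_hpr j (x y : V) : Top j (fun u => herm y u) x = 0.
Proof.
rewrite TopE dz_hpr SopE big1 ?mulr0 ?subr0// => k _.
by rewrite dz_hpr mulr0.
Qed.

(** The value off the sphere matters, although it is 0 on the sphere: a second operator still has to
    differentiate it. *)
Lemma Top_invnorm j (x : V) : x != 0 -> Top j (@invnorm R n) x =
  2^-1 * conjc (zcoord x j) * invnorm x * (1 - invnorm x ^+ 2).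
Proof.
move=> x0; rewrite TopE dz_invnorm// SopE.
have -> : \sum_(k < n.+1) zcoord x k * dz k (@invnorm R n) x = - (2^-1 * invnorm x).
  transitivity (- (2^-1 * invnorm x * (invnorm x ^+ 2 * herm x x))); last first.
    by rewrite invnorm_hp// mulr1.
  rewrite hpE !mulr_sumr -sumrN; apply: eq_bigr => k _.
  by rewrite dz_invnorm//; ring.
ring.
Qed.

Lemma Tbarop_hp j (x y : V) : Tbarop j (fun u => herm u y) x = 0.
Proof.
rewrite /Tbarop dzbar_hp SbaropE big1 ?mulr0 ?subr0// => k _.
by rewrite dzbar_hp mulr0.
Qed.

Lemma Tbarop_hpr j (x y : V) : Tbarop j (fun u => herm y u) x =
  zcoord y j - zcoord x j * herm y x.
Proof.
rewrite /Tbarop dzbar_hpr SbaropE; under eq_bigr do rewrite dzbar_hpr mulrC.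
by [].
Qed.

Lemma Tbarop_invnorm j (x : V) : x != 0 -> Tbarop j (@invnorm R n) x =
  2^-1 * zcoord x j * invnorm x * (1 - invnorm x ^+ 2).
Proof.
move=> x0; rewrite /Tbarop dzbar_invnorm// SbaropE.
have -> : \sum_(k < n.+1) conjc (zcoord x k) * dzbar k (@invnorm R n) x = - (2^-1 * invnorm x).
  transitivity (- (2^-1 * invnorm x * (invnorm x ^+ 2 * herm x x))); last first.
    by rewrite invnorm_hp// mulr1.
  rewrite hpE !mulr_sumr -sumrN; apply: eq_bigr => k _.
  by rewrite dzbar_invnorm//; ring.
ring.
Qed.

Lemma zcoord_hp (v : V) j : zcoord v j = herm v (xdir R j).
Proof. by rewrite hpC hp_xdir conjcK. Qed.

Lemma zcoord_xdir j : zcoord (xdir R j : V) j = 1.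
Proof. by rewrite /zcoord /= !mxE !eqxx. Qed.

Lemma Top_zcoord j (x : V) :
  Top j (fun u => zcoord u j) x = 1 - conjc (zcoord x j) * zcoord x j.
Proof.
under [X in Top _ X]eq_fun do rewrite zcoord_hp.
by rewrite Top_hp zcoord_xdir conjc1 -zcoord_hp.
Qed.

Lemma Tbarop_zcoordJ j (x : V) :
  Tbarop j (fun u => conjc (zcoord u j)) x = 1 - zcoord x j * conjc (zcoord x j).
Proof.
have -> : (fun u : V => conjc (zcoord u j)) = (fun u => herm (xdir R j) u).
  by apply/funext => u; rewrite hp_xdir.
by rewrite Tbarop_hpr zcoord_xdir hp_xdir.
Qed.

(* For r = p + q this is the extension, homogeneous of degree 0, of the
   restriction of <v, y>^p <y, v>^q to the sphere. *)
Definition monomial (y : V) p q r (v : V) : R[i] := herm v y ^+ p * herm y v ^+ q * invnorm v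
  ^+ r.

Ltac elem := repeat first [exact: elem_hp | exact: elem_hpr | exact: elem_invnorm
  | exact: elem_zcoord | exact: elem_zcoordJ | exact: elem_cst
  | apply: elemM | apply: elemD | apply: elemX].

Lemma elem_monomial y p q r : elem (monomial y p q r).
Proof. by rewrite /monomial; elem. Qed.

(** Differences are written as sums of multiples by -1, so that [elemD] and [elemM] recognize the
    factors when the conjugate operator is applied. *)
Lemma Tbarop_monomial j y p q r (v : V) : v != 0 -> Tbarop j (monomial y p q r) v =
  q%:R * (herm v y ^+ p * herm y v ^+ q.-1 * invnorm v ^+ r * (zcoord y j +
    (-1) * (zcoord v j * herm y v))) +
  r%:R * (herm v y ^+ p * herm y v ^+ q * invnorm v ^+ r.-1 *
     (2^-1 * (zcoord v j * invnorm v * (1 + (-1) * invnorm v ^+ 2)))).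
Proof.
move=> v0; have hD := derivation_Tbarop j v0; have [h1 h2 h3 h4] := hD.
rewrite /monomial h2; [|by elem..].
rewrite h2; [|by elem..].
rewrite !(derivationX _ hD); [|by elem..].
rewrite Tbarop_hp Tbarop_hpr Tbarop_invnorm//; ring.
Qed.

Lemma Top_monomial j y p q r (v : V) : v != 0 -> Top j (monomial y p q r) v =
  p%:R * (herm v y ^+ p.-1 * herm y v ^+ q * invnorm v ^+ r * (conjc (zcoord y j) +
    (-1) * (conjc (zcoord v j) * herm v y))) +
  r%:R * (herm v y ^+ p * herm y v ^+ q * invnorm v ^+ r.-1 *
     (2^-1 * (conjc (zcoord v j) * invnorm v * (1 + (-1) * invnorm v ^+ 2)))).
Proof.
move=> v0; have hD := derivation_Top j v0; have [h1 h2 h3 h4] := hD.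
rewrite /monomial h2; [|by elem..].
rewrite h2; [|by elem..].
rewrite !(derivationX _ hD); [|by elem..].
rewrite Top_hp Top_hpr Top_invnorm//; ring.
Qed.

Lemma invnorm_val (x : S) : invnorm (val x) = 1.
Proof. by rewrite /invnorm sqnorm_val sqrtr1 invr1. Qed.

(* On the sphere the radial factor contributes nothing: invnorm = 1 there, and a
   tangential derivation kills it. *)
Lemma derivation_radial_factor (D : (V -> R[i]) -> R[i]) (c : V -> R[i]) (x : S) :
  derivation_at (val x) D -> elem c -> D (@invnorm R n) = 0 ->
  D (fun v => 2^-1 * (c v * invnorm v * (1 + (-1) * invnorm v ^+ 2))) = 0.
Proof.
move=> hD sc D0; have [h1 h2 h3 h4] := hD.
rewrite (derivationZ _ hD); [|by elem..].
do 2 (rewrite h2; [|by elem..]).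
rewrite h1; [|by elem..].
rewrite (derivationZ _ hD); [|by elem..].
rewrite (derivationX _ hD); [|by elem..].
rewrite h3 D0 invnorm_val; ring.
Qed.

Lemma derivation_affine (D : (V -> R[i]) -> R[i]) (a : R[i]) (b c : V -> R[i]) v :
  derivation_at v D -> elem b -> elem c ->
  D (fun v => a + (-1) * (b v * c v)) = - (D b * c v + b v * D c).
Proof.
move=> hD sb sc; have [h1 h2 h3 h4] := hD.
rewrite h1; [|by elem..].
rewrite (derivationZ _ hD); [|by elem..].
rewrite h2 ?h3//; ring.
Qed.

Lemma Top_invnorm_sphere j (x : S) : Top j (@invnorm R n) (val x) = 0.
Proof. by rewrite Top_invnorm ?val_neq0// invnorm_val expr1n subrr mulr0. Qed.

Lemma Tbarop_invnorm_sphere j (x : S) : Tbarop j (@invnorm R n) (val x) = 0.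
Proof. by rewrite Tbarop_invnorm ?val_neq0// invnorm_val expr1n subrr mulr0. Qed.

(** The truncated exponent at q = 0 is harmless because the factor q vanishes there. *)
Lemma mulr_predX (z : R[i]) q : q%:R * z ^+ q.-1 * z = q%:R * z ^+ q.
Proof. by case: q => [|q]; rewrite ?mul0r// exprS /=; ring. Qed.

Lemma Top_Tbarop_monomial j y p q r (x : S) :
  Top j (Tbarop j (monomial y p q r)) (val x) =
  (p%:R * q%:R * (herm (val x) y ^+ p.-1 * herm y (val x) ^+ q.-1)) *
    ((conjc (zcoord y j) - conjc (zcoord (val x) j) * herm (val x) y) *
     (zcoord y j - zcoord (val x) j * herm y (val x))) -
  q%:R * (herm (val x) y ^+ p * herm y (val x) ^+ q) *
    (1 - conjc (zcoord (val x) j) * zcoord (val x) j).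
Proof.
have v0 := val_neq0 x.
have hD := derivation_Top j v0; have [h1 h2 h3 h4] := hD.
rewrite (h4 _ _ (fun v v0 => Tbarop_monomial j y p q r v0)).
rewrite h1; [|by elem..].
rewrite !(derivationZ _ hD); [|by elem..].
rewrite [X in r%:R * X]h2; [|by elem..].
rewrite (derivation_radial_factor hD (elem_zcoord R j) (Top_invnorm_sphere j x)).
do 3 (rewrite h2; [|by elem..]).
rewrite !(derivationX _ hD); [|by elem..].
rewrite (derivation_affine _ hD); [|by elem..].
rewrite Top_invnorm_sphere Top_hpr Top_hp Top_zcoord invnorm_val !expr1n.
rewrite [q%:R * (herm (val x) y ^+ p * herm y (val x) ^+ q)]mulrCA -(mulr_predX (herm y (val
  x)) q).
ring.
Qed.

Lemma Tbarop_Top_monomial j y p q r (x : S) :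
  Tbarop j (Top j (monomial y p q r)) (val x) =
  (p%:R * q%:R * (herm (val x) y ^+ p.-1 * herm y (val x) ^+ q.-1)) *
    ((conjc (zcoord y j) - conjc (zcoord (val x) j) * herm (val x) y) *
     (zcoord y j - zcoord (val x) j * herm y (val x))) -
  p%:R * (herm (val x) y ^+ p * herm y (val x) ^+ q) *
    (1 - conjc (zcoord (val x) j) * zcoord (val x) j).
Proof.
have v0 := val_neq0 x.
have hD := derivation_Tbarop j v0; have [h1 h2 h3 h4] := hD.
rewrite (h4 _ _ (fun v v0 => Top_monomial j y p q r v0)).
rewrite h1; [|by elem..].
rewrite !(derivationZ _ hD); [|by elem..].
rewrite [X in r%:R * X]h2; [|by elem..].
rewrite (derivation_radial_factor hD (elem_zcoordJ R j) (Tbarop_invnorm_sphere j x)).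
do 3 (rewrite h2; [|by elem..]).
rewrite !(derivationX _ hD); [|by elem..].
rewrite (derivation_affine _ hD); [|by elem..].
rewrite Tbarop_invnorm_sphere Tbarop_hpr Tbarop_hp Tbarop_zcoordJ invnorm_val !expr1n.
rewrite [p%:R * (herm (val x) y ^+ p * herm y (val x) ^+ q)]mulrA -(mulr_predX (herm (val x)
  y) p).
ring.
Qed.

Definition laplacian (F : V -> R[i]) (v : V) : R[i] :=
  2 * \sum_(j < n.+1) (Top j (Tbarop j F) v + Tbarop j (Top j F) v).

(** On the sphere the gradient products of the two factors sum to 1 - h h', and the sum of 1 -
    |x_j|^2 over j is n. *)
Lemma laplacian_monomial (x y : S) p q r :
  laplacian (monomial (val y) p q r) (val x) =
  4 * p%:R * q%:R * (herm (val x) (val y) ^+ p.-1 * herm (val y) (val x) ^+ q.-1)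
  - (4 * p%:R * q%:R + 2 * n%:R * (p%:R + q%:R)) *
    (herm (val x) (val y) ^+ p * herm (val y) (val x) ^+ q).
Proof.
rewrite /laplacian; under eq_bigr do rewrite Top_Tbarop_monomial Tbarop_Top_monomial.
set h := herm (val x) (val y); set h' := herm (val y) (val x).
set K := p%:R * q%:R * _.
transitivity (2 * \sum_(j < n.+1) (2 * K * (conjc (zcoord (val y) j) * zcoord (val y) j)
   - 2 * K * h' * (zcoord (val x) j * conjc (zcoord (val y) j))
   - 2 * K * h * (zcoord (val y) j * conjc (zcoord (val x) j))
   + 2 * K * h * h' * (zcoord (val x) j * conjc (zcoord (val x) j))
   - (p%:R + q%:R) * (h ^+ p * h' ^+ q) * (1 - zcoord (val x) j * conjc (zcoord (val x) j)))).
  by congr (_ * _); apply: eq_bigr => j _; ring.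
rewrite !big_split /= !sumrN -!mulr_sumr !sumrB sumr_const card_ord -!hpE !hp_self.
rewrite (_ : \sum_(i < n.+1) _ = 1); last first.
  by rewrite -(hp_self y) hpE; apply: eq_bigr => j _; rewrite mulrC.
rewrite -[herm (sval x) _]/h -[herm (sval y) _]/h' -(natr1 n).
have e : K * h * h' = p%:R * q%:R * (h ^+ p * h' ^+ q).
  rewrite /K (_ : _ * h * h' = (p%:R * h ^+ p.-1 * h) * (q%:R * h' ^+ q.-1 * h')); last by ring.
  by rewrite !mulr_predX; ring.
transitivity (2 * (2 * K - 2 * (K * h * h') - (p%:R + q%:R) * (h ^+ p * h' ^+ q) * n%:R)).
  by ring.
rewrite e /K; ring.
Qed.

Lemma elem_cderive (F : V -> R[i]) v : elem F -> elem (cderive v F).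
Proof.
move=> [e1 [e2 h]]; exists (sderiv v e1), (sderiv v e2) => x x0.
have [_ d1] := is_derive_seval e1 v x0; have [_ d2] := is_derive_seval e2 v x0.
rewrite /cderive /=; split; [rewrite -d1|rewrite -d2]; apply: near_eq_derive;
  apply: filterS (near_neq0 x0) => y y0; by have [] := h y y0.
Qed.

Lemma elem_dz j (F : V -> R[i]) : elem F -> elem (dz j F).
Proof.
move=> sF; apply: elemM; last exact: elem_cst.
apply: elemD; first exact: elem_cderive.
apply: (@elem_ext _ _ _ (fun v => (-1) * ('i%C * cderive (ydir R j) F v))).
  by move=> v _; rewrite mulN1r.
by apply: elemM; [exact: elem_cst|apply: elemM; [exact: elem_cst|exact: elem_cderive]].
Qed.

Lemma elem_dzbar j (F : V -> R[i]) : elem F -> elem (dzbar j F).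
Proof.
move=> sF; apply: elemM; last exact: elem_cst.
apply: elemD; first exact: elem_cderive.
by apply: elemM; [exact: elem_cst|exact: elem_cderive].
Qed.

Lemma elem_Top j (F : V -> R[i]) : elem F -> elem (Top j F).
Proof.
move=> sF; apply: elemD; first exact: elem_dz.
apply: (@elem_ext _ _ _ (fun v => (-1) * (conjc (zcoord v j) * Sop F v))).
  by move=> v _; rewrite mulN1r.
apply: elemM; first exact: elem_cst.
apply: elemM; first exact: elem_zcoordJ.
apply: elem_sum => k; apply: elemM; first exact: elem_zcoord.
exact: elem_dz.
Qed.

Lemma elem_Tbarop j (F : V -> R[i]) : elem F -> elem (Tbarop j F).
Proof.
move=> sF; apply: elemD; first exact: elem_dzbar.
apply: (@elem_ext _ _ _ (fun v => (-1) * (zcoord v j * Sbarop F v))).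
  by move=> v _; rewrite mulN1r.
apply: elemM; first exact: elem_cst.
apply: elemM; first exact: elem_zcoord.
apply: elem_sum => k; apply: elemM; first exact: elem_zcoordJ.
exact: elem_dzbar.
Qed.

Lemma laplacian_ext (F G : V -> R[i]) (v : V) : v != 0 -> (forall v, v != 0 -> F v = G v) ->
  laplacian F v = laplacian G v.
Proof.
move=> v0 FG.
have e j : Top j (Tbarop j F) v + Tbarop j (Top j F) v =
    Top j (Tbarop j G) v + Tbarop j (Top j G) v.
  have [_ _ _ h4] := derivation_Top j v0; have [_ _ _ k4] := derivation_Tbarop j v0.
  rewrite (h4 _ (Tbarop j G)); last first.
    by move=> u u0; have [_ _ _ g4] := derivation_Tbarop j u0; exact: g4.
  rewrite (k4 _ (Top j G)); last first.
    by move=> u u0; have [_ _ _ g4] := derivation_Top j u0; exact: g4.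
  by [].
pose A H := fun j => Top j (Tbarop j H) v + Tbarop j (Top j H) v.
have lE H : laplacian H v = 2 * \sum_(j < n.+1) A H j by [].
have AE : A F = A G by apply/funext => j; exact: e.
by clearbody A; rewrite !lE AE.
Qed.

Lemma laplacian_sum (I : Type) (r : seq I) (c : I -> R[i]) (f : I -> V -> R[i]) (v : V) :
  v != 0 -> (forall i, elem (f i)) ->
  laplacian (fun v => \sum_(i <- r) c i * f i v) v = \sum_(i <- r) c i * laplacian (f i) v.
Proof.
move=> v0 sf; rewrite /laplacian.
have scf i : elem (fun v => c i * f i v) by apply: elemM; [exact: elem_cst|].
under [RHS]eq_bigr do rewrite mulrCA mulr_sumr.
rewrite -mulr_sumr exchange_big /=; congr (_ * _); apply: eq_bigr => j _.
under [RHS]eq_bigr do rewrite mulrDr.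
rewrite big_split /=.
have hD := derivation_Top j v0; have [_ _ _ h4] := hD.
have kD := derivation_Tbarop j v0; have [_ _ _ k4] := kD.
congr (_ + _).
- rewrite (h4 _ (fun v => \sum_(i <- r) c i * Tbarop j (f i) v)); last first.
    move=> u u0; have gD := derivation_Tbarop j u0.
    rewrite (derivation_bigsum _ gD scf); apply: eq_bigr => i _.
    exact: (derivationZ _ gD (sf i)).
  rewrite (derivation_bigsum (f := fun i v => c i * Tbarop j (f i) v) _ hD); last first.
    by move=> i; apply: elemM; [exact: elem_cst|exact: elem_Tbarop].
  by apply: eq_bigr => i _; apply: (derivationZ _ hD); exact: elem_Tbarop.
- rewrite (k4 _ (fun v => \sum_(i <- r) c i * Top j (f i) v)); last first.
    move=> u u0; have gD := derivation_Top j u0.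
    rewrite (derivation_bigsum _ gD scf); apply: eq_bigr => i _.
    exact: (derivationZ _ gD (sf i)).
  rewrite (derivation_bigsum (f := fun i v => c i * Top j (f i) v) _ kD); last first.
    by move=> i; apply: elemM; [exact: elem_cst|exact: elem_Top].
  by apply: eq_bigr => i _; apply: (derivationZ _ kD); exact: elem_Top.
Qed.

Lemma subLaplacianE (f : S -> R[i]) x : subLaplacian f x = laplacian (ext f) (val x).
Proof. by []. Qed.

Lemma csmooth_elem (f : S -> R[i]) : elem (ext f) -> csmooth f.
Proof.
move=> [e1 [e2 h]]; split; [apply: (smooth_off0_seval (e := e1))|apply: (smooth_off0_seval (e
  := e2))];
  by move=> v v0; have [] := h v v0.
Qed.

Lemma ext_hp (y v : V) : v != 0 ->
  herm (val (radial_proj v : S)) y = invnorm v * herm v y /\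
  herm y (val (radial_proj v : S)) = invnorm v * herm y v.
Proof.
move=> v0; have e : herm (val (radial_proj v : S)) y = invnorm v * herm v y.
  rewrite val_radial_proj//; apply: eq_ReIm.
    by rewrite Re_mul Re_hp ipZl /= Re_hp; ring.
  by rewrite Im_mul Im_hp ipZl /= Im_hp; ring.
split=> //; rewrite hpC e conjcM -hpC; congr (_ * _).
by apply: eq_ReIm; rewrite /= ?oppr0.
Qed.

Lemma ext_bidegree m k (y v : V) : v != 0 ->
  ext (fun x : S => bidegree m k (val x) y) v =
  \sum_(p < m.+1) \sum_(q < m.+1)
    ((p + m == q + k)%N%:R * (bicoef R n m p q)%:C) * monomial y p q (p + q) v.
Proof.
move=> v0; rewrite /ext /bidegree /bigeg; apply: eq_bigr => p _; apply: eq_bigr => q _.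
have [-> ->] := ext_hp y v0.
by rewrite /monomial !exprMn exprD; ring.
Qed.

Lemma csmooth_bidegree m k (y : V) : csmooth (fun x : S => bidegree m k (val x) y).
Proof.
apply: csmooth_elem; apply: (elem_ext (ext_bidegree m k y)).
by do 2 (apply: elem_sum => ?); apply: elemM; [exact: elem_cst|exact: elem_monomial].
Qed.

Local Notation bic := (bicoef R n).

(** The differential equation of C_m^n read on bidegrees: it links (p, q) to (p + 1, q + 1), the
    pair that the lowering term of L connects. *)
Lemma bicoefS m p q : 4 * p.+1%:R * q.+1%:R * bic m p.+1 q.+1 =
  ((p%:R + q%:R) * (p%:R + q%:R + 2 * n%:R) - m%:R * (m%:R + 2 * n%:R)) * bic m p q.
Proof.
have c : (p.+1%:R * q.+1%:R * 'C(p.+1 + q.+1, p.+1)%:R =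
    (p + q).+2%:R * (p + q).+1%:R * 'C(p + q, p)%:R :> R).
  rewrite -!natrM; congr (_%:R).
  have h1 : (p.+1 * q.+1 * 'C(p.+1 + q.+1, p.+1) * (p`! * q`!) = (p + q).+2`!)%N.
    rewrite -(@bin_fact (p + q).+2 p.+1) ?subSS; last by lia.
    rewrite (_ : ((p + q).+1 - p)%N = q.+1) ?factS; last by lia.
    by rewrite addSn addnS; ring.
  have h2 : ((p + q).+2 * (p + q).+1 * 'C(p + q, p) * (p`! * q`!) = (p + q).+2`!)%N.
    rewrite !factS -(@bin_fact (p + q) p); last by lia.
    by rewrite addKn; ring.
  by apply/eqP; rewrite -(eqn_pmul2r (m := p`! * q`!)) ?muln_gt0 ?fact_gt0// h1 h2.
have g := geg_coef R n m (p + q).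
rewrite /bicoef (_ : (p.+1 + q.+1 = (p + q).+2)%N) in c *; last by rewrite addSn addnS.
rewrite natrD in g.
have -> : 2 ^+ (p + q).+2 = 4 * 2 ^+ (p + q) :> R by rewrite !exprS; ring.
have t0 : 2 ^+ (p + q) != 0 :> R by rewrite expf_neq0.
transitivity ((p.+1%:R * q.+1%:R * 'C((p + q).+2,
  p.+1)%:R) * (geg R n m)`_(p + q).+2 / 2 ^+ (p + q)).
  by field.
rewrite c; transitivity (((p + q).+2%:R * (p + q).+1%:R * (geg R n m)`_(p + q).+2) * 'C(p +
  q, p)%:R / 2 ^+ (p + q)).
  by ring.
by rewrite g; ring.
Qed.

(* L = Delta - T^2, with -m(m + 2n) for Delta and -(k - m)^2 for T^2. *)
Definition sub_eigenvalue m k : R := m%:R * (m%:R + 2 * n%:R) - (k%:R - m%:R) ^+ 2.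

Lemma sub_eigenvalue_ge0 m k : (k < (2 * m).+1)%N -> 0 <= sub_eigenvalue m k.
Proof.
move=> h; have h1 : (k%:R : R) <= 2 * m%:R by rewrite -natrM ler_nat.
rewrite /sub_eigenvalue; have := ler0n R k; have := ler0n R m; have := ler0n R n.
by move=> *; nra.
Qed.

(** After [bicoefS] the coefficient at (p, q) is (p + q)^2 - 4pq - m(m + 2n) times the old one, and
    p - q = k - m on the support. *)
Lemma subLaplacian_bidegree m k (x y : S) :
  subLaplacian (fun x : S => bidegree m k (val x) (val y)) x =
  - (sub_eigenvalue m k)%:C * bidegree m k (val x) (val y).
Proof.
rewrite subLaplacianE (laplacian_ext (val_neq0 x) (ext_bidegree m k (val y))).
pose c (p q : nat) : R[i] := (p + m == q + k)%N%:R * (bic m p q)%:C.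
pose h := herm (val x) (val y); pose h' := herm (val y) (val x).
have -> : (fun v => \sum_(p < m.+1) \sum_(q < m.+1) (c p q * monomial (val y) p q (p + q) v)) =
  (fun v => \sum_(p < m.+1) 1 * \sum_(q < m.+1) (c p q * monomial (val y) p q (p + q) v)).
  by apply/funext => v; apply: eq_bigr => p _; rewrite mul1r.
rewrite laplacian_sum ?val_neq0//; last first.
  by move=> p; apply: elem_sum => q; apply: elemM; [exact: elem_cst|exact: elem_monomial].
under eq_bigr => p _.
  rewrite mul1r laplacian_sum ?val_neq0//; last by move=> q; exact: elem_monomial.
  under eq_bigr do rewrite laplacian_monomial mulrBr.
  rewrite sumrB.
  over.
rewrite sumrB.
(* Shift of both indices in the lowering term: at p = 0 or q = 0 the factor pq vanishes, and past
   the top degree [bicoef] does. *)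
have -> : \sum_(p < m.+1) \sum_(q < m.+1) c p q * (4 * p%:R * q%:R * (h ^+ p.-1 * h' ^+ q.-1)) =
   \sum_(p < m.+1) \sum_(q < m.+1) c p.+1 q.+1 * (4 * p.+1%:R * q.+1%:R * (h ^+ p * h' ^+ q)).
  rewrite big_ord_recl [X in X + _]big1 ?add0r; last by move=> q _; rewrite mulr0 !mul0r mulr0.
  rewrite [RHS]big_ord_recr /= [X in _ = _ + X]big1 ?addr0; last first.
    by move=> q _; rewrite /c bicoef0 ?rmorph0 ?mulr0 ?mul0r// addSn ltnS leq_addr.
  apply: eq_bigr => p _.
  rewrite big_ord_recl [X in X + _](_ : _ = 0) ?add0r; last by rewrite mulr0 !mul0r mulr0.
  rewrite [RHS]big_ord_recr /= [X in _ = _ + X](_ : _ = 0) ?addr0//.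
  by rewrite /c bicoef0 ?rmorph0 ?mulr0 ?mul0r// addnS ltnS leq_addl.
rewrite -sumrB mulr_sumr; apply: eq_bigr => p _.
rewrite -sumrB mulr_sumr; apply: eq_bigr => q _.
rewrite -/h -/h' /c addSn addSn eqSS.
have [e|] := eqVneq (p + m)%N (q + k)%N; last by rewrite !mul0r mulr0 subrr.
rewrite (_ : nat_of_bool true = 1%N)// !mulr1n !mul1r.
have b : 4 * p.+1%:R * q.+1%:R * (bic m p.+1 q.+1)%:C =
  (((p%:R + q%:R) * (p%:R + q%:R + 2 * n%:R) - m%:R * (m%:R + 2 * n%:R)) * bic m p q)%:C.
  by rewrite -bicoefS !rmorphM /= !rmorph_nat.
have kE : k%:R - m%:R = p%:R - q%:R :> R.
  have /(congr1 (fun k => k%:R : R)) := e; rewrite !natrD => e'; lra.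
transitivity ((4 * p.+1%:R * q.+1%:R * (bic m p.+1 q.+1)%:C) * (h ^+ p * h' ^+ q) -
  (bic m p q)%:C * ((4 * p%:R * q%:R + 2 * n%:R * (p%:R + q%:R)) * (h ^+ p * h' ^+ q))).
  by ring.
rewrite b /sub_eigenvalue kE.
rewrite !(rmorphM, rmorphB, rmorphD, rmorphXn) /= !rmorph_nat; ring.
Qed.

End SubLaplacian.

(** * Heat semigroup and heat kernel *)

Section Semigroup.
Variables (R : realType) (n : nat).
Notation V := (Cvec R n).
Notation S := (sphereT R n).

Lemma normc_real (a : R) : 0 <= a -> `|a%:C| = a%:C.
Proof. by move=> a0; rewrite ger0_norm// ler0c. Qed.

Lemma normc_ReE (z : R[i]) : `|z| = (complex.Re `|z|)%:C.
Proof. by rewrite normc_def. Qed.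

Lemma Re_norm_ge0 (z : R[i]) : 0 <= complex.Re `|z|.
Proof. by rewrite -ler0c -normc_ReE. Qed.

Lemma normc_Re_le (z : R[i]) : `|complex.Re z| <= complex.Re `|z|.
Proof.
by rewrite normc_def /= -sqrtr_sqr; apply: ler_wsqrtr; rewrite lerDl sqr_ge0.
Qed.

Lemma normc_Im_le (z : R[i]) : `|complex.Im z| <= complex.Re `|z|.
Proof.
by rewrite normc_def /= -sqrtr_sqr; apply: ler_wsqrtr; rewrite lerDr sqr_ge0.
Qed.

Lemma normc_le_ReIm (z : R[i]) : `|z| <= (`|complex.Re z| + `|complex.Im z|)%:C.
Proof.
have q0 : 0 <= `|complex.Re z| + `|complex.Im z| by exact: addr_ge0.
rewrite normc_def lecR -[leRHS]ger0_norm// -sqrtr_sqr.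
apply: ler_wsqrtr; rewrite sqrrD !real_normK ?num_real//.
by rewrite lerD2r lerDl mulrn_wge0// mulr_ge0.
Qed.

Lemma near_right0 (P : R -> Prop) : (\forall h \near 0^'+, P h) ->
  exists2 d : R, 0 < d & forall h, 0 < h < d -> P h.
Proof.
rewrite /at_right /within /= => /nbhs_ballP [d /= d0 H].
exists d => // h /andP[h0 hd]; apply: H => //=.
by rewrite /ball /= sub0r normrN gtr0_norm.
Qed.

Lemma expRN_sub_le (u : R) : 0 <= u -> `|expR (- u) - (1 - u)| <= u ^+ 2.
Proof.
move=> u0; have h1 : 1 + - u <= expR (- u) by exact: expR_ge1Dx.
have h2 : expR (- u) <= (1 + u)^-1.
  by rewrite expRN lef_pV2 ?posrE ?expR_gt0 ?expR_ge1Dx//; lra.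
have h3 : (1 + u)^-1 <= 1 - u + u ^+ 2.
  rewrite -[leLHS]mul1r ler_pdivrMr; last by lra.
  by have : 0 <= u ^+ 3 by [exact: exprn_ge0]; nra.
by rewrite ger0_norm; lra.
Qed.

Lemma ccontinuous_lin (a : R[i]) (f g : S -> R[i]) : ccontinuous f -> ccontinuous g ->
  ccontinuous (fun x => f x - a * g x).
Proof.
move=> [f1 f2] [g1 g2]; split.
  under eq_fun do rewrite Re_add Re_opp Re_mul opprB -!mulNr addrCA addrC.
  by do 2 try (apply: continuous_rD => //); apply: continuous_rM => //; exact: continuous_rcst.
under eq_fun do rewrite Im_add Im_opp Im_mul opprD -!mulNr.
by do 2 apply: continuous_rD => //; apply: continuous_rM => //; exact: continuous_rcst.
Qed.

Variable E : R -> (S -> R[i]) -> S -> R[i].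
Hypothesis hE : is_heat_semigroup E.

(** The generator and the Taylor expansion of the exponential agree to first order, so the error
    over a short time h is o(h) uniformly in x. *)
Lemma semigroup_step (f : S -> R[i]) (lam M : R) : csmooth f -> ccontinuous f -> 0 <= lam ->
  (forall x, `|f x| <= M%:C) ->
  (forall x, subLaplacian f x = - lam%:C * f x) -> forall eps : R, 0 < eps ->
  exists2 d : R, 0 < d & forall h, 0 < h < d -> forall x,
    `|E h f x - (expR (- (lam * h)))%:C * f x| <= (eps * h)%:C.
Proof.
move=> sf cf l0 fM Lf eps e0.
have M0 : 0 <= M by rewrite -ler0c (le_trans _ (fM north)).
have e2 : 0 < eps / 2 by rewrite divr_gt0.
have [d d0 H] := near_right0 (hs_generator hE sf e2).
have c0 : 0 < lam ^+ 2 * M + 1 by rewrite ltr_wpDl// mulr_ge0// sqr_ge0.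
(* The second bound makes the quadratic Taylor error lam^2 M h^2 at most eps h / 2; the + 1 keeps
   the denominator positive. *)
exists (Num.min d (eps / 2 / (lam ^+ 2 * M + 1))).
  by rewrite lt_min d0 divr_gt0.
move=> h; rewrite lt_min => /and3P[h0 hd he] x.
have h1 := H h; rewrite h0 hd in h1; have {}h1 := h1 isT x.
have hC : h%:C != 0 :> R[i] by rewrite (fmorph_eq0 (real_complex R)) gt_eqF.
have h2 : `|E h f x - f x + (lam * h)%:C * f x| <= (eps / 2 * h)%:C.
  have -> : E h f x - f x + (lam * h)%:C * f x =
    h%:C * ((h%:C)^-1 * (E h f x - f x) - subLaplacian f x).
    by rewrite Lf mulrBr mulVKf// rmorphM /=; ring.
  rewrite normrM (normc_real (ltW h0)) mulrC rmorphM /=.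
  by apply: ler_wpM2r => //; rewrite ler0c ltW.
have -> : E h f x - (expR (- (lam * h)))%:C * f x =
  (E h f x - f x + (lam * h)%:C * f x) - (expR (- (lam * h)) - (1 - lam * h))%:C * f x.
  by rewrite !rmorphB /= rmorph1; ring.
apply: le_trans (ler_normB _ _) _.
have h3 : `|(expR (- (lam * h)) - (1 - lam * h))%:C * f x| <= (eps / 2 * h)%:C.
  rewrite normrM; apply: (@le_trans _ _ (((lam * h) ^+ 2)%:C * M%:C)).
    apply: ler_pM => //.
    rewrite [X in X <= _]normc_def /= expr0n addr0 sqrtr_sqr lecR.
    by apply: expRN_sub_le; rewrite mulr_ge0// ltW.
  rewrite -rmorphM lecR /=; move: he; rewrite ltr_pdivlMr// => he.
  have : (lam ^+ 2 * M) * h <= eps / 2 by lra.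
  by move=> q; rewrite [leLHS](_ : _ = (lam ^+ 2 * M * h) * h); [apply: ler_wpM2r => //;
    exact: ltW|ring].
apply: le_trans (lerD h2 h3) _; rewrite -rmorphD lecR /=.
by rewrite le_eqVlt; apply/orP; left; apply/eqP; field.
Qed.

(* Telescoping: each of the k steps adds an error of at most eps, which the
   contractions do not amplify. *)
Lemma semigroup_iter (f : S -> R[i]) (a h eps : R) : ccontinuous f -> 0 <= a -> a <= 1 ->
  0 <= h ->
  ccontinuous (fun x => E h f x - a%:C * f x) ->
  (forall x, `|E h f x - a%:C * f x| <= eps%:C) ->
  forall k x, `|E (k%:R * h) f x - (a ^+ k)%:C * f x| <= (k%:R * eps)%:C.
Proof.
move=> cf a0 a1 h0 cg H k.
have eps0 : 0 <= eps by rewrite -ler0c (le_trans _ (H north)).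
elim: k => [|k IH] x.
  by rewrite mul0r (hs_zero hE)// expr0 rmorph1 mul1r subrr normr0 mul0r.
have kh0 : 0 <= k%:R * h by rewrite mulr_ge0.
rewrite -natr1 mulrDl mul1r (hs_add hE)//.
have -> : E h f = (fun x => a%:C * f x + (E h f x - a%:C * f x)).
  by apply/funext => y; rewrite addrC subrK.
rewrite (hs_linear hE)//.
have -> : a%:C * E (k%:R * h) f x +
  E (k%:R * h) (fun x0 => E h f x0 - a%:C * f x0) x - (a ^+ k.+1)%:C * f x =
  a%:C * (E (k%:R * h) f x - (a ^+ k)%:C * f x) +
    E (k%:R * h) (fun x0 => E h f x0 - a%:C * f x0) x.
  by rewrite exprS rmorphM /=; ring.
apply: le_trans (ler_normD _ _) _; rewrite mulrDl mul1r rmorphD /=.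
apply: lerD; last exact: (hs_contraction hE).
rewrite normrM normc_real//; apply: le_trans (IH x).
by rewrite -[leRHS]mul1r; apply: ler_wpM2r => //; rewrite -(rmorph1 (real_complex R)) lecR.
Qed.

(** Over N steps of length t/N, each with an error of e/t per unit of time, the total error is at
    most e, for any e > 0. *)
Lemma semigroup_eigen (f : S -> R[i]) (lam t : R) : csmooth f -> cbcont f -> 0 <= lam ->
  (forall x, subLaplacian f x = - lam%:C * f x) -> 0 < t ->
  forall x, E t f x = (expR (- (lam * t)))%:C * f x.
Proof.
move=> sf nf l0 Lf t0 x; have cf := cbcont_ccontinuous nf.
have [M fM] : exists M : R, forall x, `|f x| <= M%:C.
  have [[_ [M1 b1]] [_ [M2 b2]]] := nf.
  exists (M1 + M2) => y; apply: le_trans (normc_le_ReIm _) _.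
  by rewrite lecR lerD.
apply/eqP; rewrite -subr_eq0 -normr_eq0; apply/eqP.
set z := E t f x - _.
rewrite normc_ReE; suff -> : complex.Re `|z| = 0 by [].
apply/eqP; rewrite eq_le Re_norm_ge0 andbT; apply/ler_addgt0Pl => e e0; rewrite addr0.
have et : 0 < e / t by rewrite divr_gt0.
have [d d0 H] := semigroup_step sf cf l0 fM Lf et.
(* Enough steps for each to be shorter than d. *)
pose N := (Num.truncn (t / d)).+1.
have N0 : 0 < N%:R :> R by rewrite ltr0n.
have hd : 0 < t / N%:R < d.
  rewrite divr_gt0//= ltr_pdivrMr// mulrC -ltr_pdivrMr//.
  by rewrite /N; have := truncnS_gt (t / d).
have h0 : 0 <= t / N%:R by rewrite divr_ge0 ?ltW.
have := @semigroup_iter f (expR (- (lam * (t / N%:R)))) (t / N%:R) (e / t * (t / N%:R)) cf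
  _ _ h0 _ (H _ hd) N x.
have -> : N%:R * (t / N%:R) = t by field; rewrite gt_eqF.
have -> : expR (- (lam * (t / N%:R))) ^+ N = expR (- (lam * t)).
  by rewrite -expRM_natl; congr expR; field; rewrite gt_eqF.
have -> : N%:R * (e / t * (t / N%:R)) = e by field; rewrite !gt_eqF.
rewrite -/z normc_ReE lecR; apply => //.
- by rewrite -[leRHS]expR0 ler_expR oppr_le0 mulr_ge0.
- have cE := hs_continuous hE h0 cf.
  exact: ccontinuous_lin.
Qed.

Variable mu : {measure set (sphere_borel R n) -> \bar R}.
Hypotheses (hn : (1 <= n)%N) (hmu : is_uniform mu).
Variable p : R -> S -> R[i].
Hypothesis hp : is_heat_kernel mu E p.

Lemma heat_kernel_bidegree t m k (y : S) : 0 < t -> (k < (2 * m).+1)%N ->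
  cint mu (fun x => p t x * bidegree m k (val x) (val y)) =
  (expR (- (sub_eigenvalue R n m k * t)))%:C * bidegree m k (north_vec R n) (val y).
Proof.
move=> t0 km; have [_ h] := hp t0.
have nf := cbcont_bidegree m k (val y : V) : cbcont (fun x : S => bidegree m k (val x) (val y)).
rewrite /cint -h; last exact: cbcont_ccontinuous.
rewrite (semigroup_eigen (csmooth_bidegree m k (val y)) nf (sub_eigenvalue_ge0 R n km) _ t0)//.
by move=> x; exact: subLaplacian_bidegree.
Qed.

(** The empty list of directions in [smooth_off0] is continuity of the extension off the origin. *)
Lemma heat_kernel_cbcont t : 0 < t -> cbcont (p t).
Proof.
move=> t0; have [[s1 s2] _] := hp t0; split.
  have -> : (fun x => complex.Re (p t x)) = (fun x => complex.Re (ext (p t) (val x))).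
    by apply/funext => x; rewrite /ext radial_proj_val.
  by apply: (bcont_comp (F := fun v : V => complex.Re (ext (p t) v))) => v v0;
    have [_] := s1 [::] v v0.
have -> : (fun x => complex.Im (p t x)) = (fun x => complex.Im (ext (p t) (val x))).
  by apply/funext => x; rewrite /ext radial_proj_val.
by apply: (bcont_comp (F := fun v : V => complex.Im (ext (p t) v))) => v v0;
  have [_] := s2 [::] v v0.
Qed.

Lemma heat_kernel_zonal t m (y : S) : 0 < t ->
  cint mu (fun x => p t x * ((geg R n m).[ip (val x) (val y)])%:C) =
  \sum_(k < (2 * m).+1)
    (expR (- (sub_eigenvalue R n m k * t)))%:C * bidegree m k (north_vec R n) (val y).
Proof.
move=> t0; under [X in cint _ X]eq_fun do rewrite geg_bidegree mulr_sumr.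
rewrite cint_sum//; last first.
  by move=> k; apply: cbcontM; [exact: heat_kernel_cbcont|exact: cbcont_bidegree].
by apply: eq_bigr => k _; exact: heat_kernel_bidegree.
Qed.

End Semigroup.

(** * Zonal functions separate points *)

Section Uniqueness.
Variables (R : realType) (n : nat).
Hypothesis hn : (1 <= n)%N.
Notation V := (Cvec R n).
Notation S := (sphereT R n).
Variable mu : {measure set (sphere_borel R n) -> \bar R}.
Hypothesis hmu : is_uniform mu.

(** So C_m^n has degree exactly m, and these polynomials span all polynomials. *)
Lemma geg_lead_gt0 m : 0 < (geg R n m)`_m.
Proof.
elim: m => [|m IH]; first by rewrite geg0 coefC.
have h := congr1 (fun p : {poly R} => p`_m.+1) (geg_rec R n m).
have p0 : (geg_prev R n m)`_m.+1 = 0.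
  case: m {IH h} => [|m]; first by rewrite geg_prev0 coef0.
  by rewrite geg_prevS nth_default// (leq_trans (size_geg R n m)).
rewrite coefB !coefZ coefXM /= p0 mulr0 subr0 in h.
have m0 : 0 < m.+1%:R :> R by rewrite ltr0n.
rewrite -(pmulr_rgt0 _ m0) h mulr_gt0// mulr_gt0// ltr_wpDl// ltr0n.
exact: hn.
Qed.

Lemma le_geometric_le0 (a A z : R) : 0 <= z -> z < 1 -> (forall j, a <= A * z ^+ j) -> a <= 0.
Proof.
move=> z0 z1 h; have c : A * z ^+ j @[j --> \oo] --> A * 0.
  by apply: cvgMr; apply: cvg_expr; rewrite ger0_norm.
rewrite mulr0 in c; apply: (cvgr_to_ge c).
by apply: nearW.
Qed.

Lemma sqnorm_sub_val (x b : S) : sqnorm (val b - val x) = 2 - 2 * ip (val x) (val b).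
Proof. by rewrite -ip_sqnorm ipBl !ipBr !ip_val (ipC (val b)); ring. Qed.

(** Since |x - b|^2 = 2 - 2<x, b>, the cap of height e^2/2 has all its coordinates within e of those
    of b. *)
Lemma near_cap (f : S -> R) (b : S) (c : R) : continuous f -> c < f b ->
  exists2 d : R, 0 < d & forall x, 1 - d < ip (val x) (val b) -> c < f x.
Proof.
move=> cf cb; have oA : open (f @^-1` [set y | c < y]).
  by apply: open_comp => [x _|]; [exact: cf|exact: open_gt].
have [B oB BA] := oA.
have Bb : B (val b) by rewrite -[B (val b)]/((val @^-1` B) b) BA.
have /nbhs_ballP [e /= e0 eB] : nbhs (val b) B by exact: open_nbhs_nbhs.
exists (e ^+ 2 / 2) => [|x hx]; first by rewrite divr_gt0// exprn_gt0.
have : B (val x).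
  apply: eB; have h : sqnorm (val b - val x) < e ^+ 2 by rewrite sqnorm_sub_val; lra.
  have k j : ((val b).1 ord0 j - (val x).1 ord0 j) ^+ 2 +
    ((val b).2 ord0 j - (val x).2 ord0 j) ^+ 2 < e ^+ 2.
    apply: le_lt_trans h; rewrite /sqnorm (bigD1 j)//= !mxE lerDl sumr_ge0// => i _.
    by rewrite addr_ge0 ?sqr_ge0.
  have sq (a c' : R) : a ^+ 2 + c' ^+ 2 < e ^+ 2 -> `|a| < e.
    move=> ac; rewrite -(@ltr_pXn2r _ 2) ?nnegrE ?(ltW e0)// real_normK ?num_real//.
    by apply: le_lt_trans ac; rewrite lerDl sqr_ge0.
  split; split => // i j; rewrite (ord1 i : i = ord0) /ball /=.
    exact: sq (k j).
  by apply: (sq _ ((val b).1 ord0 j - (val x).1 ord0 j)); rewrite addrC; exact: k.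
by rewrite -[B (val x)]/((val @^-1` B) x) BA.
Qed.

Lemma sint_cap_gt0 (b : S) k : 0 < sint mu (fun x => ((1 + ip (val x) (val b)) / 2) ^+ k).
Proof.
elim: k => [|k IH].
  by under eq_fun do rewrite expr0; rewrite sint_cst// mul1r mass_gt0.
have h := sint_capS hmu b k.
have n0 : 0 <= n%:R :> R by [].
have k0 : 0 <= k%:R :> R by [].
have h1 : 0 < k%:R + 2 * n%:R + 1 :> R by lra.
rewrite -(pmulr_rgt0 _ h1) h mulr_gt0//; lra.
Qed.

(** The ratio (k + n + 1/2)/(k + 2n + 1) of consecutive integrals exceeds q as soon as k(1 - q) >= n
    + 1. *)
Lemma sint_cap_growth (b : S) (q : R) : 0 < q -> q < 1 -> exists K, forall j,
  sint mu (fun x => ((1 + ip (val x) (val b)) / 2) ^+ K) * q ^+ j <=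
  sint mu (fun x => ((1 + ip (val x) (val b)) / 2) ^+ (K + j)).
Proof.
move=> q0 q1; pose K := (Num.truncn ((n%:R + 1) / (1 - q))).+1.
have hK : (n%:R + 1) <= K%:R * (1 - q).
  rewrite -ler_pdivrMr; last lra.
  by apply: ltW; rewrite /K truncnS_gt.
exists K; elim=> [|j IH]; first by rewrite expr0 mulr1 addn0.
have h := sint_capS hmu b (K + j).
have p0 := sint_cap_gt0 b (K + j).
have n0 : 0 <= n%:R :> R by [].
have k0 : K%:R <= (K + j)%:R :> R by rewrite ler_nat leq_addr.
have K0 : 0 < K%:R :> R by rewrite ltr0n.
have h1 : 0 < (K + j)%:R + 2 * n%:R + 1 :> R by lra.
rewrite addnS -(ler_pM2l h1) h exprSr mulrA.
set J := sint mu _ in IH p0 *; set J0 := sint mu _ in IH *.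
apply: (@le_trans _ _ (((K + j)%:R + 2 * n%:R + 1) * (J0 * q))).
  by apply: ler_wpM2l; [exact: ltW|apply: ler_wpM2r => //; exact: ltW].
rewrite mulrCA mulrC; apply: ler_wpM2r; first exact: ltW.
move: k0 hK; set k : R := (K + j)%:R; move: K0; set K' : R := K%:R; set n' : R := n%:R in n0 *.
move=> K0 kK hK; nra.
Qed.

Lemma bcont_cap (b : S) k : bcont (fun x : S => ((1 + ip (val x) (val b)) / 2) ^+ k).
Proof.
apply: bcontX; apply: bcontM; last exact: bcont_cst.
by apply: bcontD; [exact: bcont_cst|exact: bcont_ip].
Qed.

(* The functions ((1 + <x, b>) / 2)^k concentrate at b: their integrals decay
   slower than any geometric sequence, whereas away from b they decay
   geometrically. *)
Lemma cap_orthogonal_le0 (f : S -> R) (b : S) : bcont f ->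
  (forall k, sint mu (fun x => f x * ((1 + ip (val x) (val b)) / 2) ^+ k) = 0) -> f b <= 0.
Proof.
move=> nf H; have [cf [M fM]] := nf; rewrite leNgt; apply/negP => fb.
have c0 : 0 < f b / 2 by rewrite divr_gt0.
set c := f b / 2 in c0.
have [d d0 hd] : exists2 d : R, 0 < d & forall x, 1 - d < ip (val x) (val b) -> c < f x.
  by apply: near_cap => //; rewrite /c; lra.
(* The value of (1 + s)/2 on the edge s = 1 - d of the cap, raised to 1/2 if necessary to stay
   positive. *)
pose q := Num.max (2^-1) (1 - d / 2).
have q0 : 0 < q by rewrite lt_max invr_gt0 ltr0n.
have q1 : q < 1 by rewrite gt_max; apply/andP; split; lra.
have M0 : 0 <= M by apply: le_trans (fM b).
have u01 (x : S) : 0 <= (1 + ip (val x) (val b)) / 2 <= 1.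
  by have := ip_le1 x b; rewrite ler_norml => /andP[h1 h2]; apply/andP; split; lra.
pose J k := sint mu (fun x => ((1 + ip (val x) (val b)) / 2) ^+ k).
(* Pointwise c u^k <= (M + c) q^k + f u^k: inside the cap f > c, outside it f >= -M and u <= q. The
   integral of f u^k is zero. *)
have Jq k : c * J k <= (M + c) * q ^+ k * mass mu.
  have nk := bcont_cap b k.
  have -> : c * J k = sint mu (fun x => c * ((1 +
    ip (val x) (val b)) / 2) ^+ k) by rewrite sintZ.
  have -> : (M + c) * q ^+ k * mass mu =
      sint mu (fun x => (M + c) * q ^+ k + f x * ((1 + ip (val x) (val b)) / 2) ^+ k).
    by rewrite sintD ?sint_cst ?H ?addr0//; [exact: bcont_cst|exact: bcontM].
  apply: sint_le => //; first exact: bcontZ.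
    by apply: bcontD; [exact: bcont_cst|exact: bcontM].
  move=> x; have /andP[ux0 ux1] := u01 x; have := hd x.
  set s := ip (val x) (val b) in ux0 ux1 *; set u := (1 + s) / 2 in ux0 ux1 * => hx.
  have uk0 : 0 <= u ^+ k by exact: exprn_ge0.
  have qk0 : 0 <= q ^+ k by apply: exprn_ge0; exact: ltW.
  have fx := fM x; rewrite ler_norml in fx; move/andP: fx => [fx1 fx2].
  have [hs|hs] := ltP (1 - d) s.
    have := hx hs => hx'; nra.
  have : u ^+ k <= q ^+ k.
    by apply: lerXn2r; rewrite ?nnegrE// ?(ltW q0)// le_max; apply/orP; right; rewrite /u; lra.
  nra.
(* A rate strictly between q and 1: the integrals decay no faster than it, yet no slower than
   q^k. *)
have w0 : 0 < (1 + q) / 2 by lra.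
have w1 : (1 + q) / 2 < 1 by lra.
have [K hK] := sint_cap_growth b w0 w1.
have JK : J K <= 0.
  apply: (@le_geometric_le0 _ ((M + c) * q ^+ K * mass mu / c) (q / ((1 + q) / 2))).
  - by rewrite divr_ge0//; lra.
  - by rewrite ltr_pdivrMr; lra.
  move=> j; rewrite expr_div_n mulrA ler_pdivlMr ?exprn_gt0//; apply: le_trans (hK j) _.
  have := Jq (K + j)%N; rewrite exprD mulrC -ler_pdivlMr// => h; apply: le_trans h _.
  rewrite le_eqVlt; apply/orP; left; apply/eqP; ring.
by have := sint_cap_gt0 b K; rewrite ltNge JK.
Qed.

Lemma zonal_orthogonal_eq0 (f : S -> R) : bcont f ->
  (forall m (y : S), sint mu (fun x => f x * (geg R n m).[ip (val x) (val y)]) = 0) ->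
  forall b, f b = 0.
Proof.
move=> nf H b.
(* Subtracting a multiple of C_N lowers the size, so orthogonality extends to every polynomial in
   <x, b>. *)
have P N : forall (h : {poly R}), (size h <= N)%N ->
    sint mu (fun x => f x * h.[ip (val x) (val b)]) = 0.
  elim: N => [|N IH] h sh.
    rewrite leqn0 size_poly_eq0 in sh; rewrite (eqP sh).
    by under eq_fun do rewrite horner0 mulr0; rewrite sint_cst// mul0r.
  pose a := h`_N / (geg R n N)`_N.
  have sh' : (size (h - a *: geg R n N)%R <= N)%N.
    apply/leq_sizeP => j; rewrite leq_eqVlt => /orP[/eqP <-|Nj].
      by rewrite coefB coefZ /a divfK ?subrr// gt_eqF// geg_lead_gt0.
    by rewrite coefB coefZ !nth_default ?mulr0 ?subr0// (leq_trans _ Nj)// size_geg.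
  rewrite (_ : (fun x => _) = (fun x => f x * (h - a *: geg R n N).[ip (val x) (val b)] +
    a * (f x * (geg R n N).[ip (val x) (val b)]))); last first.
    by apply/funext => x; rewrite hornerD hornerN hornerZ; ring.
  rewrite sintD//; last 2 first.
  - by apply: bcontM => //; exact: bcont_zonal.
  - by apply: bcontZ; apply: bcontM => //; exact: bcont_zonal.
  rewrite IH// sintZ//; last by apply: bcontM => //; exact: bcont_zonal.
  by rewrite H mulr0 addr0.
have Q k : sint mu (fun x => f x * ((1 + ip (val x) (val b)) / 2) ^+ k) = 0.
  rewrite -(P _ ((2^-1 *: (1 + 'X)) ^+ k) (leqnn _)); congr sint; apply/funext => x.
  by rewrite horner_exp hornerZ hornerD hornerX hornerC [2^-1 * _]mulrC.
apply/eqP; rewrite eq_le; apply/andP; split; first exact: cap_orthogonal_le0.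
rewrite -oppr_le0; apply: (cap_orthogonal_le0 (f := fun x => - f x)); first exact: bcontN.
move=> k; under eq_fun do rewrite mulNr.
by rewrite sintN ?Q ?oppr0//; apply: bcontM => //; exact: bcont_cap.
Qed.

Lemma czonal_orthogonal_eq0 (f : S -> R[i]) : cbcont f ->
  (forall m (y : S), cint mu (fun x => f x * ((geg R n m).[ip (val x) (val y)])%:C) = 0) ->
  forall b, f b = 0.
Proof.
move=> [f1 f2] H b; apply: eq_ReIm.
  apply: (zonal_orthogonal_eq0 f1) => m y.
  have := congr1 (@complex.Re R) (H m y); rewrite cintE /= => <-.
  by congr sint; apply/funext => x; rewrite Re_mul /= mulr0 subr0.
apply: (zonal_orthogonal_eq0 f2) => m y.
have := congr1 (@complex.Im R) (H m y); rewrite cintE /= => <-.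
by congr sint; apply/funext => x; rewrite Im_mul /= mulr0 add0r.
Qed.

End Uniqueness.

(** * The series of the subelliptic kernel *)

Section GeometricSeries.
Variables (R : realType).

Lemma cvg_geometric_dominated (u : nat -> R) (C z : R) : 0 <= z -> z < 1 ->
  (forall m, `|u m| <= C * z ^+ m) -> cvgn (series u).
Proof.
move=> z0 z1 h; apply: normed_cvg.
apply: (@series_le_cvg _ _ (geometric C z)) => //.
- by move=> m; exact: normr_ge0.
- by move=> m; apply: le_trans (h m); exact: normr_ge0.
by apply: is_cvg_geometric_series; rewrite ger0_norm.
Qed.

Lemma geometric_dominated_tail (u : nat -> R) (C z : R) N : 0 <= z -> z < 1 ->
  (forall m, `|u m| <= C * z ^+ m) ->
  `|limn (series u) - series u N| <= C * z ^+ N / (1 - z).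
Proof.
move=> z0 z1 h.
have C0 : 0 <= C by have := h 0%N; rewrite expr0 mulr1; exact: le_trans.
have w0 : 0 < 1 - z by rewrite subr_gt0.
have H k : `|series u (N + k)%N - series u N| <= C * z ^+ N * (1 - z ^+ k) / (1 - z).
  elim: k => [|k IH]; first by rewrite addn0 subrr normr0 expr0 subrr mulr0 mul0r.
  rewrite addnS /series /= big_nat_recr//= -/(series u _) addrAC.
  apply: le_trans (ler_normD _ _) _; apply: le_trans (lerD IH (h _)) _.
  rewrite le_eqVlt; apply/orP; left; apply/eqP; rewrite exprD !exprS.
  by field; rewrite gt_eqF.
have cu := cvg_geometric_dominated z0 z1 h.
have cs : `|series u (N + k)%N - series u N| @[k --> \oo] --> `|limn (series u) - series u N|.
  apply: cvg_norm; apply: cvgB; last exact: cvg_cst.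
  rewrite (_ : (fun k => _) = (fun k => series u (k + N)%N)); last first.
    by apply/funext => k; rewrite addnC.
  by rewrite (cvg_shiftn N (series u)); exact: cu.
apply: (cvgr_to_le cs); apply: nearW => k; apply: le_trans (H k) _.
rewrite ler_pM2r ?invr_gt0//; rewrite -[leRHS]mulr1; apply: ler_wpM2l.
  by rewrite mulr_ge0// exprn_ge0.
by rewrite gerBl exprn_ge0.
Qed.

(** Half of the exponential decay absorbs the polynomial, by (a(m + 1))^K <= K! e^(a(m + 1)). *)
Lemma polynomial_geometric (a : R) K : 0 < a -> exists2 C, 0 <= C &
  forall m, m.+1%:R ^+ K * expR (- (2 * a * m%:R)) <= C * expR (- a) ^+ m.
Proof.
move=> a0; exists (K`!%:R / a ^+ K * expR a).
  by rewrite mulr_ge0 ?expR_ge0// divr_ge0// exprn_ge0 ?ltW.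
move=> m; have := exprn_le_fact_expR K (_ : 0 <= a * m.+1%:R) => /(_ _) h.
have {}h : (a * m.+1%:R) ^+ K <= K`!%:R * expR (a * m.+1%:R).
  by apply: h; rewrite mulr_ge0 ?ltW.
rewrite exprMn mulrC -ler_pdivlMr ?exprn_gt0// in h.
apply: (@le_trans _ _ (K`!%:R * expR (a * m.+1%:R) / a ^+ K * expR (- (2 * a * m%:R)))).
  by apply: ler_wpM2r => //; exact: expR_ge0.
rewrite -expRM_natl le_eqVlt; apply/orP; left; apply/eqP.
transitivity (K`!%:R / a ^+ K * (expR (a * m.+1%:R) * expR (- (2 * a * m%:R)))).
  ring.
rewrite -[RHS]mulrA -!expRD; congr (_ * expR _); rewrite -(natr1 m); ring.
Qed.

Lemma uniform_limit_continuousr (T : topologicalType) (F : T -> R) :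
  (forall e, 0 < e -> exists2 G : T -> R, continuous G & forall x, `|F x - G x| <= e) ->
  continuous F.
Proof.
move=> H x; apply/cvgrPdist_lt => e e0.
have e4 : 0 < e / 4 by rewrite divr_gt0.
have [G cG FG] := H _ e4; have := cG x => /cvgrPdist_lt /(_ _ e4).
apply: filterS => y; have := FG x; have := FG y.
by rewrite !ler_norml !ltr_norml => /andP[? ?] /andP[? ?] /andP[? ?]; apply/andP; split; lra.
Qed.

End GeometricSeries.

(** * Uniformly convergent series and their termwise integration *)

Section NiceSeries.
Variables (R : realType) (n : nat).
Notation S := (sphereT R n).
Variable mu : {measure set (sphere_borel R n) -> \bar R}.
Hypothesis hmu : is_uniform mu.

Lemma bcont_series (u : nat -> S -> R) (C z : R) : 0 <= z -> z < 1 ->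
  (forall m, bcont (u m)) -> (forall m x, `|u m x| <= C * z ^+ m) ->
  bcont (fun x => limn (series (fun m => u m x))) /\
  forall g, bcont g -> series (fun m => sint mu (fun x => u m x * g x)) @ \oo -->
    sint mu (fun x => limn (series (fun m => u m x)) * g x).
Proof.
move=> z0 z1 nu ub.
have C0 : 0 <= C by have := ub 0%N north; rewrite expr0 mulr1; exact: le_trans.
have w0 : 0 < 1 - z by rewrite subr_gt0.
pose F x := limn (series (fun m => u m x)).
have T N x : `|F x - series (fun m => u m x) N| <= C * z ^+ N / (1 - z).
  by apply: geometric_dominated_tail => // m; exact: ub.
have nS N : bcont (fun x => series (fun m => u m x) N).
  by rewrite /series /=; apply: bcont_sum.
have c0 (a : R) : C * z ^+ N / (1 - z) * a @[N --> \oo] --> 0.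
  rewrite -[X in _ --> X](mul0r a); apply: cvgMl.
  rewrite -[X in _ --> X](mul0r (1 - z)^-1); apply: cvgMl.
  rewrite -[X in _ --> X](mulr0 C); apply: cvgMr.
  by apply: cvg_expr; rewrite ger0_norm.
have nF : bcont F.
  split; last first.
    exists (C / (1 - z)) => x; have := T 0%N x.
    by rewrite /series /= big_geq// subr0 expr0 mulr1.
  apply: uniform_limit_continuousr => e e0.
  have [N hN] : exists N, C * z ^+ N / (1 - z) <= e.
    have := c0 1 => /cvgrPdist_le /(_ _ e0) [N _ hN]; exists N.
    have := hN N (leqnn N); rewrite /= mulr1 sub0r normrN ger0_norm//.
    by rewrite divr_ge0 ?(ltW w0)// mulr_ge0// exprn_ge0.
  exists (fun x => series (fun m => u m x) N); first by have [] := nS N.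
  by move=> x; exact: le_trans (T N x) hN.
split => // g ng; have [_ [M gM]] := ng.
apply/cvgrPdist_le => e e0.
have := c0 (M * mass mu) => /cvgrPdist_le /(_ _ e0); apply: filterS => N.
rewrite sub0r normrN => hN; apply: le_trans (le_trans (ler_norm _) hN).
rewrite [series _ N](_ : _ = sint mu (fun x => series (fun m => u m x) N * g x)); last first.
  rewrite (_ : (fun x => _ * g x) = (fun x => \sum_(0 <= m < N) u m x * g x)); last first.
    by apply/funext => x; rewrite /series /= mulr_suml.
  by rewrite sint_sum// => i; exact: bcontM.
rewrite -sintB//; [|exact: bcontM..].
rewrite mulrA; apply: sint_bound => //; first by apply: bcontB; exact: bcontM.
by move=> x; rewrite -mulrBl normrM; apply: ler_pM => //; exact: T.
Qed.

Lemma cbcont_series (u : nat -> S -> R[i]) (C z : R) : 0 <= z -> z < 1 ->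
  (forall m, cbcont (u m)) -> (forall m x, `|u m x| <= (C * z ^+ m)%:C) ->
  exists F : S -> R[i], [/\ cbcont F,
   forall x, series (fun m => complex.Re (u m x)) @ \oo --> complex.Re (F x),
   forall x, series (fun m => complex.Im (u m x)) @ \oo --> complex.Im (F x)
   & forall g, bcont g ->
    series (fun m => complex.Re (cint mu (fun x => u m x * (g x)%:C))) @ \oo -->
      complex.Re (cint mu (fun x => F x * (g x)%:C)) /\
    series (fun m => complex.Im (cint mu (fun x => u m x * (g x)%:C))) @ \oo -->
      complex.Im (cint mu (fun x => F x * (g x)%:C))].
Proof.
move=> z0 z1 nu ub.
have b1 m x : `|complex.Re (u m x)| <= C * z ^+ m.
  by apply: le_trans (normc_Re_le _) _; rewrite -lecR -normc_ReE.
have b2 m x : `|complex.Im (u m x)| <= C * z ^+ m.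
  by apply: le_trans (normc_Im_le _) _; rewrite -lecR -normc_ReE.
have [n1 s1] := bcont_series z0 z1 (fun m => (nu m).1) b1.
have [n2 s2] := bcont_series z0 z1 (fun m => (nu m).2) b2.
exists (fun x => limn (series (fun m => complex.Re (u m x))) +i* limn (series (fun m =>
  complex.Im (u m x)))).
split => //.
- by move=> x /=; apply: (cvg_geometric_dominated z0 z1) => m; exact: b1.
- by move=> x /=; apply: (cvg_geometric_dominated z0 z1) => m; exact: b2.
have eR (f : S -> R[i]) (g : S ->
  R) : complex.Re (cint mu (fun x => f x * (g x)%:C)) =
    sint mu (fun x => complex.Re (f x) * g x).
  by rewrite cintE /=; congr sint; apply/funext => x; rewrite Re_mul /= mulr0 subr0.
have eI (f : S -> R[i]) (g : S ->
  R) : complex.Im (cint mu (fun x => f x * (g x)%:C)) =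
    sint mu (fun x => complex.Im (f x) * g x).
  by rewrite cintE /=; congr sint; apply/funext => x; rewrite Im_mul /= mulr0 add0r.
move=> g ng; rewrite eR eI; split.
  by under eq_fun do rewrite eR; exact: s1.
by under eq_fun do rewrite eI; exact: s2.
Qed.

End NiceSeries.

(** * Identification of the heat kernel with its spectral series *)

Section SubellipticSeries.
Variables (R : realType) (n : nat).
Notation V := (Cvec R n).
Notation S := (sphereT R n).
Variable mu : {measure set (sphere_borel R n) -> \bar R}.
Hypotheses (hn : (1 <= n)%N) (hmu : is_uniform mu).

Definition sub_term t m (x : S) : R[i] := ((geg_weight mu m)^-1)%:C *
  \sum_(k < (2 * m).+1) (expR (- (sub_eigenvalue R n m k * t)))%:C *
    bidegree m k (north_vec R n) (val x).

Lemma cbcont_sub_term t m : cbcont (sub_term t m).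
Proof.
apply: cbcontM; first exact: cbcont_cst.
by apply: cbcont_sum => k; apply: cbcontM; [exact: cbcont_cst|exact: cbcont_bidegreer].
Qed.

(** The quadratic parts compensate because |k - m| <= m; the linear gap left over makes the series
    converge. *)
Lemma sub_eigenvalue_ge m k : (k < (2 * m).+1)%N -> 2 * n%:R * m%:R <= sub_eigenvalue R n m k.
Proof.
move=> h; have h1 : (k%:R : R) <= 2 * m%:R by rewrite -natrM ler_nat.
by rewrite /sub_eigenvalue; have := ler0n R k; have := ler0n R m; move=> *; nra.
Qed.

Lemma sub_term_bound t : 0 < t -> exists2 C, 0 <= C &
  forall m x, `|sub_term t m x| <= (C * expR (- (n%:R * t)) ^+ m)%:C.
Proof.
move=> t0; have n0 : 0 < n%:R :> R by rewrite ltr0n.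
have n1 : 1 <= n%:R :> R by rewrite ler1n.
have M0 := mass_gt0 hmu.
have nt0 : 0 < n%:R * t by rewrite mulr_gt0.
(* Exponent 2n + 2: 2n for C_m^n(1), one for the factor m + n of the inverse weight, one for the 2m
   + 1 values of k. *)
have [C C0 hC] := polynomial_geometric (2 * n + 2) nt0.
exists (2 / mass mu * C); first by rewrite mulr_ge0// divr_ge0 ?ltW.
move=> m x; rewrite /sub_term normrM normc_real; last by rewrite invr_ge0 ltW// geg_weight_gt0.
apply: (@le_trans _ _ (((geg_weight mu m)^-1)%:C *
    ((2 * m).+1%:R * (expR (- (2 * (n%:R * t) * m%:R)) * (geg R n m).[1]))%:C)).
  apply: ler_wpM2l; first by rewrite ler0c invr_ge0 ltW// geg_weight_gt0.
  apply: le_trans (ler_norm_sum _ _ _) _.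
  apply: le_trans (_ : \sum_(k < (2 * m).+1) (expR (- (2 * (n%:R * t) * m%:R)) * (geg R n
    m).[1])%:C <= _); last first.
    by rewrite sumr_const card_ord -rmorphMn /= -mulr_natl.
  apply: ler_sum => k _; rewrite normrM normc_real ?expR_ge0// [X in _ <= X]rmorphM.
  apply: ler_pM => //; first by rewrite ler0c expR_ge0.
    rewrite lecR ler_expR lerN2.
    by have := sub_eigenvalue_ge (ltn_ord k) => h; nra.
  exact: (bidegree_bound hmu hn x (ltn_ord k)).
rewrite -rmorphM lecR /=.
rewrite /geg_weight.
have g1 := geg_at1_le R hn m; have g0 := geg_at1_gt0 R hn m.
set e := expR _.
have e0 : 0 <= e by exact: expR_ge0.
have m0 : 0 <= m%:R :> R by [].
have mn : 0 < m%:R + n%:R :> R by lra.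
apply: (@le_trans _ _ (2 / mass mu * (m.+1%:R ^+ (2 * n + 2) * e))); last first.
  rewrite -[leRHS]mulrA; apply: ler_wpM2l; last exact: hC.
  by rewrite divr_ge0 ?ltW.
have -> : (mass mu * n%:R / (m%:R + n%:R))^-1 * ((2 * m).+1%:R * (e * (geg R n m).[1])) =
   (mass mu)^-1 * (((m%:R + n%:R) / n%:R) * (2 * m).+1%:R * (e * (geg R n m).[1])).
  by field; rewrite !gt_eqF.
rewrite [2 / _]mulrC -[leRHS]mulrA; apply: ler_wpM2l; first by rewrite invr_ge0 ltW.
have -> : 2 * (m.+1%:R ^+ (2 * n + 2) * e) =
  (m.+1%:R * (2 * m.+1%:R)) * (e * m.+1%:R ^+ (2 * n)) :> R.
  by rewrite exprD expr2; ring.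
apply: ler_pM.
- by rewrite mulr_ge0// divr_ge0// ltW.
- by rewrite mulr_ge0// ltW.
- apply: ler_pM => //.
    by rewrite ler_pdivrMr// -(natr1 m); nra.
  by rewrite -natrM ler_nat; lia.
- by apply: ler_wpM2l.
Qed.

Lemma sub_term_reproducing t m l (y : S) :
  cint mu (fun x => sub_term t m x * ((geg R n l).[ip (val x) (val y)])%:C) =
  (m == l)%:R * \sum_(k < (2 * m).+1) (expR (- (sub_eigenvalue R n m k * t)))%:C *
    bidegree m k (north_vec R n) (val y).
Proof.
pose c (k : nat) : R[i] := ((geg_weight mu m)^-1)%:C * (expR (- (sub_eigenvalue R n m k *
  t)))%:C.
rewrite (_ : (fun x => _) = (fun x : S => \sum_(k < (2 * m).+1) c k *
   (bidegree m k (north_vec R n) (val x) * ((geg R n l).[ip (val x) (val y)])%:C))); last first.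
  by apply/funext => x; rewrite /sub_term mulr_sumr mulr_suml; apply: eq_bigr => k _;
    rewrite /c; ring.
have nk k : cbcont (fun x : S => bidegree m k (north_vec R n) (val x) * ((geg R n l).[ip (val
  x) (val y)])%:C).
  by apply: cbcontM; [exact: cbcont_bidegreer|apply: cbcont_real; exact: bcont_zonal].
rewrite cint_sum//; last by move=> k; apply: cbcontM => //; exact: cbcont_cst.
rewrite mulr_sumr; apply: eq_bigr => k _; rewrite cintZ// (bidegree_reproducing hmu hn)//.
have w0 : (geg_weight mu m)%:C != 0 :> R[i].
  by rewrite (fmorph_eq0 (real_complex R)) gt_eqF// geg_weight_gt0.
rewrite /c fmorphV /=.
by field.
Qed.

Lemma subelliptic_series t : 0 < t -> exists F : S -> R[i], [/\ cbcont F,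
   forall x, series (fun m => complex.Re (sub_term t m x)) @ \oo --> complex.Re (F x),
   forall x, series (fun m => complex.Im (sub_term t m x)) @ \oo --> complex.Im (F x)
   & forall l (y : S), cint mu (fun x => F x * ((geg R n l).[ip (val x) (val y)])%:C) =
     \sum_(k < (2 * l).+1) (expR (- (sub_eigenvalue R n l k * t)))%:C *
       bidegree l k (north_vec R n) (val y)].
Proof.
move=> t0; have [C C0 hC] := sub_term_bound t0.
have z1 : expR (- (n%:R * t)) < 1.
  by rewrite -[ltRHS]expR0 ltr_expR oppr_lt0 mulr_gt0// ltr0n.
have [F [nF FR FI Fg]] := cbcont_series hmu (expR_ge0 _) z1 (cbcont_sub_term t) hC.
exists F; split => // l y.
(* By orthogonality only the term m = l survives, so the partial sums are constant from l + 1 on. *)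
have key (a : nat -> R) (b L : R) : (forall m, m != l -> a m = 0) -> a l = b ->
    series a @ \oo --> L -> L = b.
  move=> a0 al aL; apply: (cvg_unique _ aL) => //.
  apply: cvg_near_cst; exists l.+1 => // N /= lN.
  rewrite /series /= big_mkord (bigD1 (Ordinal lN))//= al big1 ?addr0// => i il.
  by apply: a0; apply: contra il => /eqP h; apply/eqP/val_inj.
have [h1 h2] := Fg (fun x => (geg R n l).[ip (val x) (val y)]) (bcont_zonal _ _).
apply: eq_ReIm; [apply: key h1|apply: key h2].
- by move=> m ml; rewrite sub_term_reproducing (negbTE ml) mul0r.
- by rewrite sub_term_reproducing eqxx mul1r.
- by move=> m ml; rewrite sub_term_reproducing (negbTE ml) mul0r.
- by rewrite sub_term_reproducing eqxx mul1r.
Qed.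

Variable E : R -> (S -> R[i]) -> S -> R[i].
Hypothesis hE : is_heat_semigroup E.
Variable p : R -> S -> R[i].
Hypothesis hp : is_heat_kernel mu E p.

Lemma heat_kernel_series t x : 0 < t ->
   series (fun m => complex.Re (sub_term t m x)) @ \oo --> complex.Re (p t x) /\
   series (fun m => complex.Im (sub_term t m x)) @ \oo --> complex.Im (p t x).
Proof.
move=> t0; have [F [nF FR FI Fg]] := subelliptic_series t0.
have np := heat_kernel_cbcont hp t0.
suff -> : p t x = F x by split; [exact: FR|exact: FI].
apply/eqP; rewrite -subr_eq0; apply/eqP.
apply: (czonal_orthogonal_eq0 hn hmu (f := fun x => p t x - F x)).
  apply: cbcontD => //; under eq_fun do rewrite -mulN1r; apply: cbcontM => //;
    exact: cbcont_cst.
move=> m y; under eq_fun do rewrite mulrBl.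
have ng : cbcont (fun x : S => ((geg R n m).[ip (val x) (val y)])%:C) by apply: cbcont_real;
  exact: bcont_zonal.
rewrite cintB//; [|exact: cbcontM..].
by rewrite Fg (heat_kernel_zonal hE hmu hp)// subrr.
Qed.

End SubellipticSeries.

(** * Shifting the contour of a Gaussian integral *)

Section GaussianContourShift.
Variables (R : realType) (t a : R).
Hypothesis t0 : 0 < t.
Local Notation leb := (@lebesgue_measure R).

Lemma integrable_expRN_norm (c : R) : 0 < c ->
  leb.-integrable setT (EFin \o (fun y : R => expR (- (c * `|y|)))).
Proof.
move=> c0; have cf : continuous (fun y : R => expR (- (c * `|y|))).
  move=> y; apply: (@continuous_comp _ _ _ (fun y : R => `|y|) (fun s => expR (- (c * s)))).
    exact: norm_continuous.
  rewrite (_ : (fun s => _) = (fun s => expR (- c * s))); first exact: continuous_expRM.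
  by apply/funext => s; rewrite mulNr.
apply/integrableP; split.
  by apply/measurable_EFinP; exact: continuous_measurable_fun.
under eq_integral do rewrite /= ger0_norm ?expR_ge0//.
rewrite ge0_symfun_integralT//=; last by move=> y /=; rewrite normrN.
have -> : [set x : R | 0 <= x] = `[0, +oo[%classic.
  by apply/seteqP; split => x /=; rewrite in_itv /= andbT.
have -> : (\int[leb]_(x in `[0%R, +oo[) (expR (- (c * `|x|)))%:E =
    \int[leb]_(x in `[0%R, +oo[) (expR (- c * x))%:E)%E.
  apply: eq_integral => x; rewrite inE /= in_itv /= andbT => x0.
  by rewrite ger0_norm// mulNr.
by rewrite Rintegral_expRNM// ltry.
Qed.

(* shift_re and shift_im are the real and imaginary parts of
   - u^2 / 4t + a u at u = y + i th; shiftU and shiftV those of its exponential.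
   By the Cauchy-Riemann equations the th-derivative of the integral over y is
   the integral of a y-derivative, so the integral does not depend on th. *)
Definition shift_re (th y : R) := - ((y ^+ 2 - th ^+ 2) / (4 * t)) + a * y.
Definition shift_im (th y : R) := a * th - y * th / (2 * t).

Lemma is_derive_quadratic (al be ga x : R) :
  is_derive x (1 : R) (fun s : R => al * s ^+ 2 + be * s + ga) (2 * al * x + be).
Proof.
pose p : {poly R} := al *: 'X^2 + be *: 'X + ga%:P.
have -> : (fun s : R => al * s ^+ 2 + be * s + ga) = horner p.
  by apply/funext => h; rewrite /p !hornerD !hornerZ hornerXn hornerX hornerC.
have := is_derive_poly p x.
rewrite /p !derivD !derivZ derivXn derivX derivC /= expr1.
rewrite !hornerD !hornerZ hornerMn hornerX hornerC horner0 addr0 mulr1 => h.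
by apply: is_derive_eq h _; ring.
Qed.

Lemma is_derive_expcos (P Q : R -> R) (x p q : R) :
  is_derive x (1 : R) P p -> is_derive x (1 : R) Q q ->
  is_derive x (1 : R) (fun s => expR (P s) * cos (Q s))
    (expR (P x) * (p * cos (Q x) - q * sin (Q x))).
Proof.
move=> dP dQ.
have d1 := @is_derive1_comp _ expR P _ _ _ (is_derive_expR (P x)) dP.
have d2 := @is_derive1_comp _ cos Q _ _ _ (is_derive_cos (Q x)) dQ.
apply: is_derive_eq (is_deriveM d1 d2) _.
by rewrite /GRing.scale /=; ring.
Qed.

Lemma is_derive_expsin (P Q : R -> R) (x p q : R) :
  is_derive x (1 : R) P p -> is_derive x (1 : R) Q q ->
  is_derive x (1 : R) (fun s => expR (P s) * sin (Q s))
    (expR (P x) * (p * sin (Q x) + q * cos (Q x))).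
Proof.
move=> dP dQ.
have d1 := @is_derive1_comp _ expR P _ _ _ (is_derive_expR (P x)) dP.
have d2 := @is_derive1_comp _ sin Q _ _ _ (is_derive_sin (Q x)) dQ.
apply: is_derive_eq (is_deriveM d1 d2) _.
by rewrite /GRing.scale /=; ring.
Qed.

Lemma is_derive_shift_re_th th y : is_derive th (1 : R) (shift_re ^~ y) (th / (2 * t)).
Proof.
have tn : t != 0 by rewrite gt_eqF.
have -> : shift_re ^~ y = fun s => (4 * t)^-1 * s ^+ 2 + 0 * s + (a * y - y ^+ 2 / (4 * t)).
  by apply/funext => s; rewrite /shift_re; ring.
by apply: is_derive_eq (is_derive_quadratic _ _ _ _) _; field.
Qed.

Lemma is_derive_shift_re_y th y : is_derive y (1 : R) (shift_re th) (a - y / (2 * t)).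
Proof.
have tn : t != 0 by rewrite gt_eqF.
have -> : shift_re th = fun s => - (4 * t)^-1 * s ^+ 2 + a * s + th ^+ 2 / (4 * t).
  by apply/funext => s; rewrite /shift_re; ring.
by apply: is_derive_eq (is_derive_quadratic _ _ _ _) _; field.
Qed.

Lemma is_derive_shift_im_th th y : is_derive th (1 : R) (shift_im ^~ y) (a - y / (2 * t)).
Proof.
have -> : shift_im ^~ y = fun s => 0 * s ^+ 2 + (a - y / (2 * t)) * s + 0.
  by apply/funext => s; rewrite /shift_im; ring.
by apply: is_derive_eq (is_derive_quadratic _ _ _ _) _; ring.
Qed.

Lemma is_derive_shift_im_y th y : is_derive y (1 : R) (shift_im th) (- (th / (2 * t))).
Proof.
have -> : shift_im th = fun s => 0 * s ^+ 2 + (- (th / (2 * t))) * s + a * th.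
  by apply/funext => s; rewrite /shift_im; ring.
by apply: is_derive_eq (is_derive_quadratic _ _ _ _) _; ring.
Qed.

Definition shiftU th y := expR (shift_re th y) * cos (shift_im th y).
Definition shiftV th y := expR (shift_re th y) * sin (shift_im th y).
Definition shiftU1 th y := expR (shift_re th y) *
  (th / (2 * t) * cos (shift_im th y) - (a - y / (2 * t)) * sin (shift_im th y)).
Definition shiftV1 th y := expR (shift_re th y) *
  (th / (2 * t) * sin (shift_im th y) + (a - y / (2 * t)) * cos (shift_im th y)).

Lemma is_derive_shiftU_th th y : is_derive th (1 : R) (shiftU ^~ y) (shiftU1 th y).
Proof. exact: is_derive_expcos (is_derive_shift_re_th th y) (is_derive_shift_im_th th y). Qed.

Lemma is_derive_shiftV_th th y : is_derive th (1 : R) (shiftV ^~ y) (shiftV1 th y).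
Proof. exact: is_derive_expsin (is_derive_shift_re_th th y) (is_derive_shift_im_th th y). Qed.

Lemma is_derive_shiftU_y th y : is_derive y (1 : R) (shiftU th) (shiftV1 th y).
Proof.
apply: is_derive_eq (is_derive_expcos (is_derive_shift_re_y th y) (is_derive_shift_im_y th
  y)) _.
by rewrite /shiftV1; ring.
Qed.

Lemma is_derive_shiftV_y th y : is_derive y (1 : R) (shiftV th) (- shiftU1 th y).
Proof.
apply: is_derive_eq (is_derive_expsin (is_derive_shift_re_y th y) (is_derive_shift_im_y th
  y)) _.
by rewrite /shiftU1; ring.
Qed.

Lemma is_derive_continuous (f g : R -> R) : (forall x,
  is_derive x (1 : R) f (g x)) -> continuous f.
Proof.
move=> h x; apply: differentiable_continuous; apply/derivable1_diffP.
by have [] := h x.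
Qed.

Lemma continuous_shiftU th : continuous (shiftU th).
Proof. exact: is_derive_continuous (is_derive_shiftU_y th). Qed.

Lemma continuous_shiftV th : continuous (shiftV th).
Proof. exact: is_derive_continuous (is_derive_shiftV_y th). Qed.

Lemma continuous_affine (b c : R) : continuous (fun y : R => b - y / c).
Proof.
have -> : (fun y : R => b - y / c) = (fun y => 0 * y ^+ 2 + (- c^-1) * y + b).
  by apply/funext => y; ring.
exact: is_derive_continuous (is_derive_quadratic _ _ _).
Qed.

Lemma continuous_shiftU1 th : continuous (shiftU1 th).
Proof.
have -> : shiftU1 th = fun y => th / (2 * t) * shiftU th y +
  (-1) * ((a - y / (2 * t)) * shiftV th y).
  by apply/funext => y; rewrite /shiftU1 /shiftU /shiftV; ring.
apply: continuous_rD; apply: continuous_rM; try exact: continuous_rcst.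
  exact: continuous_shiftU.
by apply: continuous_rM; [exact: continuous_affine|exact: continuous_shiftV].
Qed.

Lemma continuous_shiftV1 th : continuous (shiftV1 th).
Proof.
have -> : shiftV1 th = fun y => th / (2 * t) * shiftV th y + (a - y / (2 * t)) * shiftU th y.
  by apply/funext => y; rewrite /shiftV1 /shiftU /shiftV; ring.
apply: continuous_rD; apply: continuous_rM; try exact: continuous_rcst.
- exact: continuous_shiftV.
- exact: continuous_affine.
- exact: continuous_shiftU.
Qed.

(** Completing the square leaves room for e^(2|y|), hence |a| + 2: one factor pays for 1 + |y|, the
    other for the decay on the right. The bound is uniform for |th| <= T, as differentiation under
    the integral requires. *)
Lemma shift_re_bound (T th y : R) : `|th| <= T ->
  expR (shift_re th y) * (1 + `|y|) <=
  expR (T ^+ 2 / (4 * t) + t * (`|a| + 2) ^+ 2) * expR (- (1 * `|y|)).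
Proof.
move=> hT; have tn : t != 0 by rewrite gt_eqF.
have h1 : 1 + `|y| <= expR `|y| by exact: expR_ge1Dx.
apply: (@le_trans _ _ (expR (shift_re th y) * expR `|y|)).
  by apply: ler_wpM2l => //; exact: expR_ge0.
rewrite -!expRD ler_expR.
have h2 : th ^+ 2 <= T ^+ 2.
  by rewrite -(real_normK (num_real th)); apply: lerXn2r; rewrite ?nnegrE// (le_trans _ hT).
have h3 : a * y <= `|a| * `|y| by rewrite -normrM ler_norm.
have h4 : y ^+ 2 = `|y| ^+ 2 by rewrite real_normK ?num_real.
have h5 : 0 <= (`|y| - 2 * t * (`|a| + 2)) ^+ 2 / (4 * t).
  by rewrite divr_ge0 ?sqr_ge0// mulr_ge0// ltW.
have -> : T ^+ 2 / (4 * t) + t * (`|a| + 2) ^+ 2 + - (1 * `|y|) =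
   (T ^+ 2 - th ^+ 2) / (4 * t) + (`|y| - 2 * t * (`|a| + 2)) ^+ 2 / (4 * t) +
   (- ((y ^+ 2 - th ^+ 2) / (4 * t)) + `|a| * `|y| + `|y|).
  by rewrite h4; field.
have h6 : 0 <= (T ^+ 2 - th ^+ 2) / (4 * t).
  by rewrite divr_ge0 ?subr_ge0// mulr_ge0// ltW.
by rewrite /shift_re; lra.
Qed.

(** One dominating function for the four shift functions on |th| <= T; the prefactor bounds the
    coefficients produced by differentiation, and the + 1 makes it at least 1. *)
Definition shift_dom (T y : R) := (T / (2 * t) + `|a| + (2 * t)^-1 + 1) *
  (expR (T ^+ 2 / (4 * t) + t * (`|a| + 2) ^+ 2) * expR (- (1 * `|y|))).

Lemma shift_factor_bound (T th y d : R) : `|th| <= T -> `|d| <= 1 + `|y| ->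
  `|expR (shift_re th y) * d| <= expR (T ^+ 2 / (4 * t) + t * (`|a| +
    2) ^+ 2) * expR (- (1 * `|y|)).
Proof.
move=> hT hd; apply: le_trans (shift_re_bound y hT).
rewrite normrM ger0_norm ?expR_ge0//; apply: ler_wpM2l => //; exact: expR_ge0.
Qed.

Lemma cos_le_norm (x : R) : `|cos x| <= 1.
Proof. by rewrite ler_norml cos_geN1 cos_le1. Qed.

Lemma sin_le_norm (x : R) : `|sin x| <= 1.
Proof. by rewrite ler_norml sin_geN1 sin_le1. Qed.

Lemma shift_deriv_bound (T th y u v : R) : `|th| <= T -> `|u| <= 1 -> `|v| <= 1 ->
  `|expR (shift_re th y) * (th / (2 * t) * u + (a - y / (2 * t)) * v)| <= shift_dom T y.
Proof.
move=> hT hu hv; have T0 : 0 <= T by apply: le_trans hT.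
set B := T / (2 * t) + `|a| + (2 * t)^-1 + 1.
have t2 : 0 < (2 * t)^-1 by rewrite invr_gt0 mulr_gt0.
have Tt : 0 <= T / (2 * t) by rewrite mulr_ge0// ltW.
have B1 : 1 <= B by rewrite /B; have := normr_ge0 a; lra.
have B0 : 0 < B by lra.
rewrite (_ : _ * _ = B * (expR (shift_re th y) *
  ((th / (2 * t) * u + (a - y / (2 * t)) * v) / B))); last by field; rewrite !gt_eqF.
rewrite normrM (gtr0_norm B0); apply: ler_wpM2l; first exact: ltW.
apply: shift_factor_bound => //.
rewrite normf_div (gtr0_norm B0) ler_pdivrMr//.
apply: le_trans (ler_normD _ _) _; rewrite !normrM.
apply: (@le_trans _ _ (T / (2 * t) + (`|a| + `|y| / (2 * t)))).
  apply: lerD.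
    rewrite -[leRHS]mulr1; apply: ler_pM => //.
    by rewrite (gtr0_norm t2); apply: ler_wpM2r => //; exact: ltW.
  rewrite -[leRHS]mulr1; apply: ler_pM => //.
  apply: le_trans (ler_normB _ _) _; apply: lerD => //.
  by rewrite normrM (gtr0_norm t2).
have y0 := normr_ge0 y; have a0 := normr_ge0 a; rewrite /B; nra.
Qed.

Lemma integrable_shift_dom (T : R) : leb.-integrable setT (EFin \o shift_dom T).
Proof.
apply: RintegrableZl => //; apply: RintegrableZl => //.
exact: integrable_expRN_norm.
Qed.

Lemma shift_bound (T th y u : R) : `|th| <= T -> `|u| <= 1 ->
  `|expR (shift_re th y) * u| <= shift_dom T y.
Proof.
move=> hT hu; apply: (@le_trans _ _ (1 * (expR (T ^+ 2 / (4 * t) + t * (`|a| +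
  2) ^+ 2) * expR (- (1 * `|y|))))).
  by rewrite mul1r; apply: shift_factor_bound => //; apply: le_trans hu _; rewrite lerDl.
apply: ler_wpM2r; first by rewrite mulr_ge0 ?expR_ge0.
have T0 : 0 <= T by apply: le_trans hT.
have t2 : 0 < (2 * t)^-1 by rewrite invr_gt0 mulr_gt0.
have Tt : 0 <= T / (2 * t) by rewrite mulr_ge0// ltW.
by have := normr_ge0 a; lra.
Qed.

Lemma integrable_shiftU th : leb.-integrable setT (EFin \o shiftU th).
Proof.
apply: (@Rle_integrable _ _ _ leb _ _ (shift_dom `|th|)) => //.
- by apply: continuous_measurable_fun; exact: continuous_shiftU.
- by move=> y _; apply: shift_bound => //; exact: cos_le_norm.
- exact: integrable_shift_dom.
Qed.

Lemma integrable_shiftV th : leb.-integrable setT (EFin \o shiftV th).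
Proof.
apply: (@Rle_integrable _ _ _ leb _ _ (shift_dom `|th|)) => //.
- by apply: continuous_measurable_fun; exact: continuous_shiftV.
- by move=> y _; apply: shift_bound => //; exact: sin_le_norm.
- exact: integrable_shift_dom.
Qed.

Lemma shiftU1_bound (T th y : R) : `|th| <= T -> `|shiftU1 th y| <= shift_dom T y.
Proof.
move=> hT; rewrite /shiftU1 -mulrN; apply: shift_deriv_bound => //; first exact: cos_le_norm.
by rewrite normrN sin_le_norm.
Qed.

Lemma shiftV1_bound (T th y : R) : `|th| <= T -> `|shiftV1 th y| <= shift_dom T y.
Proof.
by move=> hT; apply: shift_deriv_bound => //; [exact: sin_le_norm|exact: cos_le_norm].
Qed.

Lemma cvgy_shift_dom T : shift_dom T y @[y --> +oo] --> (0 : R).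
Proof.
rewrite -[X in _ --> X](mulr0 (T / (2 * t) + `|a| + (2 * t)^-1 + 1)); apply: cvgMr.
rewrite -[X in _ --> X](mulr0 (expR (T ^+ 2 / (4 * t) + t * (`|a| + 2) ^+ 2))); apply: cvgMr.
apply: cvg_trans (cvgy_expRNM (ltr01 : 0 < (1 : R))).
apply: near_eq_cvg; apply: filterS (nbhs_pinfty_ge (num_real (0 : R))) => y y0.
by rewrite ger0_norm// mulNr.
Qed.

Lemma cvgy_of_shift_dom T (f : R -> R) : (forall y, `|f y| <= shift_dom T y) ->
  f y @[y --> +oo] --> (0 : R).
Proof.
move=> h; apply: norm_cvg0; apply: (squeeze_cvgr _ (cvg_cst (0 : R)) (cvgy_shift_dom T)).
by apply: nearW => y; rewrite normr_ge0 h.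
Qed.

Lemma cvgNy_of_shift_dom T (f : R -> R) : (forall y, `|f y| <= shift_dom T y) ->
  f y @[y --> -oo] --> (0 : R).
Proof.
move=> h; apply/cvgNy_compNP; apply: (@cvgy_of_shift_dom T) => y.
by apply: le_trans (h _) _; rewrite /shift_dom normrN.
Qed.

Lemma integral_shiftU1 th : \int[leb]_y shiftU1 th y = 0.
Proof.
have h := @integral_deriv_line R (fun y => - shiftU1 th y) (shiftV th).
have i1 : leb.-integrable setT (EFin \o (fun y => shiftU1 th y)).
  apply: (@Rle_integrable _ _ _ leb _ _ (shift_dom `|th|)) => //.
  - by apply: continuous_measurable_fun; exact: continuous_shiftU1.
  - by move=> y _; exact: shiftU1_bound.
  - exact: integrable_shift_dom.
have b y : `|shiftV th y| <= shift_dom `|th| y by apply: shift_bound => //; exact: sin_le_norm.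
have e : (fun y => - shiftU1 th y) = (fun y => (-1) * shiftU1 th y).
  by apply/funext => y; rewrite mulN1r.
have : \int[leb]_y (- shiftU1 th y) = 0.
  apply: h.
  - by rewrite e; exact: RintegrableZl.
  - by rewrite e; apply: continuous_rM; [exact: continuous_rcst|exact: continuous_shiftU1].
  - exact: (cvgy_of_shift_dom b).
  - exact: (cvgNy_of_shift_dom b).
  - exact: is_derive_shiftV_y.
by rewrite e RintegralZl// mulN1r => /eqP; rewrite oppr_eq0 => /eqP.
Qed.

Lemma integral_shiftV1 th : \int[leb]_y shiftV1 th y = 0.
Proof.
have b y : `|shiftU th y| <= shift_dom `|th| y by apply: shift_bound => //; exact: cos_le_norm.
apply: (@integral_deriv_line R _ (shiftU th)).
- apply: (@Rle_integrable _ _ _ leb _ _ (shift_dom `|th|)) => //.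
  + by apply: continuous_measurable_fun; exact: continuous_shiftV1.
  + by move=> y _; exact: shiftV1_bound.
  + exact: integrable_shift_dom.
- exact: continuous_shiftV1.
- exact: (cvgy_of_shift_dom b).
- exact: (cvgNy_of_shift_dom b).
- exact: is_derive_shiftU_y.
Qed.

(** Near each s the derivative may be taken under the integral, dominated by [shift_dom] with T =
    |s| + 1, and it is zero. *)
Lemma integral_shift_cst (f f1 : R -> R -> R) :
  (forall th, leb.-integrable setT (EFin \o f th)) ->
  (forall th y, is_derive th (1 : R) (f ^~ y) (f1 th y)) ->
  (forall T th y, `|th| <= T -> `|f1 th y| <= shift_dom T y) ->
  (forall th, \int[leb]_y f1 th y = 0) ->
  forall th, \int[leb]_y f th y = \int[leb]_y f 0 y.
Proof.
move=> fi fd fb f0 th.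
apply: (is_derive_0_is_cst (f := fun s => \int[leb]_y f s y)) => s.
have Is : `]s - 1, s + 1[%classic s by rewrite /= in_itv /=; lra.
have e x y : partial1of2 f x y = f1 x y by rewrite partial1of2E; have [_ ->] := fd x y.
have D0 y : 0 <= shift_dom (`|s| + 1) y by apply: le_trans (fb (`|s| + 1) 0 y _);
  rewrite ?normr0 ?addr_ge0.
have db x y : `]s - 1, s + 1[%classic x -> [set: R] y ->
  `|partial1of2 f x y| <= shift_dom (`|s| + 1) y.
  rewrite /= in_itv /= => /andP[x1 x2] _; rewrite e; apply: fb.
  have := ler_norm s; have := ler_norm (- s); rewrite normrN ler_norml => *; lra.
have dd x y : `]s - 1, s + 1[%classic x -> [set: R] y -> derivable (f ^~ y) x 1.
  by move=> _ _; have [] := fd x y.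
have c := @cvg_differentiation_under_integral R _ _ leb f setT measurableT s (s - 1) (s +
  1) Is (fun x _ => fi x) dd _ D0 (integrable_shift_dom _) db.
have {}c : h^-1 *: (\int[leb]_y f (h + s) y - \int[leb]_y f s y) @[h --> 0^'] --> (0 : R).
  have e0 : \int[leb]_y partial1of2 f s y = 0.
    by rewrite -(f0 s); congr Rintegral; apply/funext => y; exact: e.
  by rewrite e0 in c.
split.
  by apply/cvg_ex; exists 0; under eq_fun do rewrite /= scaler1.
by apply: cvg_lim => //; under eq_fun do rewrite /= scaler1.
Qed.

Lemma integral_shiftV th : \int[leb]_y shiftV th y = 0.
Proof.
rewrite (integral_shift_cst integrable_shiftV is_derive_shiftV_th shiftV1_bound
  integral_shiftV1).
rewrite (_ : (fun y => shiftV 0 y) = fun y => 0 * shiftV 0 y).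
  by rewrite RintegralZl ?mul0r//; exact: integrable_shiftV.
apply/funext => y; rewrite /shiftV (_ : shift_im 0 y = 0); last by rewrite /shift_im; ring.
by rewrite sin0 mulr0 mul0r.
Qed.

Lemma integral_shiftU th : \int[leb]_y shiftU th y = Num.sqrt (4 * pi * t) * expR (a ^+ 2 * t).
Proof.
rewrite (integral_shift_cst integrable_shiftU is_derive_shiftU_th shiftU1_bound
  integral_shiftU1).
(* At th = 0 the integrand is a multiple of the normal density of mean 2at and variance 2t. *)
pose s := Num.sqrt (2 * t).
have s2 : s ^+ 2 = 2 * t by rewrite sqr_sqrtr// mulr_ge0// ltW.
have s0 : s != 0 by rewrite gt_eqF// sqrtr_gt0 mulr_gt0.
have q0 : Num.sqrt (4 * pi * t) != 0 by rewrite gt_eqF// sqrtr_gt0 !mulr_gt0// pi_gt0.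
have e y : shiftU 0 y = Num.sqrt (4 * pi * t) * expR (a ^+ 2 * t) * normal_pdf (2 * a * t) s y.
  rewrite normal_pdfE// /normal_peak /normal_fun /shiftU s2.
  rewrite (_ : shift_im 0 y = 0); last by rewrite /shift_im; ring.
  rewrite cos0 mulr1 (_ : 2 * t * pi *+ 2 = 4 * pi * t); last by ring.
  rewrite mulrACA divff// mul1r -expRD; congr expR; rewrite /shift_re.
  by field; rewrite gt_eqF.
have -> : \int[leb]_y shiftU 0 y = \int[leb]_y (Num.sqrt (4 * pi * t) * expR (a ^+ 2 * t) *
    normal_pdf (2 * a * t) s y) by apply: eq_Rintegral => y _; exact: e.
have i1 : leb.-integrable setT (EFin \o normal_pdf (2 * a * t) s) by exact:
  integrable_normal_pdf.
by rewrite RintegralZl// /Rintegral integral_normal_pdf /= mulr1.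
Qed.

End GaussianContourShift.

(** * The integral representation *)

Section RealBidegree.
Variables (R : realType) (n : nat).
Local Notation bic := (bicoef R n).

(** The coefficient b_(m,k) of the overview: the component evaluated at two equal real arguments. *)
Definition bireal m k (c : R) : R :=
  \sum_(p < m.+1) \sum_(q < m.+1) (p + m == q + k)%N%:R * (bic m p q * c ^+ p * c ^+ q).

Lemma bigeg_real m k (c : R) : bigeg n m k c%:C c%:C = (bireal m k c)%:C.
Proof.
rewrite /bigeg /bireal rmorph_sum /=; apply: eq_bigr => p _.
rewrite rmorph_sum /=; apply: eq_bigr => q _.
move: (bic m p q) => b.
by rewrite !(rmorphM (real_complex R)) !(rmorphXn (real_complex R)) (rmorph_nat (real_complex
  R)).
Qed.

Lemma bigeg_phase m k (u v a b : R[i]) : u * v = 1 ->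
  u ^+ m * bigeg n m k (u * a) (v * b) = u ^+ k * bigeg n m k a b.
Proof.
move=> uv; rewrite /bigeg !mulr_sumr; apply: eq_bigr => p _.
rewrite !mulr_sumr; apply: eq_bigr => q _.
have [e|] := eqVneq (p + m)%N (q + k)%N; last by rewrite !mul0r !mulr0.
have h : u ^+ m * u ^+ p * v ^+ q = u ^+ k.
  by rewrite -exprD addnC e exprD mulrAC -exprMn uv expr1n mul1r.
rewrite !exprMn -h; ring.
Qed.

(** [bigeg_sum] with u = e^y and v = e^(-y): the hyperbolic rotation replaces the phase by a real
    exponential. *)
Lemma geg_cosh m (c y : R) : (geg R n m).[c * cosh y] =
  \sum_(k < (2 * m).+1) expR ((k%:R - m%:R) * y) * bireal m k c.
Proof.
have uv : (expR y)%:C * (expR (- y))%:C = 1 :> R[i].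
  by rewrite -rmorphM /= -expRD subrr expR0.
have := bigeg_sum n m c%:C c%:C uv.
have -> : ((expR y)%:C * c%:C + (expR (- y))%:C * c%:C) / 2 = (c * cosh y)%:C.
  rewrite -!rmorphM -rmorphD /= -[2](rmorph_nat (real_complex R) 2) -fmorphV -rmorphM /=.
  by congr (_%:C); rewrite /cosh; ring.
rewrite horner_map /= -rmorphXn -rmorphM /=.
under eq_bigr do rewrite bigeg_real -rmorphXn -rmorphM /=.
rewrite -rmorph_sum /= => /(congr1 (@complex.Re R)) /= h.
have -> : (geg R n m).[c * cosh y] =
  expR (- (m%:R * y)) * (expR y ^+ m * (geg R n m).[c * cosh y]).
  by rewrite mulrA -expRM_natl -expRD addNr expR0 mul1r.
rewrite h mulr_sumr; apply: eq_bigr => k _.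
by rewrite mulrA -expRM_natl -expRD; congr (expR _ * _); ring.
Qed.

Variable mu : {measure set (sphere_borel R n) -> \bar R}.
Hypotheses (hn : (1 <= n)%N) (hmu : is_uniform mu).

(** Every s in [-1, 1] is the product of N with e^(i acos s) N, so the bound on the sphere covers
    the interval. *)
Lemma geg_le_at1 m (s : R) : `|s| <= 1 -> `|(geg R n m).[s]| <= (geg R n m).[1].
Proof.
move=> s1; have := geg_bound hn hmu (phase_north n (acos s)) (@north R n) m.
rewrite ip_phase_north (hp_self (@north R n)) mulr1 /= acosK//.
by rewrite in_itv /= -ler_norml.
Qed.

(** In the discrete Fourier formula the polynomial is evaluated at c Re w with w on the unit circle,
    hence within [-1, 1]. *)
Lemma bireal_bound m k (c : R) : `|c| <= 1 -> (k < (2 * m).+1)%N ->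
  `|bireal m k c| <= (geg R n m).[1].
Proof.
move=> c1 km; rewrite -lecR.
have -> : (`|bireal m k c|)%:C = `|bigeg n m k c%:C c%:C|.
  by rewrite bigeg_real normc_def /= expr0n addr0 sqrtr_sqr.
rewrite bigeg_fourier// normrM ger0_norm ?invr_ge0//.
have M0 : 0 < (2 * m).+1%:R :> R[i] by rewrite ltr0n.
rewrite mulrC ler_pdivrMr//.
apply: le_trans (ler_norm_sum _ _ _) _.
apply: le_trans (_ : \sum_(j < (2 * m).+1) ((geg R n m).[1])%:C <= _); last first.
  by rewrite sumr_const card_ord mulr_natr.
apply: ler_sum => j _; rewrite !normrM !normrX normcJ normc_cis !expr1n !mul1r.
set w := rootu R m j.
have -> : (w * c%:C + conjc w * c%:C) / 2 = (c * complex.Re w)%:C.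
  by rewrite -mulrDl addcJ; apply: eq_ReIm; rewrite ?Re_mul ?Im_mul /=; field.
rewrite horner_map /= normc_def /= expr0n addr0 sqrtr_sqr lecR.
apply: geg_le_at1; rewrite normrM; apply: mulr_ile1 => //.
exact: cos_le_norm.
Qed.

Lemma geg_cosh_bound m (c y : R) : `|c| <= 1 ->
  `|(geg R n m).[c * cosh y]| <= (2 * m).+1%:R * (geg R n m).[1] * expR (m%:R * `|y|).
Proof.
move=> c1; rewrite geg_cosh; apply: le_trans (ler_norm_sum _ _ _) _.
apply: (@le_trans _ _ (\sum_(k < (2 * m).+1) (geg R n m).[1] * expR (m%:R * `|y|))); last first.
  by rewrite sumr_const card_ord -[_ *+ (2 * m).+1]mulr_natl mulrA.
apply: ler_sum => k _; rewrite normrM mulrC (ger0_norm (expR_ge0 _)).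
apply: ler_pM; [exact: normr_ge0|exact: expR_ge0|exact: bireal_bound|].
rewrite ler_expR; apply: le_trans (ler_norm _) _; rewrite normrM; apply: ler_wpM2r => //.
have h : (k%:R : R) <= 2 * m%:R by rewrite -natrM ler_nat; have := ltn_ord k.
by rewrite ler_norml; have := ler0n R k; move=> *; apply/andP; split; lra.
Qed.

End RealBidegree.

Lemma Rintegral_lincomb (R : realType) (I : Type) (s : seq I) (a : I -> R) (f : I -> R -> R) :
  (forall i, (@lebesgue_measure R).-integrable setT (EFin \o f i)) ->
  \int[lebesgue_measure]_y (\sum_(i <- s) a i * f i y) =
  \sum_(i <- s) a i * \int[lebesgue_measure]_y f i y.
Proof.
move=> fi.
suff [] : (@lebesgue_measure R).-integrable setT (EFin \o (fun y => \sum_(i <- s) a i * f i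
  y)) /\
  \int[lebesgue_measure]_y (\sum_(i <- s) a i * f i y) =
  \sum_(i <- s) a i * \int[lebesgue_measure]_y f i y by [].
elim: s => [|i s [IH1 IH2]].
  have e0 : (fun y => \sum_(i <- [::]) a i * f i y) = (fun=> 0) by apply/funext => y;
    rewrite big_nil.
  rewrite e0 big_nil; split; first exact: integrable0.
  by rewrite /Rintegral integral0.
have e1 : (fun y => \sum_(j <- i :: s) a j * f j y) =
  (fun y => a i * f i y + \sum_(j <- s) a j * f j y).
  by apply/funext => y; rewrite big_cons.
rewrite e1 big_cons; split; first by apply: RintegrableD => //; exact: RintegrableZl.
by rewrite RintegralD ?RintegralZl ?IH2//; exact: RintegrableZl.
Qed.

(* The modulus of exp (- (y + i theta)^2 / 4t). *)
Definition gauss_mod (R : realType) (t theta y : R) := expR (- ((y ^+ 2 - theta ^+ 2) / (4 *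
  t))).

(** * Bounds and convergence for the Riemannian series *)

Section RiemannianSeries.
Variables (R : realType) (n : nat).
Variable mu : {measure set (sphere_borel R n) -> \bar R}.
Hypotheses (hn : (1 <= n)%N) (hmu : is_uniform mu).

(* C_m^n(c cosh y) grows like e^(m|y|); completing the square with the Gaussian
   and e^(-m^2 t) leaves e^(-2nmt - (|y| - 2mt)^2 / 4t). *)
Lemma riemannian_term_bound (t theta c : R) : 0 < t -> `|c| <= 1 ->
  exists2 C, 0 <= C & forall m y,
  gauss_mod t theta y * `|riemannian_term n t (c * cosh y) m| <=
  C * expR (- (n%:R * t / 2)) ^+ m * expR (- (n%:R / 2 * `|y|)).
Proof.
move=> t0 c1; have n1 : 1 <= n%:R :> R by rewrite ler1n.
have nt0 : 0 < n%:R * t / 2 by rewrite divr_gt0// mulr_gt0//; lra.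
have [C C0 hC] := polynomial_geometric (2 * n + 2) nt0.
(* Half of the decay e^(-2nmt) is traded for e^(-n|y|/2): the completed square is (|y| - 2mt - nt)^2
   / 4t, and n^2 t / 4 is the cost. *)
pose K := expR (theta ^+ 2 / (4 * t) + n%:R ^+ 2 * t / 4).
exists (2 * n%:R * K * C); first by rewrite !mulr_ge0// ?expR_ge0//.
move=> m y; have m0 : 0 <= m%:R :> R by [].
have g0 := geg_at1_gt0 R hn m; have g1 := geg_at1_le R hn m.
rewrite /riemannian_term (gegenbauerE R m hn) !normrM (ger0_norm (expR_ge0 _)) [`|_ +
  _|]ger0_norm ?addr_ge0//.
apply: (@le_trans _ _ (gauss_mod t theta y * ((m%:R + n%:R) * expR (- (m%:R * (m%:R +
  2 * n%:R) * t)) *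
    ((2 * m).+1%:R * (geg R n m).[1] * expR (m%:R * `|y|))))).
  apply: ler_wpM2l; first exact: expR_ge0.
  apply: ler_wpM2l; first by rewrite mulr_ge0 ?expR_ge0 ?addr_ge0.
  exact: (geg_cosh_bound hn hmu m y c1).
apply: (@le_trans _ _ (2 * n%:R * (m.+1%:R ^+ (2 * n + 2)) *
   (gauss_mod t theta y * expR (- (m%:R * (m%:R + 2 * n%:R) * t)) * expR (m%:R * `|y|)))).
  rewrite (_ : gauss_mod t theta y * _ = ((m%:R + n%:R) * (2 * m).+1%:R * (geg R n m).[1]) *
     (gauss_mod t theta y * expR (- (m%:R * (m%:R + 2 * n%:R) * t)) * expR (m%:R * `|y|)));
       last by ring.
  apply: ler_wpM2r; first by rewrite !mulr_ge0 ?expR_ge0.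
  rewrite exprD expr2.
  rewrite (_ : 2 * n%:R * _ = (n%:R * m.+1%:R * (2 * m.+1%:R)) * m.+1%:R ^+ (2 * n));
    last by ring.
  apply: ler_pM; [by rewrite !mulr_ge0 ?addr_ge0|exact: ltW| |exact: g1].
  apply: ler_pM; [by rewrite addr_ge0|by []| |].
    by rewrite -(natr1 m); nra.
  by rewrite -natrM ler_nat; lia.
rewrite /gauss_mod -!expRD.
apply: (@le_trans _ _ (2 * n%:R * (m.+1%:R ^+ (2 * n + 2)) *
   (K * expR (- (2 * (n%:R * t / 2) * m%:R)) * expR (- (n%:R / 2 * `|y|))))).
  apply: ler_wpM2l; first by rewrite !mulr_ge0// exprn_ge0.
  rewrite -!expRD ler_expR.
  have h : 0 <= (`|y| - 2 * m%:R * t - n%:R * t) ^+ 2 / (4 * t).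
    by rewrite divr_ge0 ?sqr_ge0// mulr_ge0// ltW.
  have y2 : y ^+ 2 = `|y| ^+ 2 by rewrite real_normK ?num_real.
  rewrite -subr_ge0 (le_trans h)// y2 le_eqVlt; apply/orP; left; apply/eqP.
  by field; rewrite gt_eqF.
have e : 2 * n%:R * m.+1%:R ^+ (2 * n + 2) *
   (K * expR (- (2 * (n%:R * t / 2) * m%:R)) * expR (- (n%:R / 2 * `|y|))) =
   2 * n%:R * K * (m.+1%:R ^+ (2 * n + 2) * expR (- (2 * (n%:R * t / 2) * m%:R))) *
   expR (- (n%:R / 2 * `|y|)) by ring.
rewrite e -[X in _ <= X * _](mulrA (2 * n%:R * K)); apply: ler_wpM2r; first exact: expR_ge0.
apply: ler_wpM2l; last exact: hC.
by rewrite !mulr_ge0 ?expR_ge0.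
Qed.

(** Any x is c cosh y with |c| <= 1 once y = 2|x|; at this fixed y the Gaussian factor is a positive
    constant and can be divided out. *)
Lemma cvg_riemannian_term (t x : R) : 0 < t -> cvgn (series (riemannian_term n t x)).
Proof.
move=> t0; have x0 := normr_ge0 x; pose y := 2 * `|x|.
have hx : `|x| <= cosh y.
  have := expR_ge1Dx y; have := expR_ge0 (- y); rewrite /cosh /y => *; lra.
have y0 : 0 < cosh y by rewrite divr_gt0// addr_gt0// expR_gt0.
have c1 : `|x / cosh y| <= 1 by rewrite normf_div (gtr0_norm y0) ler_pdivrMr// mul1r.
have [C C0 hC] := riemannian_term_bound 0 t0 c1.
have z1 : expR (- (n%:R * t / 2)) < 1.
  by rewrite -[ltRHS]expR0 ltr_expR oppr_lt0 divr_gt0// mulr_gt0// ltr0n.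
apply: (cvg_geometric_dominated (expR_ge0 _) z1
  (C := C * expR (- (n%:R / 2 * `|y|)) / gauss_mod t 0 y)) => m.
rewrite mulrAC ler_pdivlMr ?expR_gt0// mulrC mulrAC.
by have := hC m y; rewrite divfK// gt_eqF.
Qed.

End RiemannianSeries.

(** * Matching the Gaussian integral with the spectral series *)

Section IntegralRepresentation.
Variables (R : realType) (n : nat).
Notation S := (sphereT R n).
Variable mu : {measure set (sphere_borel R n) -> \bar R}.
Hypotheses (hn : (1 <= n)%N) (hmu : is_uniform mu).
Variables (t theta c : R).
Hypotheses (t0 : 0 < t) (c1 : `|c| <= 1).
Local Notation leb := (@lebesgue_measure R).

Local Notation gauss_mod := (gauss_mod t theta).

Lemma continuous_riemannian_term m : continuous (fun y : R => riemannian_term n t (c * cosh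
  y) m).
Proof.
rewrite /riemannian_term; apply: continuous_rM; first exact: continuous_rcst.
move=> y; apply: (@continuous_comp _ _ _ (fun y : R => c * cosh y) (horner (gegenbauer R n m))).
  have : continuous (fun y : R => c * cosh y).
    apply: continuous_rM; first exact: continuous_rcst.
    apply: continuous_rM; last exact: continuous_rcst.
    by apply: continuous_rD; [exact: continuous_expR|exact: continuous_expRN].
  exact.
exact: continuous_horner.
Qed.

Lemma integral_riemannian_series (e0 : R -> R) : continuous e0 ->
  (forall y, `|e0 y| <= gauss_mod y) ->
  leb.-integrable setT (EFin \o (fun y => e0 y * limn (series (riemannian_term n t (c * cosh
    y))))) /\
  series (fun m => \int[leb]_y (e0 y * riemannian_term n t (c * cosh y) m)) @ \oo -->
    \int[leb]_y (e0 y * limn (series (riemannian_term n t (c * cosh y)))).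
Proof.
move=> ce e0b; have [C C0 hC] := riemannian_term_bound hn hmu theta t0 c1.
have n1 : 1 <= n%:R :> R by rewrite ler1n.
set z := expR (- (n%:R * t / 2)) in hC.
have z0 : 0 <= z by exact: expR_ge0.
have z1 : z < 1.
  by rewrite /z -[ltRHS]expR0 ltr_expR oppr_lt0 divr_gt0// mulr_gt0//; lra.
pose D (y : R) := expR (- (n%:R / 2 * `|y|)) : R.
have iD : leb.-integrable setT (EFin \o D) by apply: integrable_expRN_norm;
  rewrite divr_gt0//; lra.
pose T m y := e0 y * riemannian_term n t (c * cosh y) m.
have Tb m y : `|T m y| <= (C * D y) * z ^+ m.
  rewrite normrM; apply: (@le_trans _ _ (gauss_mod y * `|riemannian_term n t (c * cosh y) m|)).
    by apply: ler_wpM2r.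
  by apply: le_trans (hC m y) _; rewrite /D mulrAC.
have cT m : continuous (T m) by apply: continuous_rM => //; exact: continuous_riemannian_term.
have D0 y : 0 <= D y by exact: expR_ge0.
have iT m : leb.-integrable setT (EFin \o T m).
  apply: (@Rle_integrable _ _ _ leb _ _ (fun y => (C * z ^+ m) * D y)) => //.
  - by apply: continuous_measurable_fun; exact: cT.
  - by move=> y _; apply: le_trans (Tb m y) _; rewrite mulrAC.
  - exact: RintegrableZl.
have limE y : limn (series (T ^~ y)) = e0 y * limn (series (riemannian_term n t (c * cosh y))).
  have cs : cvgn (series (riemannian_term n t (c * cosh y))).
    exact: (cvg_riemannian_term hn hmu).
  apply/cvg_lim => //.
  rewrite (_ : series _ = fun N => e0 y * series (riemannian_term n t (c * cosh y)) N).
    by apply: cvgMr; exact: cs.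
  by apply/funext => N; rewrite /series /= mulr_sumr.
have mS N : measurable_fun [set: R] (fun y => series (T ^~ y) N).
  by rewrite /series /=; apply: continuous_measurable_fun; apply: continuous_sumr => m;
    exact: cT.
have w0 : 0 < 1 - z by rewrite subr_gt0.
(* The tail bounds at N and at 0 add up, hence the factor 2. *)
have Sb N y : `|series (T ^~ y) N| <= (2 * C / (1 - z)) * D y.
  have h1 := geometric_dominated_tail N z0 z1 (fun m => Tb m y).
  have h2 := geometric_dominated_tail 0 z0 z1 (fun m => Tb m y).
  have e2 : series (T ^~ y) 0 = 0 by rewrite /series /= big_geq.
  rewrite e2 subr0 expr0 mulr1 in h2.
  have zN : C * D y * z ^+ N / (1 - z) <= C * D y / (1 - z).
    rewrite ler_pM2r ?invr_gt0// -[leRHS]mulr1; apply: ler_wpM2l; first exact: mulr_ge0.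
    by apply: exprn_ile1 => //; exact: ltW.
  rewrite (_ : 2 * C / (1 - z) * D y = C * D y / (1 - z) + C * D y / (1 - z)); last by ring.
  set L := limn _ in h1 h2; rewrite (_ : series _ N = L - (L - series (T ^~ y) N));
    last by ring.
  by apply: le_trans (ler_normB _ _) _; apply: lerD => //; exact: le_trans zN.
have [|||||i1 i2] := @Rdominated_convergence _ _ _ leb setT (fun N y => series (T ^~ y) N)
   (fun y => e0 y * limn (series (riemannian_term n t (c * cosh y)))) (fun y => (2 * C / (1 -
     z)) * D y).
- by [].
- exact: mS.
- move=> y _; rewrite -limE; apply: (cvg_geometric_dominated z0 z1) => m; exact: Tb.
- exact: RintegrableZl.
- by move=> N y _; exact: Sb.
split; first exact: i1.
rewrite (_ : series _ = fun N => \int[leb]_y series (T ^~ y) N); first exact: i2.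
apply/funext => N; rewrite /series /=.
under [in RHS]eq_Rintegral do under eq_bigr do rewrite -[T _ _]mul1r.
by rewrite Rintegral_lincomb//; apply: eq_bigr => m _; rewrite mul1r.
Qed.

(** With u = y + i theta, the exponential of -u^2/4t + a u has the extra phase e^(i a theta);
    rotating the pair ([shiftU], [shiftV]) back by a theta expresses both integrands. *)
Lemma integral_shift_mode (a : R) :
  \int[leb]_y (expR (a * y) * (gauss_mod y * cos (- (y * theta / (2 * t))))) =
    Num.sqrt (4 * pi * t) * (expR (a ^+ 2 * t) * cos (a * theta)) /\
  \int[leb]_y (expR (a * y) * (gauss_mod y * sin (- (y * theta / (2 * t))))) =
    Num.sqrt (4 * pi * t) * (expR (a ^+ 2 * t) * - sin (a * theta)) /\
  leb.-integrable setT (EFin \o (fun y => expR (a * y) * (gauss_mod y * cos (- (y * theta /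
    (2 * t)))))) /\
  leb.-integrable setT (EFin \o (fun y => expR (a * y) * (gauss_mod y * sin (- (y * theta /
    (2 * t)))))).
Proof.
have iU := integrable_shiftU a t0 theta; have iV := integrable_shiftV a t0 theta.
have E1 : (fun y => expR (a * y) * (gauss_mod y * cos (- (y * theta / (2 * t))))) =
   (fun y => cos (a * theta) * shiftU t a theta y + sin (a * theta) * shiftV t a theta y).
  apply/funext => y; rewrite (_ : - (y * theta / (2 * t)) =
    shift_im t a theta y - a * theta); last first.
    by rewrite /shift_im; ring.
  rewrite cosB /shiftU /shiftV /shift_re expRD -/(gauss_mod y); ring.
have E2 : (fun y => expR (a * y) * (gauss_mod y * sin (- (y * theta / (2 * t))))) =
   (fun y => cos (a * theta) * shiftV t a theta y + (- sin (a * theta)) * shiftU t a theta y).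
  apply/funext => y; rewrite (_ : - (y * theta / (2 * t)) =
    shift_im t a theta y - a * theta); last first.
    by rewrite /shift_im; ring.
  rewrite sinB /shiftU /shiftV /shift_re expRD -/(gauss_mod y); ring.
rewrite E1 E2; split; [|split; [|split]].
- rewrite RintegralD//; [|exact: RintegrableZl..].
  by rewrite !RintegralZl// integral_shiftU// integral_shiftV//; ring.
- rewrite RintegralD//; [|exact: RintegrableZl..].
  by rewrite !RintegralZl// integral_shiftU// integral_shiftV//; ring.
- by apply: RintegrableD => //; exact: RintegrableZl.
- by apply: RintegrableD => //; exact: RintegrableZl.
Qed.

(** Here [phi] stands for the cosine or minus the sine, so one computation serves both parts. The
    Gaussian mode contributes e^((k-m)^2 t), which turns the Riemannian eigenvalue into that of
    L. *)
Lemma integral_riemannian_mode (e0 : R -> R) (phi : R -> R) m :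
  (forall a, \int[leb]_y (expR (a * y) * e0 y) =
    Num.sqrt (4 * pi * t) * (expR (a ^+ 2 * t) * phi a)) ->
  (forall a, leb.-integrable setT (EFin \o (fun y => expR (a * y) * e0 y))) ->
  \int[leb]_y (e0 y * riemannian_term n t (c * cosh y) m) =
  Num.sqrt (4 * pi * t) * ((m%:R + n%:R) * \sum_(k < (2 * m).+1)
     expR (- (sub_eigenvalue R n m k * t)) * phi (k%:R - m%:R) * bireal n m k c).
Proof.
move=> he ie.
have -> : \int[leb]_y (e0 y * riemannian_term n t (c * cosh y) m) =
  \int[leb]_y (\sum_(k < (2 * m).+1) ((m%:R + n%:R) * expR (- (m%:R * (m%:R +
    2 * n%:R) * t)) * bireal n m k c) *
     (expR ((k%:R - m%:R) * y) * e0 y)).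
  apply: eq_Rintegral => y _; rewrite /riemannian_term (gegenbauerE R m hn) geg_cosh !mulr_sumr.
  by apply: eq_bigr => k _; ring.
rewrite Rintegral_lincomb; last by move=> k; exact: ie.
rewrite !mulr_sumr; apply: eq_bigr => k _; rewrite he.
have -> : expR (- (sub_eigenvalue R n m k * t)) =
   expR (- (m%:R * (m%:R + 2 * n%:R) * t)) * expR ((k%:R - m%:R) ^+ 2 * t).
  by rewrite -expRD; congr expR; rewrite /sub_eigenvalue; ring.
ring.
Qed.

Lemma geg_weightV m : (geg_weight mu m)^-1 = Gamma n%:R / (2 * pi ^+ n.+1) * (m%:R + n%:R).
Proof.
have n1 : 1 <= n%:R :> R by rewrite ler1n.
have m0 : 0 <= m%:R :> R by [].
rewrite /geg_weight massE// GammaS//.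
have := Gamma_gt0 n1; set G := Gamma _ => G0.
have p0 : 0 < (pi : R) ^+ n.+1 by rewrite exprn_gt0// pi_gt0.
by field; rewrite !gt_eqF//; lra.
Qed.

Variables (E : R -> (S -> R[i]) -> S -> R[i]) (p : R -> S -> R[i]).
Hypotheses (hE : is_heat_semigroup E) (hp : is_heat_kernel mu E p).
Variable z : S.
Hypothesis hz : zcoord (val z) ord_max = c%:C * cis theta.

Lemma bidegree_phase m k : bidegree m k (north_vec R n) (val z) =
  cis (- ((k%:R - m%:R) * theta)) * (bireal n m k c)%:C.
Proof.
have e1 : herm (north_vec R n) (val z) = cis (- theta) * c%:C.
  by rewrite hp_north hz conjcM conj_cis mulrC; congr (_ * _); apply: eq_ReIm;
    rewrite /= ?oppr0.
have e2 : herm (val z) (north_vec R n) = cis theta * c%:C.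
  by rewrite hpC hp_north conjcK hz mulrC.
rewrite /bidegree e1 e2.
have uv : cis (- theta) * cis theta = 1 by rewrite -cisD addNr cis0.
have := bigeg_phase n m k c%:C c%:C uv; rewrite bigeg_real !cisX => h.
apply: (mulfI (cis_neq0 (m%:R * - theta))); rewrite h mulrA -cisD; congr (cis _ * _); ring.
Qed.

Lemma Re_sub_term m : complex.Re (sub_term mu t m z) = Gamma n%:R / (2 * pi ^+ n.+1) *
  ((m%:R + n%:R) * \sum_(k < (2 * m).+1)
     expR (- (sub_eigenvalue R n m k * t)) * cos ((k%:R - m%:R) * theta) * bireal n m k c).
Proof.
rewrite /sub_term Re_mul /= mul0r subr0 geg_weightV Re_sum mulrA; congr (_ * _).
by apply: eq_bigr => k _; rewrite bidegree_phase !Re_mul !Im_mul /= cosN; ring.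
Qed.

Lemma Im_sub_term m : complex.Im (sub_term mu t m z) = Gamma n%:R / (2 * pi ^+ n.+1) *
  ((m%:R + n%:R) * \sum_(k < (2 * m).+1)
     expR (- (sub_eigenvalue R n m k * t)) * - sin ((k%:R - m%:R) * theta) * bireal n m k c).
Proof.
rewrite /sub_term Im_mul /= mul0r addr0 geg_weightV Im_sum mulrA; congr (_ * _).
by apply: eq_bigr => k _; rewrite bidegree_phase !(Im_mul, Re_mul) /= sinN; ring.
Qed.

(** The real or the imaginary part of the formula: the termwise integrals of the Riemannian series
    are, up to the factor sqrt(4 pi t), the terms of the spectral series. *)
Lemma kernel_part (e0 : R -> R) (phi : R -> R) (u : nat -> R) (L : R) :
  continuous e0 -> (forall y, `|e0 y| <= gauss_mod y) ->
  (forall a, \int[leb]_y (expR (a * y) * e0 y) =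
    Num.sqrt (4 * pi * t) * (expR (a ^+ 2 * t) * phi a)) ->
  (forall a, leb.-integrable setT (EFin \o (fun y => expR (a * y) * e0 y))) ->
  (forall m, u m = Gamma n%:R / (2 * pi ^+ n.+1) *
    ((m%:R + n%:R) * \sum_(k < (2 * m).+1)
     expR (- (sub_eigenvalue R n m k * t)) * phi (k%:R - m%:R) * bireal n m k c)) ->
  series u @ \oo --> L ->
  leb.-integrable setT (EFin \o (fun y => e0 y * riemannian_kernel n t (c * cosh y))) /\
  L = (Num.sqrt (4 * pi * t))^-1 * \int[leb]_y (e0 y * riemannian_kernel n t (c * cosh y)).
Proof.
move=> ce be he ie uE uL; set J := Num.sqrt _; set K := Gamma n%:R / (2 * pi ^+ n.+1) in uE *.
have J0 : J != 0 by rewrite gt_eqF// sqrtr_gt0 !mulr_gt0// pi_gt0.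
have [i1 c1'] := integral_riemannian_series ce be.
have rE : (fun y => e0 y * riemannian_kernel n t (c * cosh y)) =
  (fun y => K * (e0 y * limn (series (riemannian_term n t (c * cosh y))))).
  by apply/funext => y; rewrite /riemannian_kernel -/K mulrCA.
rewrite rE; split; first exact: RintegrableZl.
rewrite RintegralZl// mulrA; apply: (cvg_unique _ uL) => //.
rewrite (_ : series u = fun N => (J^-1 * K) *
    series (fun m => \int[leb]_y (e0 y * riemannian_term n t (c * cosh y) m)) N).
  by apply: cvgMr; exact: c1'.
apply/funext => N; rewrite /series /= mulr_sumr; apply: eq_bigr => m _.
by rewrite uE (integral_riemannian_mode _ he ie) -/J; field.
Qed.

Lemma gauss_cexp (y : R) : cexp (- ((y%:C + 'i * theta%:C) ^+ 2 / (4 * t)%:C)) =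
  (gauss_mod y * cos (- (y * theta / (2 * t)))) +i* (gauss_mod y * sin (- (y * theta / (2 *
    t)))).
Proof.
have -> : - ((y%:C + 'i * theta%:C) ^+ 2 / (4 * t)%:C) =
   (- ((y ^+ 2 - theta ^+ 2) / (4 * t))) +i* (- (y * theta / (2 * t))).
  rewrite -fmorphV /=; apply: eq_ReIm;
    rewrite ?Re_opp ?Im_opp ?Re_mul ?Im_mul expr2 ?Re_mul ?Im_mul ?Re_add ?Im_add ?Re_mul
      ?Im_mul /=.
    by field; rewrite gt_eqF.
  by field; rewrite gt_eqF.
by rewrite /cexp /=; apply: eq_ReIm; rewrite ?Re_mul ?Im_mul /= ?mul0r ?subr0 ?addr0.
Qed.

Lemma heat_kernel_integral : let integrand := fun y : R =>
    cexp (- ((y%:C + 'i * theta%:C) ^+ 2 / (4 * t)%:C)) *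
    (riemannian_kernel n t (c * cosh y))%:C in
  cintegrable leb setT integrand /\
  p t z = ((Num.sqrt (4 * pi * t))^-1)%:C * cintegral leb setT integrand.
Proof.
move=> f; have [cR cI] := heat_kernel_series hn hmu hE hp z t0.
have cg : continuous gauss_mod.
  have -> : gauss_mod = shiftU t 0 0 \* cst (expR (theta ^+ 2 / (4 * t))).
    apply/funext => y; rewrite /gauss_mod /shiftU /shift_re /shift_im /=.
    rewrite (_ : 0 * 0 - y * 0 / (2 * t) = 0); last by ring.
    by rewrite cos0 mulr1 -expRD; congr expR; ring.
  by apply: continuous_rM; [exact: continuous_shiftU|exact: continuous_rcst].
have cl : continuous (fun y : R => - (y * theta / (2 * t))).
  have -> : (fun y : R => - (y * theta / (2 * t))) = (fun y => (- (theta / (2 * t))) * y).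
    by apply/funext => y; ring.
  by move=> y; apply: cvgMr; exact: cvg_id.
have Rf : (fun y => complex.Re (f y)) =
  (fun y => gauss_mod y * cos (- (y * theta / (2 * t))) * riemannian_kernel n t (c * cosh y)).
  by apply/funext => y; rewrite /f gauss_cexp Re_mul /= mulr0 subr0.
have If : (fun y => complex.Im (f y)) =
  (fun y => gauss_mod y * sin (- (y * theta / (2 * t))) * riemannian_kernel n t (c * cosh y)).
  by apply/funext => y; rewrite /f gauss_cexp Im_mul /= mulr0 add0r.
have [i1 e1] : leb.-integrable setT (EFin \o (fun y => complex.Re (f y))) /\
   complex.Re (p t z) = (Num.sqrt (4 * pi * t))^-1 * \int[leb]_y complex.Re (f y).
  rewrite Rf; apply: (kernel_part (phi := fun a => cos (a * theta)) _ _ _ _ Re_sub_term cR).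
  - apply: continuous_rM => // y.
    by apply: (@continuous_comp _ _ _ (fun y : R => - (y * theta / (2 * t))) cos);
      [exact: cl|exact: continuous_cos].
  - move=> y; rewrite normrM (ger0_norm (expR_ge0 _)) -[leRHS]mulr1.
    by apply: ler_wpM2l; [exact: expR_ge0|exact: cos_le_norm].
  - by move=> a; have [] := integral_shift_mode a.
  - by move=> a; have [_ [_ []]] := integral_shift_mode a.
have [i2 e2] : leb.-integrable setT (EFin \o (fun y => complex.Im (f y))) /\
   complex.Im (p t z) = (Num.sqrt (4 * pi * t))^-1 * \int[leb]_y complex.Im (f y).
  rewrite If; apply: (kernel_part (phi := fun a => - sin (a * theta)) _ _ _ _ Im_sub_term cI).
  - apply: continuous_rM => // y.
    by apply: (@continuous_comp _ _ _ (fun y : R => - (y * theta / (2 * t))) sin);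
      [exact: cl|exact: continuous_sin].
  - move=> y; rewrite normrM (ger0_norm (expR_ge0 _)) -[leRHS]mulr1.
    by apply: ler_wpM2l; [exact: expR_ge0|exact: sin_le_norm].
  - by move=> a; have [_ []] := integral_shift_mode a.
  - by move=> a; have [_ [_ []]] := integral_shift_mode a.
split; first by split.
have RM (a : R) (v : R[i]) : complex.Re (a%:C * v) = a * complex.Re v.
  by rewrite Re_mul /= mul0r subr0.
have IM (a : R) (v : R[i]) : complex.Im (a%:C * v) = a * complex.Im v.
  by rewrite Im_mul /= mul0r addr0.
by apply: eq_ReIm; [rewrite RM; exact: e1|rewrite IM; exact: e2].
Qed.

End IntegralRepresentation.

(** Limits and integrals take default values when they diverge; the first two clauses guarantee that
    the third speaks of genuine ones. *)
Theorem proposition3p2 (R : realType) (n : nat) (hn : (1 <= n)%N)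
  (mu : {measure set (sphere_borel R n) -> \bar R}) (hmu : is_uniform mu)
  (E : R -> (sphereT R n -> R[i]) -> (sphereT R n -> R[i]))
  (hE : is_heat_semigroup E)
  (p : R -> sphereT R n -> R[i]) (hp : is_heat_kernel mu E p)
  (t r theta : R) (ht : 0 < t) (hr : 0 <= r < pi / 2)
  (htheta : - pi <= theta <= pi)
  (w : 'rV[R[i]]_n) (hw : rho w = tan r)
  (z : sphereT R n) (hz : forall j, zcoord (val z) j = cylindrical w theta j) :
  let integrand := fun y : R =>
    cexp (- ((y%:C + 'i * theta%:C) ^+ 2 / (4 * t)%:C)) *
    (riemannian_kernel n t (cos r * cosh y))%:C in
  [/\ forall x : R, cvgn (series (riemannian_term n t x)),
      cintegrable lebesgue_measure setT integrand &
      p t z = ((Num.sqrt (4 * pi * t))^-1)%:C *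
              cintegral lebesgue_measure setT integrand].
Proof.
(* Since cos r > 0 for r in [0, pi/2), the factor 1/sqrt(1 + tan^2 r) is cos r itself. *)
have zE : zcoord (val z) ord_max = (cos r)%:C * cis theta.
  rewrite hz; move: hr => /andP[r0 r2].
  have c0 : 0 < cos r by apply: cos_gt0_pihalf; apply/andP; split => //; have := pi_gt0 R; lra.
  rewrite /cylindrical unlift_none mulr1 hw; congr (_ * _).
    congr (_%:C); rewrite (_ : 1 + tan r ^+ 2 = (cos r)^-1 ^+ 2).
      by rewrite sqrtr_sqr gtr0_norm ?invr_gt0// invrK.
    rewrite /tan; apply: (mulIf (expf_neq0 2 (lt0r_neq0 c0))).
    rewrite -exprMn mulVf ?gt_eqF// expr1n mulrDl mul1r -exprMn divfK ?gt_eqF//.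
    exact: cos2Dsin2.
  have -> : 'i * theta%:C = 0 +i* theta by apply: eq_ReIm; rewrite ?Re_mul ?Im_mul /=; ring.
  rewrite /cexp /cis /= expR0.
  by rewrite (rmorph1 (real_complex R)) mul1r.
move=> f; have [i e] := heat_kernel_integral hn hmu ht (cos_le_norm r) hE hp zE.
by split => // x; exact: (cvg_riemannian_term hn hmu).
Qed.
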